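(* Let $\mathcal C$ be one of the classes $\Sigma_{2,\le}$, $\texttt{b-}\Sigma_{2,\le}$, $\texttt{b-}\Sigma^{++}_{2,\le}$. Given a $\mathcal C$-sentence, one can compute in polynomial time an equivalent $\mathcal C$-sentence all of whose atoms involve polynomials of total degree at most four. In particular one can compute in polynomial time an equivalent $\mathcal C$-sentence whose atomic polynomials are given in the standard encoding as lists of (multi-index, coefficient) pairs.
   Context: $\mathcal L$ is the first-order language over the signature $\langle \mathbb Z,+,\times,<,\le\rangle$ with connectives $\land,\lor$ (negation, implication, equality as abbreviations), integer constants in binary, polynomials in atoms given as terms over $\langle\mathbb Z,+,\times\rangle$, interpreted over $\mathbb R$. A $\mathrm{QFF}_\le$-formula is a quantifier-free $\mathcal L$-formula not containing $<$. $I=[-1,1]$; $|X|\le y$ abbreviates $\bigwedge_j(-y\le x_j\le y)$ and $|X|>y$ its negation; $\exists X\in I^m.\forall Y\in I^n.\Phi_0$ abbreviates $\exists X\in\mathbb R^m.\forall Y\in\mathbb R^n.(|Y|>1\lor(|X|\le1\land\Phi_0))$. Classes: $\Sigma_{2,\le}$ = sentences $\exists X\in\mathbb R^m.\forall Y\in\mathbb R^n.\Phi_{0,\le}(X,Y)$; $\texttt{b-}\Sigma_{2,\le}$ = sentences $\exists X\in I^m.\forall Y\in I^n.\Phi_{0,\le}(X,Y)$; $\texttt{b-}\Sigma^{++}_{2,\le}$ = sentences $\exists X\in I^m.\forall Y\in I^n.(\Psi_{0,\le}(Y)\to\Phi_{0,\le}(X,Y))$; here $\Phi_{0,\le},\Psi_{0,\le}$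 are $\mathrm{QFF}_\le$-formulas. Standard encoding of $P\in\mathbb Z[x_1,\dots,x_n]$: a list of pairs $(\alpha_k,c_k)$ with $\alpha_k\in\mathbb N^n$ in unary and $c_k\in\mathbb Z$ in binary such that $P=\sum_kc_kx^{\alpha_k}$. *)

(* Defs.v *)
From Stdlib Require Import Reals ZArith.
From Stdlib Require List.
From mathcomp Require Import all_boot all_algebra.
From mathcomp Require Import mpoly.

Set Implicit Arguments.
Unset Strict Implicit.
Unset Printing Implicit Defensive.

Inductive term : Type :=
| TVar of nat
| TConst of Z
| TAdd of term & term
| TMul of term & term.

Inductive tatom : Type :=
| TLe of term & term
| TLt of term & term.

(* standard encoding of a polynomial: list of (multi-index, coefficient) *)
Definition stdpoly := seq (seq nat * Z).

Inductive satom : Type :=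
| SLe of stdpoly & stdpoly
| SLt of stdpoly & stdpoly.

(* quantifier-free formulas with connectives /\ and \/ over atoms A
   (negation/implication are abbreviations in the paper) *)
Inductive qf (A : Type) : Type :=
| QAtom of A
| QAnd of qf A & qf A
| QOr of qf A & qf A.
Arguments QAtom {A}.

(* sentences of the three shapes.  Variables 0..m-1 are X, m..m+n-1 are Y. *)
Inductive sentence (A : Type) : Type :=
| Sig2 (m n : nat) (phi : qf A)                  (* E X in R^m. A Y in R^n. phi *)
| BSig2 (m n : nat) (phi : qf A)                 (* E X in I^m. A Y in I^n. phi *)
| BSig2pp (m n : nat) (psi : qf A) (phi : qf A). (* E X in I^m. A Y in I^n. psi(Y) -> phi *)

Inductive cls : Type := CSigma2 | CbSigma2 | CbSigma2pp.

Fixpoint teval (v : nat -> R) (t : term) : R :=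
  match t with
  | TVar i => v i
  | TConst z => IZR z
  | TAdd s u => Rplus (teval v s) (teval v u)
  | TMul s u => Rmult (teval v s) (teval v u)
  end.

Definition tatom_holds (v : nat -> R) (a : tatom) : Prop :=
  match a with
  | TLe s t => Rle (teval v s) (teval v t)
  | TLt s t => Rlt (teval v s) (teval v t)
  end.

Fixpoint mon_eval_from (v : nat -> R) (i : nat) (alpha : seq nat) : R :=
  match alpha with
  | [::] => R1
  | a :: al => Rmult (pow (v i) a) (mon_eval_from v (S i) al)
  end.

Fixpoint std_eval (v : nat -> R) (p : stdpoly) : R :=
  match p with
  | [::] => R0
  | (alpha, c) :: q => Rplus (Rmult (IZR c) (mon_eval_from v 0 alpha)) (std_eval v q)
  end.

Definition satom_holds (v : nat -> R) (a : satom) : Prop :=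
  match a with
  | SLe p q => Rle (std_eval v p) (std_eval v q)
  | SLt p q => Rlt (std_eval v p) (std_eval v q)
  end.

Fixpoint qf_holds (A : Type) (ah : (nat -> R) -> A -> Prop) (v : nat -> R)
    (f : qf A) : Prop :=
  match f with
  | QAtom a => ah v a
  | QAnd f1 f2 => qf_holds ah v f1 /\ qf_holds ah v f2
  | QOr f1 f2 => qf_holds ah v f1 \/ qf_holds ah v f2
  end.

Definition valXY (m : nat) (x y : nat -> R) : nat -> R :=
  fun i => if (i < m)%N then x i else y (i - m)%N.

Definition in_box (k : nat) (z : nat -> R) : Prop :=
  forall j, (j < k)%N -> Rle (Ropp R1) (z j) /\ Rle (z j) R1.

(* truth of a sentence, unfolding the paper's abbreviations literally *)
Definition sentence_true (A : Type) (ah : (nat -> R) -> A -> Prop)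
    (s : sentence A) : Prop :=
  match s with
  | Sig2 m n phi =>
      exists x : nat -> R, forall y : nat -> R, qf_holds ah (valXY m x y) phi
  | BSig2 m n phi =>
      exists x : nat -> R, forall y : nat -> R,
        ~ in_box n y \/ (in_box m x /\ qf_holds ah (valXY m x y) phi)
  | BSig2pp m n psi phi =>
      exists x : nat -> R, forall y : nat -> R,
        ~ in_box n y \/
        (in_box m x /\
         (qf_holds ah (valXY m x y) psi -> qf_holds ah (valXY m x y) phi))
  end.

Fixpoint qf_all (A : Type) (P : A -> Prop) (f : qf A) : Prop :=
  match f with
  | QAtom a => P a
  | QAnd f1 f2 => qf_all P f1 /\ qf_all P f2
  | QOr f1 f2 => qf_all P f1 /\ qf_all P f2
  end.

Fixpoint term_vars (t : term) : seq nat :=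
  match t with
  | TVar i => [:: i]
  | TConst _ => [::]
  | TAdd s u => term_vars s ++ term_vars u
  | TMul s u => term_vars s ++ term_vars u
  end.

Definition tatom_ok (lo hi : nat) (a : tatom) : Prop :=
  match a with
  | TLe s t => forall i, i \in term_vars s ++ term_vars t -> (lo <= i < hi)%N
  | TLt _ _ => False
  end.

Definition stdpoly_ok (lo hi : nat) (p : stdpoly) : Prop :=
  forall ac : seq nat * Z, List.In ac p ->
    size ac.1 = hi /\ forall i, (i < lo)%N -> nth 0%N ac.1 i = 0%N.

Definition satom_ok (lo hi : nat) (a : satom) : Prop :=
  match a with
  | SLe p q => stdpoly_ok lo hi p /\ stdpoly_ok lo hi q
  | SLt _ _ => False
  end.

(* s is a C-sentence: right shape, QFF_<= matrices, closed, and Psi only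
   mentions Y *)
Definition in_class (A : Type) (ok : nat -> nat -> A -> Prop) (C : cls)
    (s : sentence A) : Prop :=
  match C, s with
  | CSigma2, Sig2 m n phi => qf_all (ok 0%N (m + n)%N) phi
  | CbSigma2, BSig2 m n phi => qf_all (ok 0%N (m + n)%N) phi
  | CbSigma2pp, BSig2pp m n psi phi =>
      qf_all (ok m (m + n)%N) psi /\ qf_all (ok 0%N (m + n)%N) phi
  | _, _ => False
  end.

Definition nvars (A : Type) (s : sentence A) : nat :=
  match s with
  | Sig2 m n _ | BSig2 m n _ | BSig2pp m n _ _ => (m + n)%N
  end.

Definition sentence_atoms_all (A : Type) (P : A -> Prop) (s : sentence A) : Prop :=
  match s with
  | Sig2 _ _ phi | BSig2 _ _ phi => qf_all P phi
  | BSig2pp _ _ psi phi => qf_all P psi /\ qf_all P phi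
  end.

Definition int_of_Z (z : Z) : int :=
  match z with
  | Z0 => Posz 0
  | Zpos p => Posz (Pos.to_nat p)
  | Zneg p => GRing.opp (Posz (Pos.to_nat p))
  end.

Fixpoint term_mpoly (k : nat) (t : term) : {mpoly int[k]} :=
  match t with
  | TVar i => match @insub nat (fun j => (j < k)%N) 'I_k i with
              | Some j => 'X_j
              | None => 0%R
              end
  | TConst z => (int_of_Z z)%:MP
  | TAdd s u => (term_mpoly k s + term_mpoly k u)%R
  | TMul s u => (term_mpoly k s * term_mpoly k u)%R
  end.

(* total degree <= d  (msize p = 1 + total degree, msize 0 = 0) *)
Definition term_deg_le (k d : nat) (t : term) : Prop :=
  (msize (term_mpoly k t) <= d.+1)%N.

Definition tatom_deg_le (k d : nat) (a : tatom) : Prop :=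
  match a with
  | TLe s t | TLt s t => term_deg_le k d s /\ term_deg_le k d t
  end.

Definition enc_unary (n : nat) : seq bool := nseq n true ++ [:: false].

(* binary digits of a positive, each digit prefixed by a 1, ended by 0 *)
Fixpoint enc_pos_digits (p : positive) : seq bool :=
  match p with
  | xH => [:: true; true]
  | xO q => [:: true; false] ++ enc_pos_digits q
  | xI q => [:: true; true] ++ enc_pos_digits q
  end.

Definition enc_pos (p : positive) : seq bool := enc_pos_digits p ++ [:: false].

Definition enc_Z (z : Z) : seq bool :=
  match z with
  | Z0 => [:: false; false]
  | Zpos p => [:: false; true] ++ enc_pos p
  | Zneg p => [:: true] ++ enc_pos p
  end.

Fixpoint enc_term (t : term) : seq bool :=
  match t with
  | TVar i => [:: false; false] ++ enc_unary i
  | TConst z => [:: false; true] ++ enc_Z z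
  | TAdd s u => [:: true; false] ++ enc_term s ++ enc_term u
  | TMul s u => [:: true; true] ++ enc_term s ++ enc_term u
  end.

Definition enc_tatom (a : tatom) : seq bool :=
  match a with
  | TLe s t => [:: false] ++ enc_term s ++ enc_term t
  | TLt s t => [:: true] ++ enc_term s ++ enc_term t
  end.

Fixpoint enc_list (T : Type) (e : T -> seq bool) (l : seq T) : seq bool :=
  match l with
  | [::] => [:: false]
  | x :: r => [:: true] ++ e x ++ enc_list e r
  end.

Definition enc_stdpoly (p : stdpoly) : seq bool :=
  enc_list (fun ac => enc_list enc_unary ac.1 ++ enc_Z ac.2) p.

Definition enc_satom (a : satom) : seq bool :=
  match a with
  | SLe p q => [:: false] ++ enc_stdpoly p ++ enc_stdpoly q
  | SLt p q => [:: true] ++ enc_stdpoly p ++ enc_stdpoly q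
  end.

Fixpoint enc_qf (A : Type) (e : A -> seq bool) (f : qf A) : seq bool :=
  match f with
  | QAtom a => [:: false] ++ e a
  | QAnd f1 f2 => [:: true; false] ++ enc_qf e f1 ++ enc_qf e f2
  | QOr f1 f2 => [:: true; true] ++ enc_qf e f1 ++ enc_qf e f2
  end.

Definition enc_sentence (A : Type) (e : A -> seq bool) (s : sentence A) : seq bool :=
  match s with
  | Sig2 m n phi => [:: false; false] ++ enc_unary m ++ enc_unary n ++ enc_qf e phi
  | BSig2 m n phi => [:: false; true] ++ enc_unary m ++ enc_unary n ++ enc_qf e phi
  | BSig2pp m n psi phi =>
      [:: true] ++ enc_unary m ++ enc_unary n ++ enc_qf e psi ++ enc_qf e phi
  end.

(* Polynomial-time computability: deterministic one-tape Turing        *)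
(* machines over the tape alphabet {blank, 0, 1} (option bool)         *)

Inductive move : Type := MLeft | MRight | MStay.

(* finitely many states 'I_k.+2; state 0 is initial, state 1 is halting *)
Record TM : Type := {
  tm_k : nat;
  tm_delta : 'I_tm_k.+2 -> option bool -> 'I_tm_k.+2 * option bool * move
}.

Definition tm_start (M : TM) : 'I_(tm_k M).+2 := @Ordinal (tm_k M).+2 0 isT.
Definition tm_halt (M : TM) : 'I_(tm_k M).+2 := @Ordinal (tm_k M).+2 1 isT.

(* configuration: state, tape left of the head (nearest first), scanned
   symbol, tape right of the head; all other cells are blank *)
Record config (M : TM) : Type := Config {
  c_state : 'I_(tm_k M).+2;
  c_left : seq (option bool);
  c_head : option bool;
  c_right : seq (option bool)
}.

Definition tm_step (M : TM) (c : config M) : config M :=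
  if c_state c == tm_halt M then c else
  let: (q', w, mv) := tm_delta (c_state c) (c_head c) in
  match mv with
  | MStay => Config q' (c_left c) w (c_right c)
  | MLeft => match c_left c with
             | [::] => Config q' [::] None (w :: c_right c)
             | x :: l => Config q' l x (w :: c_right c)
             end
  | MRight => match c_right c with
              | [::] => Config q' (w :: c_left c) None [::]
              | x :: r => Config q' (w :: c_left c) x r
              end
  end.

Fixpoint tm_run (M : TM) (t : nat) (c : config M) : config M :=
  match t with
  | 0 => c
  | S t' => tm_run t' (tm_step c)
  end.

Definition tm_init (M : TM) (w : seq bool) : config M :=
  match w with
  | [::] => Config (tm_start M) [::] None [::]
  | b :: w' => Config (tm_start M) [::] (Some b) (map Some w')
  end.

Fixpoint read_word (s : seq (option bool)) : seq bool :=
  match s with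
  | Some b :: r => b :: read_word r
  | _ => [::]
  end.

Definition tm_output (M : TM) (c : config M) : seq bool :=
  read_word (c_head c :: c_right c).

Definition poly_time_computable (g : seq bool -> seq bool) : Prop :=
  exists (M : TM) (c d : nat), forall w : seq bool,
    exists t : nat, (t <= c * (size w) ^ d + c)%N /\
      c_state (tm_run t (tm_init M w)) = tm_halt M /\
      tm_output (tm_run t (tm_init M w)) = g w.

(* Main.v *)
Require Import Defs.
From Stdlib Require Import Reals ZArith.
From mathcomp Require Import all_boot all_algebra.
From mathcomp Require Import mpoly.
From Stdlib Require Import Lia Lra Classical FunctionalExtensionality.
From mathcomp Require Import zify.

(** Every node [v] of every atom gets a fresh universally quantified variable
    [z_v], intended to equal [s * val v] for a universally quantified scale [s].
    An equation defining [z_v] cannot be assumed, because its negation is a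
    strict inequality; instead an atom [t <= u] of [Phi] becomes the disjunction
    of [z_t <= z_u + s^2] with closed escape clauses: an equation is off by at
    least [delta], or [|z_v| >= 1], or [s] is outside ]0, 1[, or [delta <= 0], or
    the chain [s = u_0, ..., u_L = delta] does not satisfy
    [u_(i+1) < (s / 4) * u_i].  If no clause holds, [delta] is so small that
    [|z_v - s * val v| <= delta * (4 / s)^N] is negligible against [s^2], so
    [t <= u] implies the disjunction.  Conversely exact values of the [z_v] make
    every clause false, and [val t <= val u + s] for all small [s] gives
    [t <= u].  In [Psi] the equations can be assumed exactly.  All atoms have
    degree at most two.

    The translation replaces atoms in place, so it is computed by one pass over
    the prefix encoding that keeps a stack of the variables whose defining terms
    are still to be read.  The pass is written in a small language for machines
    with several stacks, which is compiled to one-tape Turing machines. *)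

Set Implicit Arguments.
Unset Strict Implicit.
Unset Printing Implicit Defensive.

(** * Structured programs for one-tape machines *)

(** The scale lets one construction serve the bounded and the unbounded classes: new variables of a
    bounded sentence range over I, while the values of subterms have no bound known in advance; for
    each fixed X and Y some small s fits all of them into I. Since both factors of a product carry
    the scale, its equation reads s * z_c = z_a * z_b, and recovering z_c divides the error by s.
    The clauses on |z_v| keep the factors bounded, so the error before that division is at most four
    times the error of the factors; this is the origin of 4 / s as the growth per node. A tolerance
    that beats N such factors is of order (s / 4)^N, of unbounded degree in s, so it is built by a
    chain of variables with one multiplication per link. Every atom of Phi repeats all its escape
    clauses: the translation stays local and passes only the next free variable from one atom to the
    next. For L the length of the input is taken, since it bounds the number of fresh variables and
    is known to the machine before any parsing. *)

Definition tape := Z -> option bool.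

Definition twrite (T : tape) (p : Z) (w : option bool) : tape :=
  fun i => if Z.eqb i p then w else T i.

Definition tmove (p : Z) (mv : move) : Z :=
  match mv with
  | MLeft => Z.sub p 1
  | MRight => Z.add p 1
  | MStay => p
  end.

(** The boolean result of a command stands for its two exits: [TIf] branches on it and [TLoop]
    repeats while it is true. A basic step reads, writes, moves and chooses an exit, like a single
    transition. *)
Inductive tcmd : Type :=
| TB of (option bool -> bool * option bool * move)
| TIf of tcmd & tcmd & tcmd
| TLoop of tcmd.

Definition TSeq (a b : tcmd) := TIf a b b.

Inductive texec : tcmd -> tape -> Z -> bool -> tape -> Z -> nat -> Prop :=
| EB f T p b w mv : f (T p) = (b, w, mv) ->
    texec (TB f) T p b (twrite T p w) (tmove p mv) 1
| EIf a c d T p b T1 p1 t1 b' T2 p2 t2 :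
    texec a T p b T1 p1 t1 ->
    texec (if b then c else d) T1 p1 b' T2 p2 t2 ->
    texec (TIf a c d) T p b' T2 p2 (t1 + t2)
| EStop a T p T1 p1 t1 :
    texec a T p false T1 p1 t1 -> texec (TLoop a) T p true T1 p1 t1
| EGo a T p T1 p1 t1 T2 p2 t2 :
    texec a T p true T1 p1 t1 -> texec (TLoop a) T1 p1 true T2 p2 t2 ->
    texec (TLoop a) T p true T2 p2 (t1 + t2).

(** * Transition tables of structured programs *)

Fixpoint tst (c : tcmd) : finType :=
  match c with
  | TB _ => unit
  | TIf a b d => (tst a + (tst b + tst d))%type
  | TLoop a => tst a
  end.

Fixpoint tstart (c : tcmd) : tst c :=
  match c with
  | TB _ => tt
  | TIf a b d => inl (tstart a)
  | TLoop a => tstart a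
  end.

(** An exit of a subprogram is turned into the entry of its successor within the same transition.
    Hence composition adds neither states nor time, and the times in [texec] count transitions
    exactly. *)
Definition redirect (Q Q' : Type) (k : Q + bool -> Q' + bool)
  (r : (Q + bool) * option bool * move) : (Q' + bool) * option bool * move :=
  (k r.1.1, r.1.2, r.2).

Fixpoint tdelta (c : tcmd) {struct c} :
    tst c -> option bool -> (tst c + bool) * option bool * move :=
  match c return tst c -> option bool -> (tst c + bool) * option bool * move with
  | TB f => fun _ x => let: (b, w, mv) := f x in (inr b, w, mv)
  | TIf a b d => fun q x =>
      match q with
      | inl q => redirect (fun r => match r with
          | inl q' => inl (inl q')
          | inr true => inl (inr (inl (tstart b)))
          | inr false => inl (inr (inr (tstart d)))
          end) (@tdelta a q x)
      | inr (inl q) => redirect (fun r => match r with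
          | inl q' => inl (inr (inl q')) | inr e => inr e end) (@tdelta b q x)
      | inr (inr q) => redirect (fun r => match r with
          | inl q' => inl (inr (inr q')) | inr e => inr e end) (@tdelta d q x)
      end
  | TLoop a => fun q x => redirect (fun r => match r with
          | inl q' => inl q'
          | inr true => inl (tstart a)
          | inr false => inr true
          end) (@tdelta a q x)
  end.

Inductive mrun (c : tcmd) : tst c -> tape -> Z -> nat -> bool -> tape -> Z -> Prop :=
| mrun_exit q T p b w mv : tdelta q (T p) = (inr b, w, mv) ->
    mrun q T p 1 b (twrite T p w) (tmove p mv)
| mrun_step q q' T p w mv t b T' p' : tdelta q (T p) = (inl q', w, mv) ->
    mrun q' (twrite T p w) (tmove p mv) t b T' p' ->
    mrun q T p t.+1 b T' p'.

Lemma mrun_if_cond a c d q T p t1 b T1 p1 t2 b' T2 p2 :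
  @mrun a q T p t1 b T1 p1 ->
  @mrun (TIf a c d) (inr (if b then inl (tstart c) else inr (tstart d)))
    T1 p1 t2 b' T2 p2 ->
  @mrun (TIf a c d) (inl q) T p (t1 + t2) b' T2 p2.
Proof.
elim=> [{}q {}T {}p {}b w mv e | {}q q' {}T {}p w mv t {}b T' p' e _ IH] H.
- by apply: mrun_step H; rewrite /= e; case: (b).
- by apply: mrun_step (IH H); rewrite /= e.
Qed.

Lemma mrun_if_then a c d q T p t b T' p' :
  @mrun c q T p t b T' p' -> @mrun (TIf a c d) (inr (inl q)) T p t b T' p'.
Proof.
elim=> [{}q {}T {}p {}b w mv e | {}q q' {}T {}p w mv {}t {}b {}T' {}p' e _ IH].
- by apply: mrun_exit; rewrite /= e.
- by apply: mrun_step IH; rewrite /= e.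
Qed.

Lemma mrun_if_else a c d q T p t b T' p' :
  @mrun d q T p t b T' p' -> @mrun (TIf a c d) (inr (inr q)) T p t b T' p'.
Proof.
elim=> [{}q {}T {}p {}b w mv e | {}q q' {}T {}p w mv {}t {}b {}T' {}p' e _ IH].
- by apply: mrun_exit; rewrite /= e.
- by apply: mrun_step IH; rewrite /= e.
Qed.

Lemma mrun_loop_stop a q T p t b T' p' :
  @mrun a q T p t b T' p' -> b = false -> @mrun (TLoop a) q T p t true T' p'.
Proof.
elim=> [{}q {}T {}p {}b w mv e eb | {}q q' {}T {}p w mv {}t {}b {}T' {}p' e _ IH eb].
- by apply: mrun_exit; rewrite /= e eb.
- by apply: mrun_step (IH eb); rewrite /= e.
Qed.

Lemma mrun_loop_go a q T p t1 b T1 p1 t2 T2 p2 :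
  @mrun a q T p t1 b T1 p1 -> b = true ->
  @mrun (TLoop a) (tstart a) T1 p1 t2 true T2 p2 ->
  @mrun (TLoop a) q T p (t1 + t2) true T2 p2.
Proof.
elim=> [{}q {}T {}p {}b w mv e eb | {}q q' {}T {}p w mv t {}b T' p' e _ IH eb] H.
- by apply: mrun_step H; rewrite /= e eb.
- by apply: mrun_step (IH eb H); rewrite /= e.
Qed.

Lemma texec_mrun c T p b T' p' t :
  texec c T p b T' p' t -> mrun (tstart c) T p t b T' p'.
Proof.
elim=> {c T p b T' p' t}
  [f T p b w mv e | a c d T p b T1 p1 t1 b' T2 p2 t2 _ H1 _ H2
  | a T p T1 p1 t1 _ H1 | a T p T1 p1 t1 T2 p2 t2 _ H1 _ H2].
- by apply: mrun_exit; rewrite /= e.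
- apply: mrun_if_cond H1 _.
  by case: b H2 => H2; [exact: mrun_if_then | exact: mrun_if_else].
- exact: mrun_loop_stop H1 _.
- exact: mrun_loop_go H1 _ H2.
Qed.

Definition tm_of_state (c : tcmd) (r : tst c + bool) : 'I_(#|tst c|).+2 :=
  match r with
  | inl q => rshift 2 (enum_rank q)
  | inr _ => @Ordinal (#|tst c|).+2 1 isT
  end.

(** States 0 and 1 are prescribed as initial and halting, so the control states are shifted by two.
    The initial state only enters the program without moving, which is the extra step in
    [tm_of_texec]. *)
Definition tm_of (c : tcmd) : TM :=
  {| tm_k := #|tst c|;
     tm_delta := fun i x =>
       match @split 2 #|tst c| i with
       | inl _ => (tm_of_state (inl (tstart c)), x, MStay)
       | inr r => let r := tdelta (enum_val r) x in (tm_of_state r.1.1, r.1.2, r.2)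
       end |}.

(** [nth None] reads the finite lists as half-tapes continued by blanks, so the relation ignores
    trailing blanks, and moving past the end of a list is no special case for the tape. *)
Definition tape_cfg (M : TM) (c : config M) (T : tape) (p : Z) : Prop :=
  [/\ c_head c = T p,
      forall i, nth None (c_left c) i = T (Z.sub p (Z.of_nat i.+1)) &
      forall i, nth None (c_right c) i = T (Z.add p (Z.of_nat i.+1))].

Lemma tape_cfg_step (M : TM) (c : config M) T p q w mv :
  tape_cfg c T p -> c_state c != tm_halt M ->
  tm_delta (c_state c) (c_head c) = (q, w, mv) ->
  tape_cfg (tm_step c) (twrite T p w) (tmove p mv) /\ c_state (tm_step c) = q.
Proof.
case=> eh el er ns ed; rewrite /tm_step (negbTE ns) ed.
have tw i : i <> p -> twrite T p w i = T i.
  by rewrite /twrite; case: Z.eqb_spec.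
have tp : twrite T p w p = w by rewrite /twrite Z.eqb_refl.
case: mv {ed} => /=.
- have e0 : T (Z.sub p 1) = nth None (c_left c) 0 by rewrite el.
  case El: (c_left c) => [|x l] /=; split=> //; split=> /=.
  + by rewrite tw ?e0 ?El //; lia.
  + move=> i; rewrite nth_nil tw; last lia.
    move: (el i.+1); rewrite El nth_nil => ->; congr T; lia.
  + case=> [|i] /=; first by rewrite -[LHS]tp; congr twrite; lia.
    rewrite er tw; last lia. congr T; lia.
  + by rewrite tw ?e0 ?El //; lia.
  + move=> i; rewrite tw; last lia.
    move: (el i.+1); rewrite El /= => ->; congr T; lia.
  + case=> [|i] /=; first by rewrite -[LHS]tp; congr twrite; lia.
    rewrite er tw; last lia. congr T; lia.
- have e0 : T (Z.add p 1) = nth None (c_right c) 0 by rewrite er.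
  case Er: (c_right c) => [|x l] /=; split=> //; split=> /=.
  + by rewrite tw ?e0 ?Er //; lia.
  + case=> [|i] /=; first by rewrite -[LHS]tp; congr twrite; lia.
    rewrite el tw; last lia. congr T; lia.
  + move=> i; rewrite nth_nil tw; last lia.
    move: (er i.+1); rewrite Er nth_nil => ->; congr T; lia.
  + by rewrite tw ?e0 ?Er //; lia.
  + case=> [|i] /=; first by rewrite -[LHS]tp; congr twrite; lia.
    rewrite el tw; last lia. congr T; lia.
  + move=> i; rewrite tw; last lia.
    move: (er i.+1); rewrite Er /= => ->; congr T; lia.
- split=> //; split=> //= i; rewrite tw ?el ?er //; lia.
Qed.

Lemma tm_of_mrun c q T p t b T' p' (cf : config (tm_of c)) :
  mrun q T p t b T' p' -> tape_cfg cf T p -> c_state cf = tm_of_state (inl q) ->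
  let cf' := tm_run t cf in
  tape_cfg cf' T' p' /\ c_state cf' = tm_halt (tm_of c).
Proof.
move=> H; elim: H cf => {q T p t b T' p'}
  [q T p b w mv e | q q' T p w mv t b T' p' e _ IH] cf tc es.
- have ed : tm_delta (c_state cf) (c_head cf) = (tm_halt (tm_of c), w, mv).
    case: tc => -> _ _; rewrite es /= (unsplitK (inr _)) enum_rankK e /=.
    by congr (_, _, _); apply: val_inj.
  have ns : c_state cf != tm_halt (tm_of c) by rewrite es.
  exact: (tape_cfg_step tc ns ed).
- have ed : tm_delta (c_state cf) (c_head cf) = (tm_of_state (inl q'), w, mv).
    by case: tc => -> _ _; rewrite es /= (unsplitK (inr _)) enum_rankK e /=.
  have ns : c_state cf != tm_halt (tm_of c) by rewrite es.
  have [tc' es'] := tape_cfg_step tc ns ed.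
  exact: IH.
Qed.

(** The input starts at cell 1, so that cell 0 is blank and the input already forms stack 0 in the
    layout of the stack machine. *)
Definition input_tape (w : seq bool) : tape :=
  fun i => if Z.leb 1 i then nth None (map Some w) (Z.to_nat (Z.sub i 1)) else None.

Lemma input_tape_le0 w i : Z.le i 0 -> input_tape w i = None.
Proof. by rewrite /input_tape; case: Z.leb_spec => //; lia. Qed.

Lemma input_tapeS w i n : i = Z.of_nat n.+1 -> input_tape w i = nth None (map Some w) n.
Proof.
rewrite /input_tape => ->; case: Z.leb_spec; last lia.
by have -> : Z.to_nat (Z.sub (Z.of_nat n.+1) 1) = n by lia.
Qed.

Lemma tm_of_texec c w b T' p' t :
  texec c (input_tape w) 1 b T' p' t ->
  let cf' := tm_run t.+1 (tm_init (tm_of c) w) in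
  tape_cfg cf' T' p' /\ c_state cf' = tm_halt (tm_of c).
Proof.
move=> H; have {}H := texec_mrun H.
have tc : tape_cfg (tm_init (tm_of c) w) (input_tape w) 1.
  split=> [|i|i].
  - by rewrite (@input_tapeS w _ 0) //; case: w {H}.
  - rewrite input_tape_le0; last lia. by case: w {H} => [|b0 w]; rewrite /= nth_nil.
  - rewrite (@input_tapeS w _ i.+1); last lia. by case: w {H} => [|b0 w] //=; rewrite !nth_nil.
have e0 : c_state (tm_init (tm_of c) w) = tm_start (tm_of c) by case: w {H tc}.
have ed : tm_delta (c_state (tm_init (tm_of c) w)) (c_head (tm_init (tm_of c) w))
   = (tm_of_state (inl (tstart c)), c_head (tm_init (tm_of c) w), MStay).
  by rewrite e0 /=; case: splitP => [j _ |k /= ].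
have ns : c_state (tm_init (tm_of c) w) != tm_halt (tm_of c) by rewrite e0.
have [tc' es'] := tape_cfg_step tc ns ed.
rewrite /=; apply: tm_of_mrun es'; first exact: H.
case: tc tc' => eh _ _ [h1 h2 h3]; rewrite eh in h1 h2 h3.
have tw i : twrite (input_tape w) 1 (input_tape w (Zpos xH)) i = input_tape w i.
  by rewrite /twrite; case: Z.eqb_spec => // ->.
by split=> [|i|i]; rewrite ?h1 ?h2 ?h3 tw.
Qed.

Lemma tm_output_word (M : TM) (c : config M) T p w :
  tape_cfg c T p ->
  (forall i, (i <= size w)%N -> T (Z.add p (Z.of_nat i)) = nth None (map Some w) i) ->
  tm_output c = w.
Proof.
rewrite /tm_output; case=> eh _ er H.
have {eh er H} : forall i, (i <= size w)%N ->
    nth None (c_head c :: c_right c) i = nth None (map Some w) i.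
  case=> [|i] Hi /=; first by rewrite eh -(H 0%N) //; congr T; lia.
  by rewrite er H.
elim: w (c_head c :: c_right c) => [|b w IH] [|[b'|] s] H //=.
- by have := H 0%N isT.
- by have := H 0%N isT.
- by have [->] := H 0%N isT; congr (_ :: _); apply: IH => i Hi; exact: (H i.+1).
- by have := H 0%N isT.
Qed.

(** * Stack machines on one tape *)

Definition mem := nat -> seq bool.

Definition upd (m : mem) (j : nat) (s : seq bool) : mem :=
  fun i => if i == j then s else m i.

(** [SCase] pops the symbol that it tests: a program that only inspects a stack has to push the
    symbol back. *)
Inductive scmd : Type :=
| SRet of bool
| SPush of nat & bool
| SCase of nat & scmd & scmd & scmd
| SSeq of scmd & scmd
| SLoop of scmd.

Inductive sx : scmd -> mem -> bool -> mem -> nat -> Prop :=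
| XRet b m : sx (SRet b) m b m 1
| XPush j b m : sx (SPush j b) m true (upd m j (b :: m j)) 1
| XCaseE j cE c0 c1 m b m' t : m j = [::] ->
    sx cE m b m' t -> sx (SCase j cE c0 c1) m b m' t.+1
| XCaseB j cE c0 c1 m x s b m' t : m j = x :: s ->
    sx (if x then c1 else c0) (upd m j s) b m' t ->
    sx (SCase j cE c0 c1) m b m' t.+1
| XSeq a c m b m1 t1 b' m2 t2 : sx a m b m1 t1 -> sx c m1 b' m2 t2 ->
    sx (SSeq a c) m b' m2 (t1 + t2)
| XStop a m m1 t1 : sx a m false m1 t1 -> sx (SLoop a) m true m1 t1
| XGo a m m1 t1 m2 t2 : sx a m true m1 t1 -> sx (SLoop a) m1 true m2 t2 ->
    sx (SLoop a) m true m2 (t1 + t2).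

Fixpoint regs_le (K : nat) (c : scmd) : bool :=
  match c with
  | SRet _ => true
  | SPush j _ => (j <= K)%N
  | SCase j a b d => [&& (j <= K)%N, regs_le K a, regs_le K b & regs_le K d]
  | SSeq a b => regs_le K a && regs_le K b
  | SLoop a => regs_le K a
  end.

Definition tret (b : bool) := TB (fun x => (b, x, MStay)).

Fixpoint tmv (mv : move) (n : nat) : tcmd :=
  match n with
  | 0 => tret true
  | n'.+1 => TSeq (TB (fun x => (true, x, mv))) (tmv mv n')
  end.

Definition tnonblank := TB (fun x => (isSome x, x, MStay)).

Lemma twrite_id (T : tape) p : twrite T p (T p) = T.
Proof.
by apply: functional_extensionality => i; rewrite /twrite; case: Z.eqb_spec => // ->.
Qed.

Lemma tret_exec b T p : texec (tret b) T p b T p 1.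
Proof. by rewrite -{2}(twrite_id T p); apply: (EB (mv := MStay)). Qed.

Lemma tseq_exec a c T p b T1 p1 t1 b' T2 p2 t2 :
  texec a T p b T1 p1 t1 -> texec c T1 p1 b' T2 p2 t2 ->
  texec (TSeq a c) T p b' T2 p2 (t1 + t2).
Proof. by move=> H1 H2; apply: EIf H1 _; case: b. Qed.

Lemma tmv_exec mv n T p :
  texec (tmv mv n) T p true T (iter n (fun q => tmove q mv) p) n.+1.
Proof.
elim: n p => [|n IH] p; first exact: tret_exec.
rewrite iterSr -[n.+2]add1n; apply: tseq_exec (IH _).
by have := @EB (fun x => (true, x, mv)) T p true (T p) mv erefl; rewrite twrite_id; apply.
Qed.

Lemma tnonblank_exec T p : texec tnonblank T p (isSome (T p)) T p 1.
Proof. by rewrite -{3}(twrite_id T p); apply: (EB (mv := MStay)). Qed.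

Lemma iter_left n p : iter n (fun q => tmove q MLeft) p = Z.sub p (Z.of_nat n).
Proof. elim: n => [|n IH]; first by rewrite /=; lia. rewrite iterS IH /=; lia. Qed.

Lemma iter_right n p : iter n (fun q => tmove q MRight) p = Z.add p (Z.of_nat n).
Proof. elim: n => [|n IH]; first by rewrite /=; lia. rewrite iterS IH /=; lia. Qed.

(** * Stacks on interleaved tape cells *)

Section StackMachine.

Variable K : nat.

(* Stack 0 occupies the cells 1, 2, ... to the right of the home cell 0; the
   stacks 1 .. K are interleaved to the left of it.  Cell 0 of every stack is
   kept blank, so that walking down a stack stops there. *)
Definition cell (j i : nat) : Z :=
  if j is 0 then Z.of_nat i else Z.opp (Z.of_nat (j + K * i)).

(** The list has the top of the stack first, while the tape has the bottom next to home; hence the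
    reversal. A push or a pop then changes a single cell. *)
Definition column (s : seq bool) := None :: map Some (rev s).

Definition rep (m : mem) (T : tape) : Prop :=
  forall j i, (j <= K)%N -> T (cell j i) = nth None (column (m j)) i.

Definition stride_out (j : nat) := if j is 0 then tmv MRight 1 else tmv MLeft K.
Definition stride_in (j : nat) := if j is 0 then tmv MLeft 1 else tmv MRight K.
Definition seek_top (j : nat) := TLoop (TSeq (stride_out j) tnonblank).
Definition go_home (j : nat) :=
  TSeq (TLoop (TSeq (stride_in j) tnonblank)) (tmv MRight j).

(** Between commands the head is on the home cell 0, so a stack operation is a round trip: to the
    bottom of the stack, out to its top, and back. *)
Fixpoint compile (c : scmd) : tcmd :=
  match c with
  | SRet b => tret b
  | SPush j b =>
      TSeq (tmv MLeft j) (TSeq (seek_top j)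
        (TSeq (TB (fun _ => (true, Some b, MStay))) (go_home j)))
  | SCase j cE c0 c1 =>
      TSeq (tmv MLeft j) (TSeq (stride_out j)
        (TIf tnonblank
          (TSeq (seek_top j) (TSeq (stride_in j)
            (TIf (TB (fun x => (x == Some true, None, MStay)))
               (TSeq (go_home j) (compile c1))
               (TSeq (go_home j) (compile c0)))))
          (TSeq (go_home j) (compile cE))))
  | SSeq a b => TSeq (compile a) (compile b)
  | SLoop a => TLoop (compile a)
  end.

Lemma stride_out_exec j i T :
  exists2 t, texec (stride_out j) T (cell j i) true T (cell j i.+1) t & (t <= K + 2)%N.
Proof.
case: j => [|j] /=.
- exists 2; last lia.
  have := tmv_exec MRight 1 T (Z.of_nat i); rewrite iter_right.
  by have -> : Z.add (Z.of_nat i) (Z.of_nat 1) = Z.of_nat i.+1 by lia.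
- exists K.+1; last lia.
  have := tmv_exec MLeft K T (Z.opp (Z.of_nat (j.+1 + K * i))); rewrite iter_left.
  by have -> : Z.sub (Z.opp (Z.of_nat (j.+1 + K * i))) (Z.of_nat K)
             = Z.opp (Z.of_nat (j.+1 + K * i.+1)) by lia.
Qed.

Lemma stride_in_exec j i T :
  exists2 t, texec (stride_in j) T (cell j i.+1) true T (cell j i) t & (t <= K + 2)%N.
Proof.
case: j => [|j] /=.
- exists 2; last lia.
  have := tmv_exec MLeft 1 T (Z.of_nat i.+1); rewrite iter_left.
  by have -> : Z.sub (Z.of_nat i.+1) (Z.of_nat 1) = Z.of_nat i by lia.
- exists K.+1; last lia.
  have := tmv_exec MRight K T (Z.opp (Z.of_nat (j.+1 + K * i.+1))); rewrite iter_right.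
  by have -> : Z.add (Z.opp (Z.of_nat (j.+1 + K * i.+1))) (Z.of_nat K)
             = Z.opp (Z.of_nat (j.+1 + K * i)) by lia.
Qed.

(** A stride is made before the first test, so the blank cell at the bottom of the stack does not
    stop the search. *)
Lemma seek_top_exec j (T : tape) i d :
  (forall e, (e < d)%N -> T (cell j (i + e).+1)) -> T (cell j (i + d).+1) = None ->
  exists2 t, texec (seek_top j) T (cell j i) true T (cell j (i + d).+1) t
           & (t <= d.+1 * (K + 3))%N.
Proof.
elim: d i => [|d IH] i Hs Hn; have [t1 e1 l1] := stride_out_exec j i T.
- exists (t1 + 1); last lia.
  rewrite addn0 in Hn *; apply: EStop; apply: tseq_exec e1 _.
  by have := tnonblank_exec T (cell j i.+1); rewrite Hn.
- have [|| t2 e2 l2] := IH i.+1.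
  + by move=> e He; rewrite addSnnS; apply: Hs; lia.
  + by rewrite addSnnS.
  exists (t1 + 1 + t2); last nia.
  rewrite -addSnnS; apply: EGo e2; apply: tseq_exec e1 _.
  have := Hs 0%N isT; rewrite addn0 => h.
  have := tnonblank_exec T (cell j i.+1).
  by case: (T (cell j i.+1)) h.
Qed.

Lemma cell0_home j T :
  texec (tmv MRight j) T (cell j 0) true T 0 j.+1.
Proof.
have := tmv_exec MRight j T (cell j 0); rewrite iter_right.
suff -> : Z.add (cell j 0) (Z.of_nat j) = Z0 by [].
by case: j => [|j]; rewrite /cell; lia.
Qed.

Lemma home_cell0 j T :
  texec (tmv MLeft j) T 0 true T (cell j 0) j.+1.
Proof.
have := tmv_exec MLeft j T 0; rewrite iter_left.
suff -> : Z.sub 0 (Z.of_nat j) = cell j 0 by [].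
by case: j => [|j]; rewrite /cell; lia.
Qed.

Lemma go_home_exec j (T : tape) i : (j <= K)%N ->
  (forall e, (e < i)%N -> T (cell j e.+1)) -> T (cell j 0) = None ->
  exists2 t, texec (go_home j) T (cell j i.+1) true T 0 t
           & (t <= (i + 2) * (K + 3))%N.
Proof.
move=> jK Hs Hn.
suff [t e l] : exists2 t, texec (TLoop (TSeq (stride_in j) tnonblank)) T
    (cell j i.+1) true T (cell j 0) t & (t <= i.+1 * (K + 3))%N.
  exists (t + j.+1); last nia.
  exact: tseq_exec e (cell0_home _ _).
elim: i Hs => [|i IH] Hs.
- have [t1 e1 l1] := stride_in_exec j 0 T.
  exists (t1 + 1); last lia.
  apply: EStop; apply: tseq_exec e1 _.
  by have := tnonblank_exec T (cell j 0); rewrite Hn.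
- have [t1 e1 l1] := stride_in_exec j i.+1 T.
  have [e He|t2 e2 l2] := IH; first by apply: Hs; lia.
  exists (t1 + 1 + t2); last nia.
  apply: EGo e2; apply: tseq_exec e1 _.
  have := Hs i (ltnSn _); have := tnonblank_exec T (cell j i.+1).
  by case: (T (cell j i.+1)).
Qed.

(** To the left of home, the offset less one has the stack as its residue modulo [K] and the height
    as its quotient; to the right there is only stack 0. *)
Lemma cell_inj j i j' i' : (j <= K)%N -> (j' <= K)%N ->
  cell j i = cell j' i' -> j = j' /\ i = i'.
Proof.
case: j j' => [|j] [|j'] //= jK jK' e.
- by split=> //; lia.
- exfalso; lia.
- exfalso; lia.
- have e' : (j + K * i = j' + K * i')%N by lia.
  have eM : ((j + K * i) %% K = j)%N by rewrite addnC mulnC modnMDl modn_small.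
  have eM' : ((j' + K * i') %% K = j')%N by rewrite addnC mulnC modnMDl modn_small.
  have ej : j = j' by rewrite -eM -eM' e'.
  by split; [rewrite ej | nia].
Qed.

Lemma rep_top m (T : tape) j e : rep m T -> (j <= K)%N -> (e < size (m j))%N ->
  T (cell j e.+1).
Proof.
move=> rT jK He; rewrite rT //= (nth_map false) ?size_rev //.
Qed.

Lemma rep_blank m T j i : rep m T -> (j <= K)%N -> (size (m j) < i)%N ->
  T (cell j i) = None.
Proof.
by move=> rT jK He; rewrite rT // nth_default //= size_map size_rev.
Qed.

Lemma rep_push m T j b : rep m T -> (j <= K)%N ->
  rep (upd m j (b :: m j)) (twrite T (cell j (size (m j)).+1) (Some b)).
Proof.
move=> rT jK j' i j'K; rewrite /twrite /upd.
case: Z.eqb_spec => [/(cell_inj j'K jK) [-> ->]|ne].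
  by rewrite eqxx /= rev_cons map_rcons nth_rcons size_map size_rev ltnn eqxx.
rewrite rT //; case: eqP => // ej; rewrite ej in ne *.
have {}ne : i <> (size (m j)).+1 by move=> ei; apply: ne; rewrite ei.
case: i ne => [|i] //= ne; rewrite rev_cons map_rcons nth_rcons size_map size_rev.
case: ltngtP => // [h|h]; last by lia.
by rewrite nth_default // size_map size_rev ltnW.
Qed.

Lemma rep_pop m T j b s : rep m T -> (j <= K)%N -> m j = b :: s ->
  rep (upd m j s) (twrite T (cell j (size s).+1) None).
Proof.
move=> rT jK ms j' i j'K; rewrite /twrite /upd.
case: Z.eqb_spec => [/(cell_inj j'K jK) [-> ->]|ne].
  by rewrite eqxx /= nth_default // size_map size_rev.
rewrite rT //; case: eqP => // ej; rewrite ej ms in ne *.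
have {}ne : i <> (size s).+1 by move=> ei; apply: ne; rewrite ei.
case: i ne => [|i] //= ne; rewrite rev_cons map_rcons nth_rcons size_map size_rev.
case: ltngtP => // [h|h]; last by lia.
by rewrite nth_default // size_map size_rev ltnW.
Qed.

(** One walk up and one walk down a stack of height at most [h], with at most [K + 3] transitions
    per tested stride; the summand 8 absorbs the fixed part. *)
Definition step_cost (h : nat) := ((2 * h + 8) * (K + 3))%N.

(** [H] bounds stack height plus remaining time. A stack grows by at most one symbol per unit of
    time, so every part of a run inherits the bound, and one cost per step serves throughout. The
    conclusion on sizes passes it on through sequences and loops. *)
Theorem compile_exec c m b m' t : sx c m b m' t -> regs_le K c ->
  forall T H, rep m T -> (forall j, (j <= K)%N -> size (m j) + t <= H)%N ->
  exists T' t', [/\ texec (compile c) T 0 b T' 0 t', rep m' T',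
     (forall j, (j <= K)%N -> size (m' j) <= size (m j) + t)%N &
     (t' <= t * step_cost H)%N].
Proof.
elim=> {c m b m' t}
  [b m _ | j b m /= jK | j cE c0 c1 m b m' t mj _ IH /=/and4P[jK wE w0 w1]
  | j cE c0 c1 m x s b m' t mj _ IH /=/and4P[jK wE w0 w1]
  | a c m b m1 t1 b' m2 t2 _ IH1 _ IH2 /=/andP[wa wc]
  | a m m1 t1 _ IH /= wa | a m m1 t1 m2 t2 _ IH1 _ IH2 /= wa] T H rT hH.
- exists T, 1; split=> //; [exact: tret_exec | by move=> *; lia | rewrite /step_cost; nia].
- have [e||t1 e1 l1] := @seek_top_exec j T 0 (size (m j)).
  + exact: rep_top.
  + by apply: rep_blank rT jK _; rewrite add0n.
  rewrite add0n in e1.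
  set T' := twrite T (cell j (size (m j)).+1) (Some b).
  have rT' : rep (upd m j (b :: m j)) T' by exact: rep_push.
  have [||t2 e2 l2] := @go_home_exec j T' (size (m j)) jK.
  + by move=> e he; apply: rep_top rT' jK _; rewrite /upd eqxx /=; lia.
  + by rewrite rT'.
  exists T', (j.+1 + (t1 + (1 + t2)))%N; split=> //.
  + apply: tseq_exec (home_cell0 _ _) _; apply: tseq_exec e1 _.
    by apply: tseq_exec e2; apply: (EB (mv := MStay)).
  + by move=> j' _; rewrite /upd; case: eqP => [->|_] /=; lia.
  + have := hH j jK; rewrite /step_cost; nia.
- have [t1 e1 l1] := stride_out_exec j 0 T.
  have Tn : T (cell j 1) = None by apply: rep_blank rT jK _; rewrite mj.
  have [//||t2 e2 l2] := @go_home_exec j T 0 jK; first by rewrite rT.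
  have [|T' [t' [ex rT' sz lt]]] := IH wE T H rT.
    by move=> j' /hH; lia.
  exists T', (j.+1 + (t1 + (1 + (t2 + t'))))%N; split=> //.
  + apply: tseq_exec (home_cell0 _ _) _; apply: tseq_exec e1 _.
    apply: EIf (tnonblank_exec _ _) _; rewrite Tn.
    exact: tseq_exec e2 ex.
  + by move=> j' /sz; lia.
  + have := hH j jK; move: lt; rewrite /step_cost; nia.
- have [t1 e1 l1] := stride_out_exec j 0 T.
  have Ts : isSome (T (cell j 1)) by apply: rep_top rT jK _; rewrite mj.
  have [||t2 e2 l2] := @seek_top_exec j T 1 (size s).
  + by move=> e he; apply: rep_top rT jK _; rewrite mj /=; lia.
  + by apply: rep_blank rT jK _; rewrite mj /=; lia.
  rewrite add1n in e2.
  have [t3 e3 l3] := stride_in_exec j (size s).+1 T.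
  set T1 := twrite T (cell j (size s).+1) None.
  have rT1 : rep (upd m j s) T1 by exact: rep_pop mj.
  (* The head stands on the cell just erased; [go_home] strides before it tests, so this blank does
     not stop it. *)
  have [||t4 e4 l4] := @go_home_exec j T1 (size s) jK.
  + by move=> e he; apply: rep_top rT1 jK _; rewrite /upd eqxx.
  + by rewrite rT1.
  have w' : regs_le K (if x then c1 else c0) by case: (x).
  have [|T' [t' [ex rT' sz lt]]] := IH w' T1 H rT1.
    by move=> j' jK'; have := hH j' jK'; rewrite /upd; case: eqP => [->|]; rewrite ?mj /=; lia.
  have Tx : T (cell j (size s).+1) = Some x.
    by rewrite rT //= mj rev_cons map_rcons nth_rcons size_map size_rev ltnn eqxx.
  exists T', (j.+1 + (t1 + (1 + (t2 + (t3 + (1 + (t4 + t')))))))%N; split=> //.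
  + apply: tseq_exec (home_cell0 _ _) _; apply: tseq_exec e1 _.
    apply: EIf (tnonblank_exec _ _) _; rewrite Ts.
    apply: tseq_exec e2 _; apply: tseq_exec e3 _.
    apply: (@EIf _ _ _ _ _ x T1 (cell j (size s).+1)).
      by apply: (EB (mv := MStay)); rewrite Tx; case: (x).
    by case: (x) ex => ex; apply: tseq_exec e4 ex.
  + move=> j' jK'; have := sz j' jK'; rewrite /upd; case: eqP => [->|]; rewrite ?mj /=; lia.
  + have := hH j jK; rewrite mj /=; move: lt; rewrite /step_cost; nia.
- have [|T1 [t1' [ex1 rT1 sz1 lt1]]] := IH1 wa T H rT; first by move=> j /hH; lia.
  have [|T2 [t2' [ex2 rT2 sz2 lt2]]] := IH2 wc T1 H rT1.
    by move=> j jK; have := sz1 j jK; have := hH j jK; lia.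
  exists T2, (t1' + t2')%N; split=> //.
  + exact: tseq_exec ex1 ex2.
  + by move=> j jK; have := sz1 j jK; have := sz2 j jK; lia.
  + lia.
- have [|T1 [t1' [ex1 rT1 sz1 lt1]]] := IH wa T H rT; first by move=> j /hH; lia.
  by exists T1, t1'; split=> //; exact: EStop.
- have [|T1 [t1' [ex1 rT1 sz1 lt1]]] := IH1 wa T H rT; first by move=> j /hH; lia.
  have [|T2 [t2' [ex2 rT2 sz2 lt2]]] := IH2 wa T1 H rT1.
    by move=> j jK; have := sz1 j jK; have := hH j jK; lia.
  exists T2, (t1' + t2')%N; split=> //.
  + exact: EGo ex1 ex2.
  + by move=> j jK; have := sz1 j jK; have := sz2 j jK; lia.
  + lia.
Qed.

End StackMachine.

Definition mem_input (w : seq bool) : mem := fun j => if j is 0 then rev w else [::].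

Theorem stack_poly_time K c (g : seq bool -> seq bool) (a e : nat) :
  regs_le K c ->
  (forall w, exists b m t, [/\ sx c (mem_input w) b m t, rev (m 0%N) = g w &
     (t <= a * (size w).+1 ^ e)%N]) ->
  poly_time_computable g.
Proof.
move=> wc Hc.
(* Home is cell 0, while the machine starts on the first input cell and must stop where the output
   begins; hence one move before and one after. *)
pose prog := TSeq (tmv MLeft 1) (TSeq (compile K c) (tmv MRight 1)).
suff [A [E HA]] : exists A E, forall N t t' : nat,
    (t <= a * N.+1 ^ e -> t' <= t * step_cost K (N + t) -> t' + 5 <= A * N ^ E + A)%N.
  exists (tm_of prog), A, E => w.
  have [b [m [t [ex <- lt]]]] := Hc w.
  have rT : rep K (mem_input w) (input_tape w).
    move=> [|j] i jK; rewrite /column /=.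
      rewrite revK; case: i => [|i] /=; first exact: input_tape_le0.
      by rewrite (@input_tapeS w _ i).
    rewrite input_tape_le0; [by case: i => //= i; rewrite nth_nil | lia].
  have hH j : (j <= K)%N -> (size (mem_input w j) + t <= size w + t)%N.
    by move=> _; case: j => [|j] /=; rewrite ?size_rev; lia.
  have [T' [t' [ex' rT' _ lt']]] := compile_exec ex wc rT hH.
  have exP : texec prog (input_tape w) 1 true T' 1 (2 + (t' + 2))%N.
    apply: tseq_exec (tmv_exec MLeft 1 _ _) _; rewrite iter_left.
    apply: tseq_exec ex' _.
    by have := tmv_exec MRight 1 T' 0; rewrite iter_right.
  have [tc es] := tm_of_texec exP.
  exists (2 + (t' + 2)).+1; split; first by have := HA _ _ _ lt lt'; lia.
  split=> //; apply: tm_output_word tc _ => i _.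
  have := rT' 0%N i.+1 isT.
  by have -> : cell K 0 i.+1 = Z.add 1 (Z.of_nat i) by rewrite /cell; lia.
(* One power [e] comes from the number [t] of stack steps, the power [e.+1] from the height bound
   [N + t]. The 5 pays for entering the program and for the two outer moves. *)
pose A := (a * (2 * a + 10) * (K + 3) + 5)%N.
exists (A * 2 ^ (e + e.+1))%N, (e + e.+1)%N => N t t' h1 h2.
(* The required form is c * N ^ d + c: [N.+1] is at most [2 * N] unless [N] is 0, and that case is
   covered by the additive constant. *)
have hM : (N.+1 ^ (e + e.+1) <= 2 ^ (e + e.+1) * N ^ (e + e.+1) + 2 ^ (e + e.+1))%N.
  case: N {h1 h2} => [|N]; first by rewrite exp1n; have := expn_gt0 2 (e + e.+1); lia.
  by rewrite -expnMn; apply: leq_trans (leq_addr _ _); rewrite leq_exp2r //; lia.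
have m1 : (N.+1 <= N.+1 ^ e.+1)%N by rewrite -{1}(expn1 N.+1) leq_pexp2l.
have m2 : (N.+1 ^ e <= N.+1 ^ e.+1)%N by rewrite leq_pexp2l.
have m3 : (1 <= N.+1 ^ e)%N by rewrite expn_gt0.
suff : (t' + 5 <= A * N.+1 ^ (e + e.+1))%N by nia.
rewrite expnD; move: h2; rewrite /step_cost /A {hM}.
move: (N.+1 ^ e)%N (N.+1 ^ e.+1)%N m1 m2 m3 h1 => x y m1 m2 m3 h1 h2.
have b1 : (2 * (N + t) + 8 <= (2 * a + 10) * y)%N by nia.
have b2 : (t * ((2 * (N + t) + 8) * (K + 3)) <= (a * x) * (((2 * a + 10) * y) * (K + 3)))%N.
  by rewrite leq_mul // leq_mul.
have b3 : (1 <= x * y)%N by rewrite muln_gt0; lia.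
apply: leq_trans (leq_add (leq_trans h2 b2) (leqnn 5)) _; nia.
Qed.

(** * The reduction and its correctness over the reals *)

(** Monomials are lists of indices with repetition, so that the length is the degree; both terms and
    multi-indices are derived from this form. *)
Definition lpoly := seq (Z * seq nat).

Definition lmono_eval (v : nat -> R) (ix : seq nat) : R :=
  foldr (fun i r => Rmult (v i) r) R1 ix.

Definition lpoly_eval (v : nat -> R) (p : lpoly) : R :=
  foldr (fun cm r => Rplus (Rmult (IZR cm.1) (lmono_eval v cm.2)) r) R0 p.

Definition latom : Type := lpoly * lpoly.

Definition latom_holds (v : nat -> R) (a : latom) : Prop :=
  Rle (lpoly_eval v a.1) (lpoly_eval v a.2).

(* A node (l, r, c) stands for the equation l = r that defines variable c. *)
Definition node : Type := lpoly * lpoly * nat.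

Definition mon (ix : seq nat) : Z * seq nat := (Zpos xH, ix).

(** Equations between scaled values. An input variable and the digit 1 enter multiplied by the
    scale, since a scaled and an unscaled value could not be added. *)
Definition nvar (S c i : nat) : node := ([:: mon [:: c]], [:: mon [:: S; i]], c).
Definition nadd (c F : nat) : node := ([:: mon [:: c]], [:: mon [:: F]; mon [:: F.+1]], c).
Definition nmul (S c F : nat) : node := ([:: mon [:: S; c]], [:: mon [:: F; F.+1]], c).
Definition nneg (c F : nat) : node := ([:: mon [:: c]], [:: (Zneg xH, [:: F])], c).
Definition ndig (S : nat) (b : bool) (c F : nat) : node :=
  ([:: mon [:: c]], (Zpos (xO xH), [:: F]) :: (if b then [:: mon [:: S]] else [::]), c).
Definition nzero (c : nat) : node := ([:: mon [:: c]], [::], c).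

(** Horner's scheme with the least significant digit first. The leading 1 is treated as 2 * 0 + 1,
    so that each encoded digit yields one [ndig] and the end mark yields [nzero]. *)
Fixpoint dig_nodes (S c F : nat) (p : positive) : seq node :=
  match p with
  | xH => [:: ndig S true c F; nzero F]
  | xO q => ndig S false c F :: dig_nodes S F F.+1 q
  | xI q => ndig S true c F :: dig_nodes S F F.+1 q
  end.

Fixpoint dig_alloc (p : positive) : nat :=
  match p with xH => 1 | xO q => (dig_alloc q).+1 | xI q => (dig_alloc q).+1 end.

(** Counts only the variables below the root; the variable of the root is supplied from outside. *)
Fixpoint talloc (t : term) : nat :=
  match t with
  | TVar _ => 0
  | TConst Z0 => 0
  | TConst (Zpos p) => dig_alloc p
  | TConst (Zneg p) => (dig_alloc p).+1
  | TAdd a b => (talloc a + talloc b).+2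
  | TMul a b => (talloc a + talloc b).+2
  end.

(** Both children receive their variables before either is expanded, and the left one is expanded
    completely first. This is the order in which a single pass with a stack of pending variables
    meets them. *)
Fixpoint nodes (S c F : nat) (t : term) : seq node :=
  match t with
  | TVar i => [:: nvar S c i]
  | TConst Z0 => [:: nzero c]
  | TConst (Zpos p) => dig_nodes S c F p
  | TConst (Zneg p) => nneg c F :: dig_nodes S F F.+1 p
  | TAdd a b =>
      nadd c F :: nodes S F F.+2 a ++ nodes S F.+1 (F.+2 + talloc a) b
  | TMul a b =>
      nmul S c F :: nodes S F F.+2 a ++ nodes S F.+1 (F.+2 + talloc a) b
  end.

Definition node_phi (D : nat) (nd : node) : seq latom :=
  let: (l, r, c) := nd in
  [:: (mon [:: D] :: l, r); (mon [:: D] :: r, l);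
      ([:: mon [::]], [:: mon [:: c]]); ([:: mon [:: c]; mon [::]], [::])].

Definition node_psi (nd : node) : seq latom :=
  let: (l, r, c) := nd in [:: (l, r); (r, l)].

Definition tatom_sides (a : tatom) : term * term :=
  match a with TLe s t => (s, t) | TLt s t => (s, t) end.

Definition aalloc (a : tatom) : nat :=
  (talloc (tatom_sides a).1 + talloc (tatom_sides a).2).+2.

Definition atom_nodes (S F : nat) (a : tatom) : seq node :=
  nodes S F F.+2 (tatom_sides a).1 ++
  nodes S F.+1 (F.+2 + talloc (tatom_sides a).1) (tatom_sides a).2.

Definition chain_atoms (S L : nat) : seq latom :=
  [seq ([:: mon [:: S; i]], [:: (Zpos (xO (xO xH)), [:: i.+1])]) | i <- iota S L].

Definition phi_head (S L F : nat) : seq latom :=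
  [:: ([:: mon [:: F]], [:: mon [:: F.+1]; mon [:: S; S]]);
      ([:: mon [::]], [:: mon [:: S]]);
      ([:: mon [:: S + L]%N], [::])] ++ chain_atoms S L.

Definition phi_last (S : nat) : latom := ([:: mon [:: S]], [::]).

Definition psi_head (F : nat) : latom := ([:: mon [:: F]], [:: mon [:: F.+1]]).

(** The true atom 0 <= 0, which closes the conjunction. *)
Definition psi_last : latom := ([::], [::]).

Definition phi_atoms (S L F : nat) (a : tatom) : seq latom :=
  phi_head S L F ++ flatten (map (node_phi (S + L)) (atom_nodes S F a)).

Definition psi_atoms (S F : nat) (a : tatom) : seq latom :=
  psi_head F :: flatten (map node_psi (atom_nodes S F a)).

(** With a designated last atom, every earlier atom is written in prefix notation right after its
    own connective. The pass can thus emit clauses without knowing how many will follow. *)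
Definition disj_list (l : seq latom) (a : latom) : qf latom :=
  foldr (fun b f => QOr (QAtom b) f) (QAtom a) l.

Definition conj_list (l : seq latom) (a : latom) : qf latom :=
  foldr (fun b f => QAnd (QAtom b) f) (QAtom a) l.

Definition red_atom (psi : bool) (S L F : nat) (a : tatom) : qf latom :=
  if psi then conj_list (psi_atoms S F a) psi_last
  else disj_list (phi_atoms S L F a) (phi_last S).

Fixpoint qalloc (f : qf tatom) : nat :=
  match f with
  | QAtom a => aalloc a
  | QAnd f g => (qalloc f + qalloc g)%N
  | QOr f g => (qalloc f + qalloc g)%N
  end.

Fixpoint red_qf (psi : bool) (S L F : nat) (f : qf tatom) : qf latom :=
  match f with
  | QAtom a => red_atom psi S L F a
  | QAnd f g => QAnd (red_qf psi S L F f) (red_qf psi S L (F + qalloc f) g)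
  | QOr f g => QOr (red_qf psi S L F f) (red_qf psi S L (F + qalloc f) g)
  end.

(** Of the [(L + L).+1] new variables, the first [L.+1] form the chain from s to delta, the others
    are fresh for nodes. They follow Y, hence are universal, and Psi still avoids X. The fresh
    variables of Psi and Phi are disjoint. *)
Definition red_sentence (L : nat) (s : sentence tatom) : sentence latom :=
  match s with
  | Sig2 m n phi =>
      Sig2 m (n + (L + L).+1) (red_qf false (m + n) L (m + n + L).+1 phi)
  | BSig2 m n phi =>
      BSig2 m (n + (L + L).+1) (red_qf false (m + n) L (m + n + L).+1 phi)
  | BSig2pp m n psi phi =>
      BSig2pp m (n + (L + L).+1) (red_qf true (m + n) L (m + n + L).+1 psi)
        (red_qf false (m + n) L ((m + n + L).+1 + qalloc psi) phi)
  end.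

Definition salloc (s : sentence tatom) : nat :=
  match s with
  | Sig2 _ _ phi | BSig2 _ _ phi => qalloc phi
  | BSig2pp _ _ psi phi => (qalloc psi + qalloc phi)%N
  end.

(** * Membership in lists of clauses *)

Lemma In_cat (T : Type) (x : T) s1 s2 :
  List.In x (s1 ++ s2) <-> List.In x s1 \/ List.In x s2.
Proof. by elim: s1 => [|y s1 IH] /=; [split=> [|[]] //; right | rewrite IH; tauto]. Qed.

Lemma In_map (T U : Type) (f : T -> U) x s : List.In x s -> List.In (f x) (map f s).
Proof. by elim: s => [|y s IH] //= [->|/IH]; [left | right]. Qed.

Lemma In_map_inv (T U : Type) (f : T -> U) y s :
  List.In y (map f s) -> exists2 x, List.In x s & y = f x.
Proof.
elim: s => [|x s IH] //= [<-|/IH [z hz ->]]; [exists x | exists z] => //; [by left|by right].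
Qed.

Lemma In_flatten_map (T U : Type) (f : T -> seq U) x y s :
  List.In x s -> List.In y (f x) -> List.In y (flatten (map f s)).
Proof.
elim: s => [|z s IH] //= [->|hx] hy; apply/In_cat; [by left | by right; exact: IH].
Qed.

Lemma In_flatten_map_inv (T U : Type) (f : T -> seq U) y s :
  List.In y (flatten (map f s)) -> exists2 x, List.In x s & List.In y (f x).
Proof.
elim: s => [|z s IH] //= /In_cat [hy|/IH [x hx hy]]; [exists z | exists x] => //;
  [by left | by right].
Qed.

Lemma In_iota i k n : List.In i (iota k n) <-> (k <= i < k + n)%N.
Proof.
elim: n k => [|n IH] k /=; first by split=> //; lia.
by rewrite IH; split=> [[->|]|h]; [lia | lia | case: (eqVneq k i) => [|ne]; [left|right; lia]].
Qed.

Section RealSemantics.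

Local Open Scope R_scope.

Lemma disj_holds v l a : qf_holds latom_holds v (disj_list l a) <->
  (exists2 b, List.In b l & latom_holds v b) \/ latom_holds v a.
Proof.
elim: l => [|b l IH] /=; first by split=> [?|[[]|]] //; right.
rewrite IH; split.
- by move=> [h|[[c hc h]|h]]; [left; exists b; [left|] | left; exists c; [right|] | right].
- by move=> [[c [<-|hc] h]|h]; [left | right; left; exists c | right; right].
Qed.

Lemma conj_holds v l a : qf_holds latom_holds v (conj_list l a) <->
  (forall b, List.In b l -> latom_holds v b) /\ latom_holds v a.
Proof.
elim: l => [|b l IH] /=; first by split=> [?|[]].
rewrite IH; split.
- by move=> [h [h1 h2]]; split=> // c [<-|]; [|exact: h1].
- by move=> [h1 h2]; split; [apply: h1; left | split=> // c hc; apply: h1; right].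
Qed.

(** * Exact and approximate values at the nodes *)

Definition node_exact (v : nat -> R) (nd : node) : Prop :=
  lpoly_eval v nd.1.1 = lpoly_eval v nd.1.2.

Definition node_near (v : nat -> R) (d : R) (nd : node) : Prop :=
  - d <= lpoly_eval v nd.1.1 - lpoly_eval v nd.1.2 <= d /\ - (1) <= v nd.2 <= 1.

(** Unscaled values of the variables below the root, in order of allocation; the final 0 belongs to
    the variable below the leading digit. *)
Fixpoint dig_vals (p : positive) : seq R :=
  match p with
  | xH => [:: 0]
  | xO q => IZR (Zpos q) :: dig_vals q
  | xI q => IZR (Zpos q) :: dig_vals q
  end.

Fixpoint tvals (v : nat -> R) (t : term) : seq R :=
  match t with
  | TVar _ => [::]
  | TConst Z0 => [::]
  | TConst (Zpos p) => dig_vals p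
  | TConst (Zneg p) => IZR (Zpos p) :: dig_vals p
  | TAdd a b => [:: teval v a, teval v b & tvals v a ++ tvals v b]
  | TMul a b => [:: teval v a, teval v b & tvals v a ++ tvals v b]
  end.

Definition avals v (a : tatom) : seq R :=
  let: (s, t) := tatom_sides a in
  [:: teval v s, teval v t & tvals v s ++ tvals v t].

Fixpoint qvals v (f : qf tatom) : seq R :=
  match f with
  | QAtom a => avals v a
  | QAnd f g => qvals v f ++ qvals v g
  | QOr f g => qvals v f ++ qvals v g
  end.

Lemma size_dig_vals p : size (dig_vals p) = dig_alloc p.
Proof. by elim: p => //= q ->. Qed.

Lemma size_tvals v t : size (tvals v t) = talloc t.
Proof.
by elim: t => [|[|p|p]|a IHa b IHb|a IHa b IHb] //=;
  rewrite ?size_dig_vals ?size_cat ?IHa ?IHb.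
Qed.

Lemma size_qvals v f : size (qvals v f) = qalloc f.
Proof.
elim: f => [a|f IHf g IHg|f IHf g IHg] /=; rewrite ?size_cat ?IHf ?IHg //.
by rewrite /avals /aalloc; case: (tatom_sides a) => s t /=; rewrite size_cat !size_tvals.
Qed.

(* The allocated variables from F on hold s times the listed values. *)
Definition holds_vals (v : nat -> R) (s : R) (F : nat) (l : seq R) : Prop :=
  forall i, (i < size l)%N -> v (F + i)%N = s * nth 0 l i.

Lemma holds_vals_cons v s F x l :
  holds_vals v s F (x :: l) -> v F = s * x /\ holds_vals v s F.+1 l.
Proof.
move=> H; split; first by have := H 0%N isT; rewrite addn0.
by move=> i hi; rewrite addSnnS; apply: (H i.+1).
Qed.

Lemma holds_vals_cat v s F l1 l2 : holds_vals v s F (l1 ++ l2) ->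
  holds_vals v s F l1 /\ holds_vals v s (F + size l1) l2.
Proof.
move=> H; split=> i hi.
- by rewrite H ?nth_cat ?hi // size_cat; lia.
- rewrite -addnA H ?nth_cat ?size_cat; last lia.
  by case: ifP; [lia | rewrite addKn].
Qed.

Lemma dig_nodes_exact v S c F p :
  v c = v S * IZR (Zpos p) -> holds_vals v (v S) F (dig_vals p) ->
  forall nd, List.In nd (dig_nodes S c F p) -> node_exact v nd.
Proof.
elim: p c F => [q IH|q IH|] c F ec /=.
- move=> /holds_vals_cons [eF H] nd [<-|]; last exact: IH.
  by rewrite /node_exact /= ec eF (Pos2Z.inj_xI q) plus_IZR mult_IZR; lra.
- move=> /holds_vals_cons [eF H] nd [<-|]; last exact: IH.
  by rewrite /node_exact /= ec eF (Pos2Z.inj_xO q) mult_IZR; lra.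
- move=> /holds_vals_cons [eF H] nd [<-|[<-|[]]]; rewrite /node_exact /= ?ec ?eF; lra.
Qed.

Lemma nodes_exact v S c F t :
  v c = v S * teval v t -> holds_vals v (v S) F (tvals v t) ->
  forall nd, List.In nd (nodes S c F t) -> node_exact v nd.
Proof.
elim: t c F => [i|[|p|p]|a IHa b IHb|a IHa b IHb] c F ec /=.
- by move=> _ nd [<-|[]]; rewrite /node_exact /= ec /=; lra.
- by move=> _ nd [<-|[]]; rewrite /node_exact /= ec /=; lra.
- by move=> H; apply: dig_nodes_exact H.
- move=> /holds_vals_cons [eF H] nd [<-|]; last exact: dig_nodes_exact.
  by rewrite /node_exact /= ec eF /= -(Pos2Z.opp_pos p) opp_IZR; lra.
- move=> /holds_vals_cons [e1 /holds_vals_cons [e2 /holds_vals_cat [H1 H2]]] nd.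
  rewrite size_tvals in H2; case=> [<-|/In_cat[]]; [|exact: IHa|exact: IHb].
  by rewrite /node_exact /= ec e1 e2 /=; lra.
- move=> /holds_vals_cons [e1 /holds_vals_cons [e2 /holds_vals_cat [H1 H2]]] nd.
  rewrite size_tvals in H2; case=> [<-|/In_cat[]]; [|exact: IHa|exact: IHb].
  by rewrite /node_exact /= ec e1 e2 /=; lra.
Qed.

Lemma dig_nodes_ge S c F p k : (k <= c)%N -> (k <= F)%N ->
  forall nd, List.In nd (dig_nodes S c F p) -> (k <= nd.2)%N.
Proof.
by elim: p c F => [q IH|q IH|] c F hc hF nd /= [<-|] //;
  try (by apply: IH => //; lia); case=> // <-.
Qed.

Lemma nodes_ge S c F t k : (k <= c)%N -> (k <= F)%N ->
  forall nd, List.In nd (nodes S c F t) -> (k <= nd.2)%N.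
Proof.
elim: t c F => [i|[|p|p]|a IHa b IHb|a IHa b IHb] c F hc hF nd /=.
- by case=> // <-.
- by case=> // <-.
- exact: dig_nodes_ge.
- by case=> [<-|] //; apply: dig_nodes_ge; lia.
- by case=> [<-|/In_cat[]] //; [apply: IHa | apply: IHb]; lia.
- by case=> [<-|/In_cat[]] //; [apply: IHa | apply: IHb]; lia.
Qed.

Lemma dig_nodes_value v S c F p :
  (forall nd, List.In nd (dig_nodes S c F p) -> node_exact v nd) ->
  v c = v S * IZR (Zpos p).
Proof.
elim: p c F => [q IH|q IH|] c F H /=.
- have e1 := H _ (or_introl erefl); have e2 := IH _ _ (fun nd h => H nd (or_intror h)).
  by move: e1; rewrite /node_exact /= (Pos2Z.inj_xI q) plus_IZR mult_IZR e2; lra.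
- have e1 := H _ (or_introl erefl); have e2 := IH _ _ (fun nd h => H nd (or_intror h)).
  by move: e1; rewrite /node_exact /= (Pos2Z.inj_xO q) mult_IZR e2; lra.
- have := H _ (or_introl erefl); have := H _ (or_intror (or_introl erefl)).
  by rewrite /node_exact /=; lra.
Qed.

(** The scale must not vanish because the node of a product determines only [v S * v c]. *)
Lemma nodes_value v S c F t : v S <> 0 ->
  (forall nd, List.In nd (nodes S c F t) -> node_exact v nd) ->
  v c = v S * teval v t.
Proof.
move=> s0; elim: t c F => [i|[|p|p]|a IHa b IHb|a IHa b IHb] c F H /=.
- by have := H _ (or_introl erefl); rewrite /node_exact /=; lra.
- by have := H _ (or_introl erefl); rewrite /node_exact /=; lra.
- exact: dig_nodes_value H.
- have e1 := H _ (or_introl erefl).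
  have e2 := dig_nodes_value (fun nd h => H nd (or_intror h)).
  by move: e1; rewrite /node_exact /= e2 -(Pos2Z.opp_pos p) opp_IZR; lra.
- have e1 := H _ (or_introl erefl).
  have e2 := IHa _ _ (fun nd h => H nd (or_intror (proj2 (In_cat _ _ _) (or_introl h)))).
  have e3 := IHb _ _ (fun nd h => H nd (or_intror (proj2 (In_cat _ _ _) (or_intror h)))).
  by move: e1; rewrite /node_exact /= e2 e3; lra.
- have e1 := H _ (or_introl erefl).
  have e2 := IHa _ _ (fun nd h => H nd (or_intror (proj2 (In_cat _ _ _) (or_introl h)))).
  have e3 := IHb _ _ (fun nd h => H nd (or_intror (proj2 (In_cat _ _ _) (or_intror h)))).
  move: e1; rewrite /node_exact /= e2 e3 => e1.
  by apply: (Rmult_eq_reg_l (v S)) => //; lra.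
Qed.

Lemma mul_bounds x y p q :
  - p <= x <= p -> - q <= y <= q -> - (p * q) <= x * y <= p * q.
Proof. by move=> hx hy; split; nra. Qed.

(** A digit doubles the error from below and adds at most [d], so the error at most triples, which
    [4 <= r] covers. *)
Lemma dig_nodes_near v S c F p d r :
  0 <= d -> 4 <= r ->
  (forall nd, List.In nd (dig_nodes S c F p) -> node_near v d nd) ->
  - (d * r ^ (dig_alloc p).+1) <= v c - v S * IZR (Zpos p) <= d * r ^ (dig_alloc p).+1.
Proof.
move=> d0 r4; elim: p c F => [q IH|q IH|] c F H.
- have [e1 _] := H _ (or_introl erefl).
  have e2 := IH _ _ (fun nd h => H nd (or_intror h)).
  have h1 := pow_R1_Rle r (dig_alloc q).+1 ltac:(lra).
  move: e1; rewrite /= (Pos2Z.inj_xI q) plus_IZR mult_IZR.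
  move: e2; rewrite /=; move: h1; rewrite /=; set X := r * r ^ _ => h1 e2 e1.
  have : d <= d * X by nra.
  by split; nra.
- have [e1 _] := H _ (or_introl erefl).
  have e2 := IH _ _ (fun nd h => H nd (or_intror h)).
  have h1 := pow_R1_Rle r (dig_alloc q).+1 ltac:(lra).
  move: e1; rewrite /= (Pos2Z.inj_xO q) mult_IZR.
  move: e2; rewrite /=; move: h1; rewrite /=; set X := r * r ^ _ => h1 e2 e1.
  have : d <= d * X by nra.
  by split; nra.
- have [e1 _] := H _ (or_introl erefl); have [e2 _] := H _ (or_intror (or_introl erefl)).
  move: e1 e2 => /= e1 e2; have : d * 4 <= d * (r * (r * 1)) by apply: Rmult_le_compat_l => //; nra.
  by split; lra.
Qed.

(** Gives access to the bound on [v c] itself, which [node_near] attaches to the node that defines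
    [c]. *)
Lemma nodes_head S c F t : exists2 nd, List.In nd (nodes S c F t) & nd.2 = c.
Proof.
case: t => [i|[|p|p]|a b|a b] /=.
- by exists (nvar S c i) => //; left.
- by exists (nzero c) => //; left.
- by case: p => [q|q|] /=; (eexists; [left|]); reflexivity.
- by eexists; [left|]; reflexivity.
- by eexists; [left|]; reflexivity.
- by eexists; [left|]; reflexivity.
Qed.

(** The exponent counts allocated variables rather than depth, so both children of a node can be
    given one common bound by monotonicity. [N] ensures that all errors on the way are at most 1,
    which keeps products of approximate values under control. *)
Lemma nodes_near v S c F t d r N :
  0 <= d -> 4 <= r -> 0 < v S -> v S * r = 4 -> d * r ^ N <= 1 ->
  (talloc t < N)%N ->
  (forall nd, List.In nd (nodes S c F t) -> node_near v d nd) ->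
  - (d * r ^ (talloc t).+1) <= v c - v S * teval v t <= d * r ^ (talloc t).+1.
Proof.
move=> d0 r4 s0 sr dN; elim: t c F => [i|[|p|p]|a IHa b IHb|a IHa b IHb] c F hN H.
- by have [/= e1 _] := H _ (or_introl erefl); split; nra.
- by have [/= e1 _] := H _ (or_introl erefl); split; nra.
- by apply: (dig_nodes_near (F := F)).
- have [e1 _] := H _ (or_introl erefl).
  have e2 := dig_nodes_near d0 r4 (fun nd h => H nd (or_intror h)).
  have h1 := pow_R1_Rle r (dig_alloc p).+1 ltac:(lra).
  move: e1; rewrite /= -(Pos2Z.opp_pos p) opp_IZR.
  move: e2; rewrite /=; move: h1; rewrite /=; set X := r * r ^ _ => h1 e2 e1.
  have : d <= d * X by nra.
  by split; nra.
all: have [e1 _] := H _ (or_introl erefl).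
all: have Ha nd : List.In nd (nodes S F F.+2 a) -> node_near v d nd
  by move=> h; apply: H; right; apply/In_cat; left.
all: have Hb nd : List.In nd (nodes S F.+1 (F.+2 + talloc a) b) -> node_near v d nd
  by move=> h; apply: H; right; apply/In_cat; right.
all: have {IHa}ea := IHa _ _ ltac:(rewrite /= in hN; lia) Ha.
all: have {IHb}eb := IHb _ _ ltac:(rewrite /= in hN; lia) Hb.
all: have la := Rle_pow r (talloc a).+1 (talloc a + talloc b).+1 ltac:(lra) ltac:(lia).
all: have lb := Rle_pow r (talloc b).+1 (talloc a + talloc b).+1 ltac:(lra) ltac:(lia).
all: have l1 := pow_R1_Rle r (talloc a + talloc b).+1 ltac:(lra).
all: have lN := Rle_pow r (talloc a + talloc b).+1 N ltac:(lra) ltac:(rewrite /= in hN; lia).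
all: have eq : r ^ (talloc a + talloc b).+3 = r * (r * r ^ (talloc a + talloc b).+1) by [].
all: have {}ea : - (d * r ^ (talloc a + talloc b).+1) <= v F - v S * teval v a
    <= d * r ^ (talloc a + talloc b).+1 by split; nra.
all: have {}eb : - (d * r ^ (talloc a + talloc b).+1) <= v F.+1 - v S * teval v b
    <= d * r ^ (talloc a + talloc b).+1 by split; nra.
all: have hE : d * r ^ (talloc a + talloc b).+1 <= 1 by nra.
all: have hd : d <= d * r ^ (talloc a + talloc b).+1 by nra.
all: rewrite [talloc _]/= eq; move: e1 ea eb hE hd; rewrite [teval _ _]/=.
all: have -> : d * (r * (r * r ^ (talloc a + talloc b).+1))
  = r * r * (d * r ^ (talloc a + talloc b).+1) by lra.
(* [E] is a common error bound of the two children with [d <= E <= 1]. The target is [r * r * E]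
   because a binary node allocates two variables. *)
all: move: (d * r ^ _) => E; rewrite /= => e1 ea eb hE hd.
- have rr : 4 * E <= r * r * E by apply: Rmult_le_compat_r; nra.
  by split; lra.
- have [nb hb eqb] := nodes_head S F.+1 (F.+2 + talloc a) b.
  have [_ ub] := Hb _ hb; rewrite eqb in ub.
  have [na ha eqa] := nodes_head S F F.+2 a.
  have [_ ua] := Ha _ ha; rewrite eqa in ua.
  (* With a, b the values of the children, z_a z_b - s^2 a b = (z_a - s a) z_b + s a (z_b - s b).
     The first summand is at most E since |z_b| <= 1, the second at most 2 E since |s a| <= |z_a| +
     E <= 2. Together with [d <= E] this makes 4 E, and 4 = s r; division by s leaves r E. *)
  have m1 := mul_bounds ea ub.
  have m2 : - (2 * E) <= v S * teval v a * (v F.+1 - v S * teval v b) <= 2 * E.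
    by apply: mul_bounds => //; lra.
  have m3 : - (v S * (r * E)) <= v S * (v c - v S * (teval v a * teval v b)) <= v S * (r * E).
    by rewrite -Rmult_assoc sr; split; nra.
  have m4 : r * E <= r * r * E by nra.
  have m5 : v c - v S * (teval v a * teval v b) <= r * E.
    by apply: (Rmult_le_reg_l (v S)) => //; lra.
  have m6 : - (r * E) <= v c - v S * (teval v a * teval v b).
    by apply: (Rmult_le_reg_l (v S)) => //; lra.
  by lra.
Qed.

Lemma chain_bound v S L : 0 < v S ->
  (forall a, List.In a (chain_atoms S L) -> ~ latom_holds v a) ->
  v (S + L)%N <= v S * (v S / 4) ^ L.
Proof.
move=> s0 H; suff : forall k, (k <= L)%N -> v (S + k)%N <= v S * (v S / 4) ^ k by exact.
elim=> [|k IH] kL; first by rewrite addn0 /=; lra.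
have hk := IH (ltnW kL).
have : ~ latom_holds v ([:: mon [:: S; (S + k)%N]], [:: (Zpos (xO (xO xH)), [:: (S + k).+1])]).
  by apply: H; apply: In_map; apply/In_iota; lia.
rewrite /latom_holds /= -addnS => h.
have {}h : 4 * v (S + k.+1)%N < v S * v (S + k)%N by lra.
have : v S * v (S + k)%N <= v S * (v S * (v S / 4) ^ k) by apply: Rmult_le_compat_l; lra.
by lra.
Qed.

(** If no clause held, both sides would be known up to s^2 / 4 each, and the slack s^2 of the
    comparison clause exceeds the sum of these errors. For a nonpositive scale the closing atom
    holds. *)
Lemma red_phi_atom_true v S L F a :
  (aalloc a <= L)%N ->
  v S <= 0 \/ teval v (tatom_sides a).1 <= teval v (tatom_sides a).2 ->
  qf_holds latom_holds v (red_atom false S L F a).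
Proof.
move=> aL hv; rewrite /red_atom; apply/disj_holds; move: hv.
case ea: (tatom_sides a) => [t u] hv; rewrite [(t, u).1]/= [(t, u).2]/= in hv.
case: (classic (exists2 b, List.In b (phi_atoms S L F a) & latom_holds v b)); first by left.
move=> no; right; rewrite /latom_holds /=; apply: Rnot_lt_le => s0.
have {}s0 : 0 < v S by lra.
have {hv} hv : teval v t <= teval v u by case: hv => //; lra.
have {}no b : List.In b (phi_atoms S L F a) -> ~ latom_holds v b.
  by move=> hb h; apply: no; exists b.
have hh b : List.In b (phi_head S L F) -> ~ latom_holds v b.
  by move=> h; apply: no; apply/In_cat; left.
have h1 := hh _ (or_introl erefl).
have h2 := hh _ (or_intror (or_introl erefl)).
have h3 := hh _ (or_intror (or_intror (or_introl erefl))).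
have h4 := chain_bound s0 (fun b h => hh b (or_intror (or_intror (or_intror h)))).
move: h1 h2 h3; rewrite /latom_holds /= => h1 h2 h3.
have {}h1 : v F.+1 + v S * v S < v F by lra.
have {}h2 : v S < 1 by lra.
have {}h3 : 0 < v (S + L)%N by lra.
have near nd : List.In nd (atom_nodes S F a) -> node_near v (v (S + L)%N) nd.
  move=> hnd.
  have hn b : List.In b (node_phi (S + L) nd) -> ~ latom_holds v b.
    by move=> hb; apply: no; apply/In_cat; right; apply: In_flatten_map hnd hb.
  case: nd {hnd} hn => [[l r] c] hn.
  have := hn _ (or_introl erefl); have := hn _ (or_intror (or_introl erefl)).
  have := hn _ (or_intror (or_intror (or_introl erefl))).
  have := hn _ (or_intror (or_intror (or_intror (or_introl erefl)))).
  by rewrite /latom_holds /node_near /=; lra.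
move: near; rewrite /atom_nodes ea /= => near.
set d := v (S + L)%N in h3 h4 near *; set r := 4 / v S.
have sr : v S * r = 4 by rewrite /r; field; lra.
have r4 : 4 <= r.
  by apply: (Rmult_le_reg_l (v S)) => //; rewrite sr; lra.
(* Each of the [k] factors [r] cancels one factor [v S / 4] of the chain bound; since [k < L], at
   least one further factor [v S / 4] remains. *)
have dr k : (k < L)%N -> d * r ^ k <= v S * (v S / 4).
  move=> kL; have rk : 0 < r ^ k by apply: pow_lt; lra.
  have s1 : v S / 4 * r = 1 by lra.
  have e1 : (v S / 4) ^ k * r ^ k = 1 by rewrite -Rpow_mult_distr s1 pow1.
  have e2 : (v S / 4) ^ L = (v S / 4) ^ k * ((v S / 4) ^ (L - k.+1) * (v S / 4)).
    have -> : L = (k + (L - k.+1 + 1))%N by lia.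
    by rewrite !pow_add pow_1; congr (_ * (_ ^ _ * _)); lia.
  have e3 : (v S / 4) ^ (L - k.+1) <= 1.
    by rewrite -(pow1 (L - k.+1)); apply: pow_incr; lra.
  have e4 : d * r ^ k <= v S * (v S / 4) ^ L * r ^ k by apply: Rmult_le_compat_r; lra.
  apply: Rle_trans e4 _.
  have -> : v S * (v S / 4) ^ L * r ^ k = v S * ((v S / 4) * (v S / 4) ^ (L - k.+1)).
    by rewrite e2 -[RHS]Rmult_1_r -[X in _ = _ * X]e1; ring.
  by apply: Rmult_le_compat_l; nra.
have aL' : ((talloc t + talloc u).+2 <= L)%N by move: aL; rewrite /aalloc ea.
have dN : d * r ^ (talloc t + talloc u).+1 <= 1 by have := dr _ aL'; nra.
have := nodes_near (Rlt_le _ _ h3) r4 s0 sr dN _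
  (fun nd h => near nd (proj2 (In_cat _ _ _) (or_introl h))).
have := nodes_near (Rlt_le _ _ h3) r4 s0 sr dN _
  (fun nd h => near nd (proj2 (In_cat _ _ _) (or_intror h))).
have := dr (talloc t).+1 ltac:(lia); have := dr (talloc u).+1 ltac:(lia).
move=> l1 l2 /(_ ltac:(lia)) n1 /(_ ltac:(lia)) n2.
have : v S * teval v t <= v S * teval v u by apply: Rmult_le_compat_l; lra.
by nra.
Qed.

(** Together with exact nodes these conditions refute every escape clause. The last one also places
    all new variables in I. *)
Definition good_aux (v : nat -> R) (S L : nat) : Prop :=
  [/\ 0 < v S, 0 < v (S + L)%N,
      forall i, (S <= i < S + L)%N -> 4 * v i.+1 < v S * v i &
      forall i, (S <= i)%N -> - (1) < v i < 1].

Definition relaxed (e : R) (v : nat -> R) (a : tatom) : Prop :=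
  teval v (tatom_sides a).1 <= teval v (tatom_sides a).2 + e.

Lemma atom_nodes_exact v S F a : holds_vals v (v S) F (avals v a) ->
  v F = v S * teval v (tatom_sides a).1 /\
  v F.+1 = v S * teval v (tatom_sides a).2 /\
  forall nd, List.In nd (atom_nodes S F a) -> node_exact v nd.
Proof.
rewrite /avals /atom_nodes; case: (tatom_sides a) => t u /=.
move=> /holds_vals_cons [e1 /holds_vals_cons [e2 /holds_vals_cat [H1 H2]]].
split=> //; split=> // nd /In_cat [].
- exact: nodes_exact e1 H1 nd.
- by rewrite size_tvals in H2; exact: nodes_exact e2 H2 nd.
Qed.

(** Only the comparison clause can be true, and dividing z_t <= z_u + s^2 by s leaves the slack
    s. *)
Lemma red_phi_atom_relaxed v S L F a :
  good_aux v S L -> (S <= F)%N -> holds_vals v (v S) F (avals v a) ->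
  qf_holds latom_holds v (red_atom false S L F a) -> relaxed (v S) v a.
Proof.
rewrite /red_atom => -[s0 d0 ch bd] SF /atom_nodes_exact [e1 [e2 ex]] /disj_holds [[b]|]; last first.
  by rewrite /latom_holds /=; lra.
move=> /In_cat [|].
- rewrite /phi_head /chain_atoms /= => -[<-|[<-|[<-|hc]]].
  + rewrite /latom_holds /relaxed /= e1 e2 => h.
    by apply: (Rmult_le_reg_l (v S)) => //; lra.
  + by rewrite /latom_holds /=; have := bd S (leqnn _); lra.
  + by rewrite /latom_holds /=; lra.
  + have [i /In_iota hi ->] := In_map_inv hc.
    by rewrite /latom_holds /=; have := ch i hi; lra.
- move=> hf; have [nd hnd hb] := In_flatten_map_inv hf; clear hf.
  have := ex nd hnd; rewrite /node_exact.
  have hS : (S <= nd.2)%N.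
    by move: hnd; rewrite /atom_nodes => /In_cat []; apply: nodes_ge; lia.
  have := bd _ hS; move: hb; case: nd {hnd hS} => [[l r] c] /= hb bc elr.
  by case: hb => [<-|[<-|[<-|[<-|[]]]]]; rewrite /latom_holds /=; lra.
Qed.

Lemma red_psi_atom_true v S L F a :
  0 < v S -> holds_vals v (v S) F (avals v a) ->
  teval v (tatom_sides a).1 <= teval v (tatom_sides a).2 ->
  qf_holds latom_holds v (red_atom true S L F a).
Proof.
rewrite /red_atom => s0 /atom_nodes_exact [e1 [e2 ex]] h; apply/conj_holds; split; last first.
  by rewrite /latom_holds /=; lra.
move=> b [<-|hf].
  rewrite /latom_holds /= e1 e2.
  have : v S * teval v (tatom_sides a).1 <= v S * teval v (tatom_sides a).2.
    by apply: Rmult_le_compat_l; lra.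
  by lra.
have [nd /ex] := In_flatten_map_inv hf.
rewrite /node_exact; case: nd => [[l r] c] /= e.
by case=> [<-|[<-|[]]]; rewrite /latom_holds /=; lra.
Qed.

Lemma red_psi_atom_holds v S L F a :
  0 < v S -> qf_holds latom_holds v (red_atom true S L F a) ->
  teval v (tatom_sides a).1 <= teval v (tatom_sides a).2.
Proof.
rewrite /red_atom => s0 /conj_holds [H _].
have h1 := H _ (or_introl erefl).
have ex nd : List.In nd (atom_nodes S F a) -> node_exact v nd.
  move=> hnd; have Hn b hb := H b (or_intror (In_flatten_map hnd hb)).
  case: nd {hnd} Hn => [[l r] c] Hn.
  have := Hn _ (or_introl erefl); have := Hn _ (or_intror (or_introl erefl)).
  by rewrite /latom_holds /node_exact /=; lra.
have s0' : v S <> 0 by lra.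
have e1 := nodes_value s0' (fun nd h => ex nd (proj2 (In_cat _ _ _) (or_introl h))).
have e2 := nodes_value s0' (fun nd h => ex nd (proj2 (In_cat _ _ _) (or_intror h))).
move: h1; rewrite /latom_holds /= e1 e2 => h1.
by apply: (Rmult_le_reg_l (v S)) => //; lra.
Qed.

(** * Formulas and the limit of small scales *)

Definition is_tle (a : tatom) : Prop := if a is TLe _ _ then True else False.

Lemma tle_holds v a : is_tle a -> tatom_holds v a <->
  teval v (tatom_sides a).1 <= teval v (tatom_sides a).2.
Proof. by case: a. Qed.

Lemma red_phi_true v S L F f : qf_all is_tle f -> (qalloc f <= L)%N ->
  v S <= 0 \/ qf_holds tatom_holds v f ->
  qf_holds latom_holds v (red_qf false S L F f).
Proof.
elim: f F => [a|f IHf g IHg|f IHf g IHg] F /=.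
- move=> ha aL hv; apply: red_phi_atom_true => //.
  by case: hv => [|/(tle_holds _ ha)]; [left | right].
- move=> [hf hg] aL hv; split; [apply: IHf | apply: IHg] => //; try lia; tauto.
- move=> [hf hg] aL [hv|[hv|hv]].
  + by left; apply: IHf => //; [lia | left].
  + by left; apply: IHf => //; [lia | right].
  + by right; apply: IHg => //; [lia | right].
Qed.

Lemma red_phi_relaxed v S L F f :
  good_aux v S L -> (S <= F)%N -> holds_vals v (v S) F (qvals v f) ->
  qf_holds latom_holds v (red_qf false S L F f) -> qf_holds (relaxed (v S)) v f.
Proof.
move=> gd; elim: f F => [a|f IHf g IHg|f IHf g IHg] F SF /=.
- exact: red_phi_atom_relaxed.
- move=> /holds_vals_cat; rewrite size_qvals => -[H1 H2] [h1 h2].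
  by split; [apply: (IHf F) | apply: IHg h2 => //; lia].
- move=> /holds_vals_cat; rewrite size_qvals => -[H1 H2] [h1|h2].
  + by left; apply: (IHf F).
  + by right; apply: IHg h2 => //; lia.
Qed.

Lemma red_psi_true v S L F f : qf_all is_tle f ->
  0 < v S -> holds_vals v (v S) F (qvals v f) -> qf_holds tatom_holds v f ->
  qf_holds latom_holds v (red_qf true S L F f).
Proof.
move=> + s0; elim: f F => [a|f IHf g IHg|f IHf g IHg] F /=.
- by move=> ha H /(tle_holds _ ha); exact: red_psi_atom_true.
- move=> [hf hg] /holds_vals_cat; rewrite size_qvals => -[H1 H2] [h1 h2].
  by split; [apply: IHf | apply: IHg].
- move=> [hf hg] /holds_vals_cat; rewrite size_qvals => -[H1 H2] [h1|h2].
  + by left; apply: IHf.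
  + by right; apply: IHg.
Qed.

Lemma red_psi_holds v S L F f : qf_all is_tle f ->
  0 < v S -> qf_holds latom_holds v (red_qf true S L F f) -> qf_holds tatom_holds v f.
Proof.
move=> + s0; elim: f F => [a|f IHf g IHg|f IHf g IHg] F /=.
- by move=> ha h; apply/(tle_holds _ ha); exact: (@red_psi_atom_holds v S L F a s0 h).
- by move=> [hf hg] [/IHf h1 /IHg h2]; split; [apply: h1 | apply: h2].
- by move=> [hf hg] [/IHf h1|/IHg h2]; [left; apply: h1 | right; apply: h2].
Qed.

(** A false non-strict atom stays false under every sufficiently small relaxation, and the finitely
    many atoms of a formula have a common threshold. A strict atom with equal sides would become
    true under any relaxation. *)
Lemma relaxed_limit v f : qf_all is_tle f ->
  (forall eps, 0 < eps -> exists2 e, 0 < e < eps & qf_holds (relaxed e) v f) ->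
  qf_holds tatom_holds v f.
Proof.
move=> hf H; apply: NNPP => nh.
suff [eps e0 he] : exists2 eps, 0 < eps &
    forall e, 0 < e < eps -> ~ qf_holds (relaxed e) v f.
  by have [e /he] := H _ e0.
elim: f hf nh {H} => [a|f IHf g IHg|f IHf g IHg] /=.
- move=> ha; rewrite (tle_holds _ ha) => na.
  exists (teval v (tatom_sides a).1 - teval v (tatom_sides a).2); first lra.
  by rewrite /relaxed => e he; lra.
- move=> [hf hg] nh; case: (not_and_or _ _ nh) => h.
  + have [eps e0 he] := IHf hf h.
    by exists eps => // e /he h' [].
  + have [eps e0 he] := IHg hg h.
    by exists eps => // e /he h' [].
- move=> [hf hg] nh; have [nf ng] := not_or_and _ _ nh.
  have [e1 p1 h1] := IHf hf nf; have [e2 p2 h2] := IHg hg ng.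
  exists (Rmin e1 e2); first exact: Rmin_pos.
  move=> e he; have := Rmin_l e1 e2; have := Rmin_r e1 e2 => l1 l2.
  by case; [apply: h1 | apply: h2]; lra.
Qed.

Lemma teval_ext v w t : (forall i, i \in term_vars t -> v i = w i) -> teval v t = teval w t.
Proof.
elim: t => [i|z|a IHa b IHb|a IHa b IHb] //= H; first by apply: H; rewrite inE.
- by rewrite IHa ?IHb // => i hi; apply: H; rewrite mem_cat hi ?orbT.
- by rewrite IHa ?IHb // => i hi; apply: H; rewrite mem_cat hi ?orbT.
Qed.

Lemma tvals_ext v w t : (forall i, i \in term_vars t -> v i = w i) -> tvals v t = tvals w t.
Proof.
elim: t => [i|z|a IHa b IHb|a IHa b IHb] //= H.
all: have Ha i : i \in term_vars a -> v i = w i by move=> hi; apply: H; rewrite mem_cat hi.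
all: have Hb i : i \in term_vars b -> v i = w i by move=> hi; apply: H; rewrite mem_cat hi orbT.
all: by rewrite IHa // IHb // (teval_ext Ha) (teval_ext Hb).
Qed.

Lemma tatom_ok_tle lo hi a : tatom_ok lo hi a -> is_tle a.
Proof. by case: a. Qed.

Lemma qf_all_imp (A : Type) (P Q : A -> Prop) f :
  (forall a, P a -> Q a) -> qf_all P f -> qf_all Q f.
Proof. by move=> H; elim: f => [a /=|f IHf g IHg [hf hg]|f IHf g IHg [hf hg]] /=; auto. Qed.

Lemma tatom_sides_ext v w lo k a : (forall i, (i < k)%N -> v i = w i) ->
  tatom_ok lo k a ->
  [/\ teval v (tatom_sides a).1 = teval w (tatom_sides a).1,
      teval v (tatom_sides a).2 = teval w (tatom_sides a).2 & avals v a = avals w a].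
Proof.
case: a => // t u H /= ok.
have H1 i : i \in term_vars t -> v i = w i.
  by move=> hi; apply: H; have := ok i; rewrite mem_cat hi => /(_ isT); lia.
have H2 i : i \in term_vars u -> v i = w i.
  by move=> hi; apply: H; have := ok i; rewrite mem_cat hi orbT => /(_ isT); lia.
by rewrite /avals /= (teval_ext H1) (teval_ext H2) (tvals_ext H1) (tvals_ext H2).
Qed.

Lemma qvals_ext v w lo k f : (forall i, (i < k)%N -> v i = w i) ->
  qf_all (tatom_ok lo k) f -> qvals v f = qvals w f.
Proof.
move=> H; elim: f => [a ok|f IHf g IHg [hf hg]|f IHf g IHg [hf hg]] /=;
  rewrite ?IHf ?IHg //.
by have [] := tatom_sides_ext H ok.
Qed.

Lemma relaxed_ext v w lo k f e : (forall i, (i < k)%N -> v i = w i) ->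
  qf_all (tatom_ok lo k) f -> qf_holds (relaxed e) v f -> qf_holds (relaxed e) w f.
Proof.
move=> H; elim: f => [a ok|f IHf g IHg [hf hg]|f IHf g IHg [hf hg]] /=.
- by rewrite /relaxed; have [-> -> _] := tatom_sides_ext H ok.
- by move=> [h1 h2]; split; [apply: IHf | apply: IHg].
- by move=> [h|h]; [left; apply: IHf | right; apply: IHg].
Qed.

Lemma tatom_holds_ext v w lo k f : (forall i, (i < k)%N -> v i = w i) ->
  qf_all (tatom_ok lo k) f -> qf_holds tatom_holds v f -> qf_holds tatom_holds w f.
Proof.
move=> H; elim: f => [a ok|f IHf g IHg [hf hg]|f IHf g IHg [hf hg]] /=.
- have [e1 e2 _] := tatom_sides_ext H ok; have ha := tatom_ok_tle ok.
  by rewrite !(tle_holds _ ha) e1 e2.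
- by move=> [h1 h2]; split; [apply: IHf | apply: IHg].
- by move=> [h|h]; [left; apply: IHf | right; apply: IHg].
Qed.

(** The ratio s / 8 meets the strict condition on the chain with a factor 2 to spare. Past the end
    of [l] the default of [nth] is 0, so the remaining variables lie in I as well. *)
Definition ext_val (v : nat -> R) (S L : nat) (s : R) (l : seq R) : nat -> R :=
  fun i => if (i < S)%N then v i
           else if (i <= S + L)%N then s * (s / 8) ^ (i - S)
           else s * nth 0 l (i - (S + L).+1).

Lemma nth_bounded (l : seq R) : exists2 M, 0 < M & forall i, - M <= nth 0 l i <= M.
Proof.
elim: l => [|x l [M M0 IH]]; first by exists 1; [lra | move=> i; rewrite nth_nil; lra].
exists (M + Rabs x); first by have := Rabs_pos x; lra.
have := Rle_abs x; have := Rle_abs (- x); rewrite Rabs_Ropp => h1 h2 [|i] /=; first lra.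
by have := IH i; have := Rabs_pos x; lra.
Qed.

Lemma ext_val_good v S L l eps : 0 < eps -> exists2 s, 0 < s < eps &
  let w := ext_val v S L s l in
  [/\ w S = s, good_aux w S L & holds_vals w s (S + L).+1 l].
Proof.
move=> e0; have [M M0 hM] := nth_bounded l.
have [s s0 hs] : exists2 s, 0 < s & s <= / 2 /\ s < eps /\ s * M < 1.
  (* The bound 1 / 2 keeps the chain below 1, [eps / 2] makes the scale small, and [/ (M + 1)]
     brings all scaled values below 1 in absolute value. *)
  pose s := Rmin (/ 2) (Rmin (eps / 2) (/ (M + 1))).
  have i0 : 0 < / (M + 1) by apply: Rinv_0_lt_compat; lra.
  have l1 := Rmin_l (/ 2) (Rmin (eps / 2) (/ (M + 1))).
  have l2 := Rmin_r (/ 2) (Rmin (eps / 2) (/ (M + 1))).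
  have l3 := Rmin_l (eps / 2) (/ (M + 1)); have l4 := Rmin_r (eps / 2) (/ (M + 1)).
  exists s; first by apply: Rmin_pos; [|apply: Rmin_pos]; lra.
  rewrite /s; split; [|split]; try lra.
  have hi : / (M + 1) * (M + 1) = 1 by field; lra.
  have := @Rmult_le_compat_r (M + 1) s (/ (M + 1)) ltac:(lra) ltac:(rewrite /s; lra).
  rewrite hi.
  have : 0 < s by apply: Rmin_pos; [|apply: Rmin_pos]; lra.
  by rewrite /s; lra.
exists s; first lra.
have chain i : (S <= i <= S + L)%N -> ext_val v S L s l i = s * (s / 8) ^ (i - S).
  by move=> h; rewrite /ext_val; case: ifP; [lia | case: ifP => //; lia].
have tail i : (S + L < i)%N -> ext_val v S L s l i = s * nth 0 l (i - (S + L).+1).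
  by move=> h; rewrite /ext_val; case: ifP; [lia | case: ifP => //; lia].
have eS : ext_val v S L s l S = s by rewrite chain ?subnn /=; [lra | lia].
have pw k : 0 < (s / 8) ^ k <= 1.
  split; first by apply: pow_lt; lra.
  by rewrite -(pow1 k); apply: pow_incr; lra.
split=> //; last first.
  move=> i hi; rewrite tail; last lia.
  by have -> : ((S + L).+1 + i - (S + L).+1 = i)%N by lia.
split; rewrite ?eS //.
- rewrite chain; last lia. by apply: Rmult_lt_0_compat => //; have := pw (S + L - S)%N; lra.
- move=> i hi; rewrite !chain; [|lia|lia].
  have -> : (i.+1 - S = (i - S).+1)%N by lia.
  have := pw (i - S)%N; rewrite /= => hp.
  have : 0 < s * (s * (s / 8) ^ (i - S)) by do 2 (apply: Rmult_lt_0_compat => //); lra.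
  by lra.
- move=> i hi; case: (leqP i (S + L)) => h.
  + rewrite chain; last lia. have := pw (i - S)%N => hp; split; nra.
  + rewrite tail //. have := hM (i - (S + L).+1)%N => hp; split; nra.
Qed.

Lemma ext_val_lt v S L s l i : (i < S)%N -> ext_val v S L s l i = v i.
Proof. by rewrite /ext_val => ->. Qed.

Lemma ext_val_XY m n x y L s l :
  let w := ext_val (valXY m x y) (m + n) L s l in
  valXY m x (fun j => w (m + j)%N) = w.
Proof.
apply: functional_extensionality => i; rewrite {1}/valXY; case: ifP => h.
- rewrite ext_val_lt; last lia. by rewrite /valXY h.
- by congr ext_val; lia.
Qed.

(* Soundness of the matrix: letting the scale tend to 0 in the extended
   valuations recovers the original matrix. *)
Lemma red_matrix_sound m n L x y l phi :
  qf_all (tatom_ok 0 (m + n)) phi ->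
  (forall s, let w := ext_val (valXY m x y) (m + n) L s (l ++ qvals (valXY m x y) phi) in
     0 < s -> w (m + n)%N = s -> good_aux w (m + n) L ->
     holds_vals w s (m + n + L).+1 l ->
     qf_holds latom_holds w (red_qf false (m + n) L ((m + n + L).+1 + size l) phi)) ->
  qf_holds tatom_holds (valXY m x y) phi.
Proof.
move=> ok H; apply: relaxed_limit; first exact: qf_all_imp (@tatom_ok_tle _ _) ok.
move=> eps e0; set v := valXY m x y in H *.
have [s [s0 se] [eS gd hv]] := ext_val_good v (m + n) L (l ++ qvals v phi) e0.
exists s => //; have [hl hp] := holds_vals_cat hv.
have agree i : (i < m + n)%N -> ext_val v (m + n) L s (l ++ qvals v phi) i = v i.
  exact: ext_val_lt.
apply: (relaxed_ext agree ok); rewrite -{1}eS.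
apply: red_phi_relaxed (H s s0 eS gd hl) => //; first lia.
by rewrite (qvals_ext agree ok) eS.
Qed.

Theorem red_sentence_equiv C s L :
  in_class tatom_ok C s -> (salloc s <= L)%N ->
  sentence_true latom_holds (red_sentence L s) <-> sentence_true tatom_holds s.
Proof.
have boxS k k' z : (k <= k')%N -> in_box k' z -> in_box k z.
  by move=> kk H j hj; apply: H; lia.
have box_ext m n x y L' s' l : good_aux (ext_val (valXY m x y) (m + n) L' s' l) (m + n) L' ->
    in_box n y ->
    in_box (n + (L' + L').+1)
      (fun j => ext_val (valXY m x y) (m + n) L' s' l (m + j)%N).
  move=> [_ _ _ bd] by_ j hj; case: (ltnP j n) => h; last first.
    by have := bd (m + j)%N ltac:(lia); lra.
  rewrite ext_val_lt; last lia.
  by rewrite /valXY; case: ifP; [lia | rewrite addKn => _; exact: by_].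
case: C s => [] [m n phi|m n phi|m n psi phi] //=.
- move=> ok aL; have tle := qf_all_imp (@tatom_ok_tle _ _) ok; split=> -[x H]; exists x => y.
  + apply: (@red_matrix_sound m n L x y [::]) => // s w _ _ _ _.
    by have := H (fun j => w (m + j)%N); rewrite ext_val_XY addn0.
  + by apply: red_phi_true => //; right; apply: H.
- move=> ok aL; have tle := qf_all_imp (@tatom_ok_tle _ _) ok; split=> -[x H]; exists x => y.
  + case: (classic (in_box n y)) => by_; last by left.
    (* The bound on [x] is a conjunct of the matrix, so a single admissible choice of the new
       variables yields it; here the node variables are all 0. *)
    have bx : in_box m x.
      have [s _ [_ gd _]] := @ext_val_good (valXY m x y) (m + n) L [::] 1 ltac:(lra).
      have := H (fun j => ext_val (valXY m x y) (m + n) L s [::] (m + j)%N).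
      by case=> [[]|[]] //; apply: box_ext gd by_.
    right; split=> //.
    apply: (@red_matrix_sound m n L x y [::]) => // s w _ _ gd _.
    have := H (fun j => w (m + j)%N); rewrite ext_val_XY addn0.
    by case=> [[]|[]] //; apply: box_ext.
  + case: (classic (in_box (n + (L + L).+1) y)) => by_; last by left.
    have [[]|[bx h]] := H y; first by apply: boxS by_; lia.
    by right; split=> //; apply: red_phi_true => //; right.
- move=> [okp ok] aL; have tle := qf_all_imp (@tatom_ok_tle _ _) ok.
  have tlep := qf_all_imp (@tatom_ok_tle _ _) okp; split=> -[x H]; exists x => y.
  + case: (classic (in_box n y)) => by_; last by left.
    have bx : in_box m x.
      have [s _ [_ gd _]] := @ext_val_good (valXY m x y) (m + n) L [::] 1 ltac:(lra).
      have := H (fun j => ext_val (valXY m x y) (m + n) L s [::] (m + j)%N).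
      by case=> [[]|[]] //; apply: box_ext gd by_.
    right; split=> // hpsi.
    apply: (@red_matrix_sound m n L x y (qvals (valXY m x y) psi)) => // s w s0 eS gd hv.
    have := H (fun j => w (m + j)%N); rewrite ext_val_XY size_qvals.
    case=> [[]|[_]]; first exact: box_ext.
    have agree i : (i < m + n)%N -> valXY m x y i = w i.
      by move=> hi; rewrite /w ext_val_lt.
    apply; rewrite -/w; apply: red_psi_true => //; rewrite ?eS //.
    * by rewrite -(qvals_ext agree okp).
    * exact: tatom_holds_ext agree okp hpsi.
  + case: (classic (in_box (n + (L + L).+1) y)) => by_; last by left.
    have [[]|[bx h]] := H y; first by apply: boxS by_; lia.
    right; split=> // hpsi; apply: red_phi_true => //; first lia.
    (* For a nonpositive scale the translated Psi need not imply Psi, but then the translated Phi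
       holds by its clause on s. *)
    case: (Rle_lt_dec (valXY m x y (m + n)%N) 0) => s0; first by left.
    by right; apply: h; apply: red_psi_holds s0 hpsi.
Qed.

End RealSemantics.

(** * Terms and standard encodings *)

Definition exponents (hi : nat) (ix : seq nat) : seq nat :=
  [seq count_mem p ix | p <- iota 0 hi].

Definition lmono_term (cm : Z * seq nat) : term :=
  foldr (fun i t => TMul (TVar i) t) (TConst cm.1) cm.2.

Definition lpoly_term (p : lpoly) : term :=
  foldr (fun cm t => TAdd (lmono_term cm) t) (TConst Z0) p.

Definition latom_tatom (a : latom) : tatom := TLe (lpoly_term a.1) (lpoly_term a.2).

Definition lpoly_std (hi : nat) (p : lpoly) : stdpoly :=
  [seq (exponents hi cm.2, cm.1) | cm <- p].

Definition latom_satom (hi : nat) (a : latom) : satom :=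
  SLe (lpoly_std hi a.1) (lpoly_std hi a.2).

Fixpoint qmap (A B : Type) (h : A -> B) (f : qf A) : qf B :=
  match f with
  | QAtom a => QAtom (h a)
  | QAnd f g => QAnd (qmap h f) (qmap h g)
  | QOr f g => QOr (qmap h f) (qmap h g)
  end.

Definition smap (A B : Type) (h : A -> B) (s : sentence A) : sentence B :=
  match s with
  | Sig2 m n phi => Sig2 m n (qmap h phi)
  | BSig2 m n phi => BSig2 m n (qmap h phi)
  | BSig2pp m n psi phi => BSig2pp m n (qmap h psi) (qmap h phi)
  end.

Definition lpoly_ok (lo hi : nat) (p : lpoly) : bool :=
  all (fun cm => (size cm.2 <= 2)%N && all (fun i => lo <= i < hi)%N cm.2) p.

Definition latom_ok (lo hi : nat) (a : latom) : Prop :=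
  lpoly_ok lo hi a.1 && lpoly_ok lo hi a.2.

Lemma lpoly_term_eval v p : teval v (lpoly_term p) = lpoly_eval v p.
Proof.
elim: p => [|[c ix] p IH] //=; rewrite IH; congr Rplus.
elim: ix => [|i ix IHi] /=; first by rewrite Rmult_1_r.
by rewrite -/(lmono_term (c, ix)) -/(lmono_eval v ix) IHi; ring.
Qed.

Lemma latom_tatom_holds v a : tatom_holds v (latom_tatom a) <-> latom_holds v a.
Proof. by rewrite /= !lpoly_term_eval. Qed.

(** One more occurrence of [i] raises a single exponent. The start [k] is general because evaluation
    shifts it at each variable. *)
Lemma exponents_cons_eval v k n i (f : nat -> nat) :
  mon_eval_from v k [seq ((i == p) + f p)%N | p <- iota k n]
  = Rmult (if (k <= i < k + n)%N then v i else R1)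
      (mon_eval_from v k [seq f p | p <- iota k n]).
Proof.
elim: n k => [|n IH] k /=; first by case: ifP => [|_]; [lia | rewrite Rmult_1_l].
rewrite IH pow_add.
case: (eqVneq i k) => [->|ne].
- have -> : (k < k < k.+1 + n)%N = false by lia.
  have -> : (k <= k < k + n.+1)%N by lia.
  by rewrite /=; ring.
- have -> : (k < i < k.+1 + n)%N = (k <= i < k + n.+1)%N by lia.
  by rewrite /=; ring.
Qed.

Lemma exponents_eval v hi ix : all (fun i => i < hi)%N ix ->
  mon_eval_from v 0 (exponents hi ix) = lmono_eval v ix.
Proof.
rewrite /exponents; elim: ix => [|i ix IH] /=.
  have one k n : mon_eval_from v k [seq 0%N | _ <- iota k n] = R1.
    by elim: n k => [|n IHn] k //=; rewrite IHn Rmult_1_l.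
  by move=> _; apply: one.
move=> /andP [hi_i /IH <-].
by rewrite (exponents_cons_eval v 0 hi i (fun p => count_mem p ix)) add0n hi_i.
Qed.

Lemma lpoly_std_eval v lo hi p : lpoly_ok lo hi p ->
  std_eval v (lpoly_std hi p) = lpoly_eval v p.
Proof.
elim: p => [|[c ix] p IH] //= /andP [/andP [_ h] /IH ->].
rewrite exponents_eval //; apply: sub_all h => i /andP [] //.
Qed.

Lemma latom_satom_holds v lo hi a : latom_ok lo hi a ->
  satom_holds v (latom_satom hi a) <-> latom_holds v a.
Proof. by move=> /andP [h1 h2]; rewrite /= (lpoly_std_eval _ h1) (lpoly_std_eval _ h2). Qed.

Lemma term_vars_lpoly lo hi p i : lpoly_ok lo hi p ->
  i \in term_vars (lpoly_term p) -> (lo <= i < hi)%N.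
Proof.
elim: p => [|[c ix] p IH] //= /andP [/andP [_ h] /IH {}IH].
rewrite mem_cat => /orP [|/IH] //.
elim: ix h => [|j ix IHx] //= /andP [hj /IHx {}IHx].
by rewrite inE => /orP [/eqP -> //|/IHx].
Qed.

Lemma latom_tatom_ok lo hi a : latom_ok lo hi a -> tatom_ok lo hi (latom_tatom a).
Proof.
move=> /andP [h1 h2] i; rewrite mem_cat => /orP [].
- exact: term_vars_lpoly h1.
- exact: term_vars_lpoly h2.
Qed.

Lemma nth_exponents hi ix i : (i < hi)%N -> nth 0%N (exponents hi ix) i = count_mem i ix.
Proof. by move=> h; rewrite (nth_map 0%N) ?size_iota // nth_iota. Qed.

Lemma lpoly_std_ok lo hi p : (lo <= hi)%N -> lpoly_ok lo hi p ->
  stdpoly_ok lo hi (lpoly_std hi p).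
Proof.
move=> lh; elim: p => [|[c ix] p IH] //= /andP [/andP [_ h] /IH {}IH] ac /= [<-|/IH //] /=.
split; first by rewrite size_map size_iota.
move=> i hi_i; rewrite nth_exponents; last lia.
by apply/count_memPn; apply/negP => /(allP h); lia.
Qed.

Lemma latom_satom_ok lo hi a : (lo <= hi)%N -> latom_ok lo hi a ->
  satom_ok lo hi (latom_satom hi a).
Proof. by move=> lh /andP [h1 h2]; split; apply: lpoly_std_ok. Qed.

Lemma msizeM_pred k (p q : {mpoly int[k]}) :
  (msize (p * q)%R <= (msize p + msize q).-1)%N.
Proof.
have [->|p0] := eqVneq p 0%R; first by rewrite GRing.mul0r msize0.
have [->|q0] := eqVneq q 0%R; first by rewrite GRing.mulr0 msize0.
by rewrite msizeM.
Qed.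

Lemma lmono_term_deg k cm : (size cm.2 <= 2)%N ->
  (msize (term_mpoly k (lmono_term cm)) <= 3)%N.
Proof.
case: cm => c ix /= hs; apply: (@leq_trans (size ix).+1); last by lia.
elim: ix {hs} => [|i ix IH] /=; first by rewrite msizeC; case: eqP.
have hX : (msize (term_mpoly k (TVar i)) <= 2)%N.
  by rewrite /=; case: insub => [j|]; rewrite ?msize0 // msizeX mdeg1.
apply: leq_trans (msizeM_pred _ _) _; move: hX IH; rewrite /lmono_term /=; lia.
Qed.

Lemma lpoly_term_deg k lo hi p : lpoly_ok lo hi p -> term_deg_le k 4 (lpoly_term p).
Proof.
rewrite /term_deg_le; elim: p => [|cm p IH] /=; first by rewrite msizeC; case: eqP.
move=> /andP [/andP [hs _] /IH {}IH].
apply: leq_trans (mmeasureD_le _ _ _) _.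
by rewrite geq_max IH andbT; apply: leq_trans (lmono_term_deg k hs) _.
Qed.

Lemma latom_tatom_deg k lo hi a : latom_ok lo hi a -> tatom_deg_le k 4 (latom_tatom a).
Proof. by move=> /andP [h1 h2]; split; [exact: lpoly_term_deg h1 | exact: lpoly_term_deg h2]. Qed.

Lemma qf_all_qmap (A B : Type) (h : A -> B) P Q f :
  (forall a, P a -> Q (h a)) -> qf_all P f -> qf_all Q (qmap h f).
Proof. by move=> H; elim: f => [a|f IHf g IHg [hf hg]|f IHf g IHg [hf hg]] /=; auto. Qed.

Lemma qf_holds_qmap (A B : Type) (h : A -> B) (P : A -> Prop) ahA ahB v f :
  (forall a, P a -> ahB v (h a) <-> ahA v a) -> qf_all P f ->
  qf_holds ahB v (qmap h f) <-> qf_holds ahA v f.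
Proof.
move=> H; elim: f => [a|f IHf g IHg [hf hg]|f IHf g IHg [hf hg]] /=; first exact: H.
- by rewrite (IHf hf) (IHg hg).
- by rewrite (IHf hf) (IHg hg).
Qed.

Lemma enc_qf_qmap (A B : Type) (h : A -> B) e f :
  enc_qf e (qmap h f) = enc_qf (fun a => e (h a)) f.
Proof. by elim: f => [a|f IHf g IHg|f IHf g IHg] //=; rewrite IHf IHg. Qed.

Lemma enc_sentence_smap (A B : Type) (h : A -> B) e s :
  enc_sentence e (smap h s) = enc_sentence (fun a => e (h a)) s.
Proof. by case: s => *; rewrite /= !enc_qf_qmap. Qed.

Lemma in_class_smap (A B : Type) (h : A -> B) okA okB C s :
  (forall lo a, (lo <= nvars s)%N -> okA lo (nvars s) a -> okB lo (nvars s) (h a)) ->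
  in_class okA C s -> in_class okB C (smap h s).
Proof.
case: C s => [] [m n phi|m n phi|m n psi phi] //= H.
- by apply: qf_all_qmap => a; apply: H.
- by apply: qf_all_qmap => a; apply: H.
- by move=> [h1 h2]; split; [apply: qf_all_qmap h1 | apply: qf_all_qmap h2] => a; apply: H; lia.
Qed.

Lemma sentence_atoms_all_smap (A B : Type) (h : A -> B) ok (P : B -> Prop) C s :
  (forall lo a, ok lo (nvars s) a -> P (h a)) ->
  in_class ok C s -> sentence_atoms_all P (smap h s).
Proof.
case: C s => [] [m n phi|m n phi|m n psi phi] //= H.
- by apply: qf_all_qmap => a; apply: H.
- by apply: qf_all_qmap => a; apply: H.
- by move=> [h1 h2]; split; [apply: qf_all_qmap h1 | apply: qf_all_qmap h2] => a; apply: H.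
Qed.

Lemma sentence_true_smap (A B : Type) (h : A -> B) ok ahA ahB C s :
  (forall v lo a, ok lo (nvars s) a -> ahB v (h a) <-> ahA v a) ->
  in_class ok C s -> sentence_true ahB (smap h s) <-> sentence_true ahA s.
Proof.
case: C s => [] [m n phi|m n phi|m n psi phi] //= H.
- move=> hp; have E v := qf_holds_qmap (H v 0%N) hp.
  by split=> -[x h']; exists x => y; apply/E; apply: h'.
- move=> hp; have E v := qf_holds_qmap (H v 0%N) hp.
  by split=> -[x h']; exists x => y; have := h' y; rewrite E.
- move=> [h1 h2]; have E1 v := qf_holds_qmap (H v m) h1.
  have E2 v := qf_holds_qmap (H v 0%N) h2.
  by split=> -[x h']; exists x => y; have := h' y; rewrite E1 E2.
Qed.

(** * Well-formedness of the translated sentences *)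

Definition node_ok (lo hi : nat) (nd : node) : bool :=
  [&& lpoly_ok lo hi nd.1.1, lpoly_ok lo hi nd.1.2 & (lo <= nd.2 < hi)%N].

Lemma dig_nodes_ok lo hi S c F p :
  (lo <= S < hi)%N -> (lo <= c < hi)%N -> (lo <= F)%N -> (F + dig_alloc p <= hi)%N ->
  forall nd, List.In nd (dig_nodes S c F p) -> node_ok lo hi nd.
Proof.
move=> hS; elim: p c F => [q IH|q IH|] c F hc hF hA nd /=;
  case=> [<-|]; rewrite /= in hA; try (by apply: IH; lia);
  try (by rewrite /node_ok /lpoly_ok /=; lia).
by case=> // <-; rewrite /node_ok /lpoly_ok /=; lia.
Qed.

Lemma nodes_ok lo hi S c F t :
  (lo <= S < F)%N -> (lo <= c < F)%N -> (F + talloc t <= hi)%N ->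
  (forall i, i \in term_vars t -> (lo <= i < S)%N) -> (F <= hi)%N ->
  forall nd, List.In nd (nodes S c F t) -> node_ok lo hi nd.
Proof.
elim: t c F => [i|[|p|p]|a IHa b IHb|a IHa b IHb] c F hS hc hA hv hF nd /=.
- have := hv i (mem_head _ _) => hi_i.
  by case=> // <-; rewrite /node_ok /lpoly_ok /=; lia.
- by case=> // <-; rewrite /node_ok /lpoly_ok /=; lia.
- by apply: dig_nodes_ok; move: hA => /=; lia.
- rewrite /= in hA; case=> [<-|]; first by rewrite /node_ok /lpoly_ok /=; lia.
  by apply: dig_nodes_ok; lia.
- rewrite /= in hA; case=> [<-|/In_cat []]; first by rewrite /node_ok /lpoly_ok /=; lia.
  + by apply: IHa; try lia; move=> i hi_i; apply: hv; rewrite /= mem_cat hi_i.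
  + by apply: IHb; try lia; move=> i hi_i; apply: hv; rewrite /= mem_cat hi_i orbT.
- rewrite /= in hA; case=> [<-|/In_cat []]; first by rewrite /node_ok /lpoly_ok /=; lia.
  + by apply: IHa; try lia; move=> i hi_i; apply: hv; rewrite /= mem_cat hi_i.
  + by apply: IHb; try lia; move=> i hi_i; apply: hv; rewrite /= mem_cat hi_i orbT.
Qed.

Lemma disj_all P l a : (forall b, List.In b l -> P b) -> P a -> qf_all P (disj_list l a).
Proof.
move=> H ha; elim: l H => [|b l IH] //= H; split; first by apply: H; left.
by apply: IH => c hc; apply: H; right.
Qed.

Lemma conj_all P l a : (forall b, List.In b l -> P b) -> P a -> qf_all P (conj_list l a).
Proof.
move=> H ha; elim: l H => [|b l IH] //= H; split; first by apply: H; left.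
by apply: IH => c hc; apply: H; right.
Qed.

Lemma red_atom_ok lo hi psi S L F a :
  (lo <= S)%N -> (S + L < F)%N -> (F + aalloc a <= hi)%N -> tatom_ok lo S a ->
  qf_all (latom_ok lo hi) (red_atom psi S L F a).
Proof.
case: a => // t u hS hF hA ok; rewrite /aalloc /= in hA.
have nok nd : List.In nd (atom_nodes S F (TLe t u)) -> node_ok lo hi nd.
  rewrite /atom_nodes /= => /In_cat []; apply: nodes_ok; try lia.
  - by move=> i hi_i; apply: ok; rewrite mem_cat hi_i.
  - by move=> i hi_i; apply: ok; rewrite mem_cat hi_i orbT.
rewrite /red_atom; case: psi; [apply: conj_all | apply: disj_all].
- move=> b [<-|hb]; first by rewrite /latom_ok /lpoly_ok /=; lia.
  have [nd hnd] := In_flatten_map_inv hb; have := nok nd hnd.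
  rewrite /node_ok; case: nd {hnd} => [[l r] c] /= /and3P [hl hr hc].
  by case=> [<-|[<-|[]]]; rewrite /latom_ok /= hl hr.
- by rewrite /latom_ok.
- move=> b hb; rewrite /phi_atoms in hb; case: (proj1 (In_cat _ _ _) hb) => {}hb; last first.
    have [nd hnd] := In_flatten_map_inv hb; have := nok nd hnd.
    rewrite /node_ok; case: nd {hnd} => [[l r] c] /= /and3P [hl hr hc].
    have hD : (lo <= S + L < hi)%N by lia.
    by case=> [<-|[<-|[<-|[<-|[]]]]]; rewrite /latom_ok /= ?hl ?hr /= ?hc ?hD.
  move: hb; rewrite /phi_head /=.
  case=> [<-|[<-|[<-|hb]]]; try (by rewrite /latom_ok /lpoly_ok /=; lia).
  have [i /In_iota hi_i ->] := In_map_inv hb.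
  by rewrite /latom_ok /lpoly_ok /=; lia.
- by rewrite /latom_ok /lpoly_ok /=; lia.
Qed.

Lemma red_qf_ok lo hi psi S L F f :
  (lo <= S)%N -> (S + L < F)%N -> (F + qalloc f <= hi)%N -> qf_all (tatom_ok lo S) f ->
  qf_all (latom_ok lo hi) (red_qf psi S L F f).
Proof.
move=> hS; elim: f F => [a|f IHf g IHg|f IHf g IHg] F hF /= hA.
- exact: red_atom_ok.
- by move=> [hf hg]; split; [apply: IHf | apply: IHg] => //; lia.
- by move=> [hf hg]; split; [apply: IHf | apply: IHg] => //; lia.
Qed.

Lemma red_sentence_ok C s L : in_class tatom_ok C s -> (salloc s <= L)%N ->
  in_class latom_ok C (red_sentence L s).
Proof.
case: C s => [] [m n phi|m n phi|m n psi phi] //=.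
- by move=> h aL; apply: red_qf_ok => //; lia.
- by move=> h aL; apply: red_qf_ok => //; lia.
- by move=> [h1 h2] aL; split; apply: red_qf_ok => //; lia.
Qed.

Definition red_tatom (L : nat) (s : sentence tatom) : sentence tatom :=
  smap latom_tatom (red_sentence L s).

Definition red_satom (L : nat) (s : sentence tatom) : sentence satom :=
  smap (latom_satom (nvars (red_sentence L s))) (red_sentence L s).

Theorem red_tatom_spec C s L : in_class tatom_ok C s -> (salloc s <= L)%N ->
  [/\ in_class tatom_ok C (red_tatom L s),
      sentence_atoms_all (tatom_deg_le (nvars (red_tatom L s)) 4) (red_tatom L s) &
      sentence_true tatom_holds (red_tatom L s) <-> sentence_true tatom_holds s].
Proof.
move=> hs aL; have ok := red_sentence_ok hs aL; split.
- by apply: in_class_smap ok => lo a _; exact: latom_tatom_ok.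
- by apply: sentence_atoms_all_smap ok => lo a; exact: latom_tatom_deg.
- rewrite -(red_sentence_equiv hs aL); apply: sentence_true_smap ok => v lo a _.
  exact: latom_tatom_holds.
Qed.

Theorem red_satom_spec C s L : in_class tatom_ok C s -> (salloc s <= L)%N ->
  in_class satom_ok C (red_satom L s) /\
  (sentence_true satom_holds (red_satom L s) <-> sentence_true tatom_holds s).
Proof.
move=> hs aL; have ok := red_sentence_ok hs aL; split.
- by apply: in_class_smap ok => lo a; exact: latom_satom_ok.
- rewrite -(red_sentence_equiv hs aL); apply: sentence_true_smap ok => v lo a.
  exact: latom_satom_holds.
Qed.

(** * The translation as a stack program *)

Definition runs (c : scmd) (m : mem) (b : bool) (m' : mem) (N : nat) : Prop :=
  exists2 t, sx c m b m' t & (t <= N)%N.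

Lemma runs_le c m b m' N N' : runs c m b m' N -> (N <= N')%N -> runs c m b m' N'.
Proof. by move=> [t e l] h; exists t => //; lia. Qed.

Lemma runs_ret b m : runs (SRet b) m b m 1.
Proof. by exists 1 => //; exact: XRet. Qed.

Lemma runs_push j b m : runs (SPush j b) m true (upd m j (b :: m j)) 1.
Proof. by exists 1 => //; exact: XPush. Qed.

Lemma runs_seq a c m b m1 b' m2 N1 N2 : runs a m b m1 N1 ->
  runs c m1 b' m2 N2 -> runs (SSeq a c) m b' m2 (N1 + N2).
Proof. by move=> [t1 e1 l1] [t2 e2 l2]; exists (t1 + t2); [exact: XSeq e1 e2 | lia]. Qed.

Lemma runs_caseE j cE c0 c1 m b m' N : m j = [::] ->
  runs cE m b m' N -> runs (SCase j cE c0 c1) m b m' N.+1.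
Proof. by move=> h [t e l]; exists t.+1 => //; exact: XCaseE. Qed.

Lemma runs_caseB j cE c0 c1 m x s b m' N : m j = x :: s ->
  runs (if x then c1 else c0) (upd m j s) b m' N -> runs (SCase j cE c0 c1) m b m' N.+1.
Proof. by move=> h [t e l]; exists t.+1 => //; exact: XCaseB h e. Qed.

Lemma runs_stop a m m' N : runs a m false m' N -> runs (SLoop a) m true m' N.
Proof. by move=> [t e l]; exists t => //; exact: XStop. Qed.

Lemma runs_go a m m1 m2 N1 N2 : runs a m true m1 N1 -> runs (SLoop a) m1 true m2 N2 ->
  runs (SLoop a) m true m2 (N1 + N2).
Proof. by move=> [t1 e1 l1] [t2 e2 l2]; exists (t1 + t2); [exact: XGo e1 e2 | lia]. Qed.

Lemma runs_eq c m b m1 m2 N : runs c m b m1 N -> m1 = m2 -> runs c m b m2 N.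
Proof. by move=> h <-. Qed.

(** * Moving, copying and emitting registers *)

Definition pushall (ds : seq nat) (b : bool) : scmd :=
  foldr (fun d k => SSeq (SPush d b) k) (SRet true) ds.

(** Moves a stack onto several others at once, reversing it; with no targets it clears the stack. *)
Definition dump (src : nat) (ds : seq nat) : scmd :=
  SLoop (SCase src (SRet false) (pushall ds false) (pushall ds true)).

Definition pushed (ds : seq nat) (s : seq bool) (m : mem) : mem :=
  fun j => if j \in ds then s ++ m j else m j.

Lemma pushall_runs ds b m : uniq ds ->
  runs (pushall ds b) m true (pushed ds [:: b] m) (size ds).+1.
Proof.
elim: ds m => [|d ds IH] m /=; first by move=> _; exact: runs_ret.
move=> /andP [nd /IH {}IH]; rewrite -add1n.
apply: runs_eq (runs_seq (runs_push _ _ _) (IH _)) _.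
apply: functional_extensionality => j; rewrite /pushed inE /upd /=.
by case: eqP => [->|] //=; rewrite (negbTE nd).
Qed.

Lemma dump_runs src ds m : uniq ds -> src \notin ds ->
  runs (dump src ds) m true (upd (pushed ds (rev (m src)) m) src [::])
    ((size (m src)).+1 * (size ds + 3)).
Proof.
move=> ud ns; have [s ms] : exists s, m src = s by exists (m src).
elim: s m ms => [|x s IH] m ms.
- apply: (@runs_le _ _ _ _ 2); last by rewrite ms mul1n; lia.
  apply: runs_stop; apply: runs_caseE => //.
  apply: runs_eq (runs_ret _ _) _; apply: functional_extensionality => j.
  by rewrite /upd /pushed ms; case: eqP => [->|] //; case: ifP.
- set m1 := pushed ds [:: x] (upd m src s).
  have m1s : m1 src = s by rewrite /m1 /pushed (negbTE ns) /upd eqxx.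
  have := IH m1 m1s; rewrite m1s => H2.
  have H1 : runs (SCase src (SRet false) (pushall ds false) (pushall ds true)) m true m1
      (size ds).+2.
    apply: runs_caseB ms _.
    by rewrite /m1; case: (x); apply: pushall_runs.
  apply: (@runs_le _ _ _ _ ((size ds).+2 + (size s).+1 * (size ds + 3))); last first.
    by rewrite ms /= mulSn; lia.
  apply: runs_eq (runs_go H1 H2) _; apply: functional_extensionality => j.
  rewrite /upd /m1 /pushed ms /upd; case: (eqVneq j src) => // ne; case: (j \in ds) => //.
  by rewrite rev_cons -cats1 -catA.
Qed.

Definition is_unary (s : seq bool) : Prop := s = nseq (size s) true.

(** Reading destroys a stack, so a copy moves it to a scratch stack and from there both back and
    onto the targets. *)
Definition copy (src tmp : nat) (ds : seq nat) : scmd :=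
  SSeq (dump src [:: tmp]) (dump tmp (src :: ds)).

Lemma copy_runs src tmp ds m :
  uniq [:: tmp, src & ds] -> m tmp = [::] -> is_unary (m src) ->
  runs (copy src tmp ds) m true (pushed ds (m src) m)
    ((size (m src)).+1 * (size ds + 8)).
Proof.
rewrite /= inE negb_or => /andP [/andP [ts td] /andP [sd ud]] mt us.
have h1 := @dump_runs src [:: tmp] m isT.
have {h1}h1 := h1 ltac:(rewrite inE eq_sym; exact: ts).
set m1 := upd _ _ _ in h1.
have m1t : m1 tmp = m src.
  by rewrite /m1 /upd (negbTE ts) /pushed inE eqxx mt cats0 us rev_nseq.
have h2 := @dump_runs tmp (src :: ds) m1 ltac:(by rewrite /= sd) ltac:(by rewrite inE negb_or ts).
apply: runs_le (runs_eq (runs_seq h1 h2) _) _.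
- apply: functional_extensionality => j; rewrite m1t us rev_nseq -us.
  rewrite /upd /pushed inE /m1 /upd /pushed inE.
  case: (eqVneq j tmp) => [->|nt]; first by rewrite (negbTE td) mt.
  case: (eqVneq j src) => [->|ns] //=.
  by rewrite (negbTE sd) cats0.
- by rewrite m1t /=; lia.
Qed.

Definition emit (bs : seq bool) : scmd :=
  foldr (fun b k => SSeq (SPush 0 b) k) (SRet true) bs.

Definition out (m : mem) (bs : seq bool) : mem := upd m 0 (rev bs ++ m 0).

Lemma out_cat m b1 b2 : out (out m b1) b2 = out m (b1 ++ b2).
Proof.
apply: functional_extensionality => j; rewrite /out /upd /=.
by case: eqP => // _; rewrite rev_cat catA.
Qed.

Lemma emit_runs bs m : runs (emit bs) m true (out m bs) (size bs).+1.
Proof.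
elim: bs m => [|b bs IH] m /=.
  apply: runs_eq (runs_ret _ _) _; apply: functional_extensionality => j.
  by rewrite /out /upd; case: eqP => // ->.
rewrite -add1n; apply: runs_eq (runs_seq (runs_push _ _ _) (IH _)) _.
exact: (out_cat m [:: b] bs).
Qed.

Arguments emit : simpl never.

(** Register 0 is masked, so that emitting does not change the environment from which the emitted
    word is computed. *)
Definition env (m : mem) : nat -> nat := fun r => if r is 0 then 0 else size (m r).

Arguments env : simpl never.

Lemma env_out m bs : env (out m bs) = env m.
Proof. by apply: functional_extensionality => -[|r]. Qed.

Definition uregs := [:: 2; 3; 4; 5; 6; 7; 9; 13].

Definition pre (N : nat) (m : mem) : Prop :=
  [/\ m 10 = [::], m 11 = [::], m 12 = [::] &
      forall r, r \in uregs -> is_unary (m r) /\ (size (m r) <= N)%N].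

Lemma pre_out N m bs : pre N m -> pre N (out m bs).
Proof. by move=> [h1 h2 h3 h4]; split=> // -[|r] hr //; exact: (h4 r.+1 hr). Qed.

(** [k] is chosen before the bound [N] on the registers, so that such bounds add up under sequencing
    and are uniform in the input. *)
Definition emits (d : nat) (c : scmd) (bits : (nat -> nat) -> seq bool) : Prop :=
  exists k, forall N m, pre N m -> runs c m true (out m (bits (env m))) (k * N.+1 ^ d).

Lemma emits_const d bs : emits d (emit bs) (fun _ => bs).
Proof.
by exists (size bs).+1 => N m _; apply: runs_le (emit_runs _ _) _; rewrite leq_pmulr ?expn_gt0.
Qed.

Lemma emits_seq d a c b1 b2 : emits d a b1 -> emits d c b2 ->
  emits d (SSeq a c) (fun e => b1 e ++ b2 e).
Proof.
move=> [k1 h1] [k2 h2]; exists (k1 + k2) => N m hm.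
have r2 := h2 N _ (pre_out (b1 (env m)) hm); rewrite env_out out_cat in r2.
by rewrite mulnDl; apply: runs_seq (h1 N m hm) r2.
Qed.

Lemma emits_ext d c b1 b2 : emits d c b1 -> b1 =1 b2 -> emits d c b2.
Proof. by move=> [k h] e; exists k => N m hm; rewrite -e; apply: h. Qed.

Lemma emits_up d d' c b : (d <= d')%N -> emits d c b -> emits d' c b.
Proof.
move=> dd [k h]; exists k => N m hm; apply: runs_le (h N m hm) _.
by rewrite leq_mul2l leq_pexp2l ?orbT.
Qed.

Definition emit_reg (re : nat * nat) : scmd :=
  SSeq (copy re.1 12 [:: 0]) (emit (nseq re.2 true)).

Definition inst_ix (e : nat -> nat) (re : nat * nat) : nat := e re.1 + re.2.

Lemma emits_reg re : re.1 \in uregs ->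
  emits 1 (emit_reg re) (fun e => nseq (inst_ix e re) true).
Proof.
case: re => r o /= hr.
have hu := allP (isT : all (fun r => uniq [:: 12; r; 0]) uregs) r hr.
have r0 := allP (isT : all (fun r => r != 0) uregs) r hr.
exists (20 + o) => N m [m10 m11 m12 /(_ r hr) [ur lr]]; rewrite expn1.
have h1 := copy_runs hu m12 ur.
apply: runs_le (runs_eq (runs_seq h1 (emit_runs _ _)) _) _.
- have -> : pushed [:: 0] (m r) m = out m (nseq (env m r) true).
    apply: functional_extensionality => j; rewrite /pushed /out /upd inE.
    case: eqP => // ->; rewrite rev_nseq {1}ur /env.
    by case: (r) r0.
  by rewrite out_cat -nseqD.
- by rewrite size_nseq /=; nia.
Qed.

Definition pushn (a n : nat) : scmd := iter n (SSeq (SPush a true)) (SRet true).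

Lemma pushn_runs a n m : runs (pushn a n) m true (upd m a (nseq n true ++ m a)) n.+1.
Proof.
elim: n m => [|n IH] m /=.
  apply: runs_eq (runs_ret _ _) _; apply: functional_extensionality => j.
  by rewrite /upd; case: eqP => // ->.
rewrite -add1n; apply: runs_eq (runs_seq (runs_push _ _ _) (IH _)) _.
apply: functional_extensionality => j; rewrite /upd eqxx; case: eqP => // _.
by elim: (n) => [|k IHk] //=; rewrite IHk.
Qed.

Definition mark (i : nat) : seq bool := nseq i true ++ [:: false].

Definition load (a : nat) (re : nat * nat) : scmd :=
  SSeq (SPush a false) (SSeq (copy re.1 12 [:: a]) (pushn a re.2)).

Lemma load_runs a re N m : a \in [:: 10; 11] -> re.1 \in uregs ->
  m a = [::] -> m 12 = [::] -> is_unary (m re.1) -> (size (m re.1) <= N)%N ->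
  runs (load a re) m true (upd m a (mark (size (m re.1) + re.2))) ((20 + re.2) * N.+1).
Proof.
case: re => r o /= ha hr ma m12 ur lr.
have /andP [hu ar] := allP (allP (isT : all (fun a => all (fun r =>
  uniq [:: 12; r; a] && (a != r)) uregs) [:: 10; 11]) a ha) r hr.
have a12 := allP (isT : all (fun a => a != 12) [:: 10; 11]) a ha.
set m1 := upd m a (false :: m a).
have m1r : m1 r = m r by rewrite /m1 /upd eq_sym (negbTE ar).
have m112 : m1 12 = [::] by rewrite /m1 /upd eq_sym (negbTE a12).
have h2 := @copy_runs r 12 [:: a] m1 hu m112 ltac:(by rewrite m1r).
have h3 := @pushn_runs a o (pushed [:: a] (m1 r) m1).
apply: runs_le (runs_eq (runs_seq (runs_push _ _ _) (runs_seq h2 h3)) _) _.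
- apply: functional_extensionality => j; rewrite /upd /pushed !inE eqxx.
  case: (eqVneq j a) => [_|ne]; last by rewrite /m1 /upd (negbTE ne).
  by rewrite m1r /m1 /upd eqxx ma /mark addnC nseqD -catA {1}ur.
- by rewrite m1r /=; nia.
Qed.

(** * Multi-indices of monomials of degree at most two *)

Definition skip : scmd := SRet true.

(** The only 0 of [mark i] is at position [i]. Popping the mark once per variable therefore signals
    variable [i] without comparing numbers; the default true keeps an exhausted stack silent. *)
Definition hit (l : seq bool) (p : nat) : bool := ~~ nth true l p.

Definition emit_hit (a : nat) : scmd := SCase a skip (SPush 0 true) skip.

Lemma emit_hit_runs a m l p : a != 0 -> m a = drop p l ->
  runs (emit_hit a) m true (upd (out m (nseq (hit l p) true)) a (drop p.+1 l)) 2.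
Proof.
move=> a0 ma; have ea : (0 == a) = false by rewrite eq_sym (negbTE a0).
rewrite /hit; case: (ltnP p (size l)) => hp; last first.
  rewrite nth_default //= drop_oversize ?leqW //.
  apply: runs_caseE; first by rewrite ma drop_oversize.
  apply: runs_eq (runs_ret _ _) _; apply: functional_extensionality => j.
  rewrite /out /upd /=; case: eqP => [->|]; first by rewrite ma drop_oversize.
  by case: eqP => // ->.
apply: runs_caseB (etrans ma (drop_nth true hp)) _.
case: (nth true l p) => /=.
- apply: runs_eq (runs_ret _ _) _; apply: functional_extensionality => j.
  by rewrite /out /upd /=; case: eqP => // _; case: eqP => // ->.
- apply: runs_eq (runs_push _ _ _) _; apply: functional_extensionality => j.
  rewrite /out /upd /= ea; case: (eqVneq j a) => [->|//].
  by rewrite (negbTE a0).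
Qed.

(** Emits the exponent of one variable in unary. Two stacks suffice in degree two; equal indices hit
    together and give exponent 2. Register 12 collects the count taken from register 2, to be
    restored afterwards. *)
Definition exp_step : scmd :=
  SSeq (SPush 12 true) (SSeq (SPush 0 true)
    (SSeq (emit_hit 10) (SSeq (emit_hit 11) (SPush 0 false)))).

Definition exp_loop : scmd := SLoop (SCase 2 (SRet false) exp_step exp_step).

Definition exp_bits (la lb : seq bool) (p n : nat) : seq bool :=
  flatten [seq true :: nseq (hit la p + hit lb p) true ++ [:: false] | p <- iota p n].

Lemma exp_loop_runs la lb n p m :
  m 2 = nseq n true -> m 10 = drop p la -> m 11 = drop p lb ->
  runs exp_loop m true
    (upd (upd (upd (upd (out m (exp_bits la lb p n)) 2 [::]) 12 (nseq n true ++ m 12))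
       10 (drop (p + n) la)) 11 (drop (p + n) lb)) (10 * n.+1).
Proof.
elim: n p m => [|n IH] p m m2 m10 m11.
  apply: (@runs_le _ _ _ _ 2) => //; apply: runs_stop; apply: runs_caseE => //.
  apply: runs_eq (runs_ret _ _) _; rewrite addn0; apply: functional_extensionality.
  by do 16 (case; [by rewrite /out /upd /= ?m2 ?m10 ?m11 | ]).
pose m1 := upd (upd (upd m 2 (nseq n true)) 12 (true :: m 12)) 0 (true :: m 0).
have h10 := @emit_hit_runs 10 m1 la p isT m10.
set m2' := upd _ _ _ in h10.
have h11 := @emit_hit_runs 11 m2' lb p isT m11.
set m3 := upd _ _ _ in h11.
pose m4 := upd m3 0 (false :: m3 0).
have step : runs (SCase 2 (SRet false) exp_step exp_step) m true m4 10.
  apply: (@runs_caseB _ _ _ _ _ true (nseq n true)) => //.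
  apply: (@runs_le _ _ _ _ (1 + (1 + (2 + (2 + 1))))) => //.
  apply: runs_seq (runs_push _ _ _) _; apply: runs_seq (runs_push _ _ _) _.
  by apply: runs_seq h10 _; apply: runs_seq h11 _; apply: runs_push.
have := IH p.+1 m4 erefl erefl erefl => H2.
apply: runs_le (runs_eq (runs_go step H2) _) _; last by lia.
have e0 : m4 0 = rev (true :: nseq (hit la p + hit lb p) true ++ [:: false]) ++ m 0.
  rewrite /m4 /m3 /m2' /m1 /out /upd /= rev_cons rev_cat !rev_nseq nseqD /= cat_rcons.
  by case: (hit la p) => //=; case: (hit lb p).
rewrite addSnnS; apply: functional_extensionality.
case=> [|].
  have eb : exp_bits la lb p n.+1
    = (true :: nseq (hit la p + hit lb p) true ++ [:: false]) ++ exp_bits la lb p.+1 n by [].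
  transitivity (rev (exp_bits la lb p.+1 n) ++ m4 0); first by [].
  by rewrite e0 catA -rev_cat -eb.
do 11 (case; [by []|]).
case; first by rewrite /upd /=; elim: (n) => [|k IHk] //=; rewrite IHk.
do 3 (case; [by []|]); by [].
Qed.

Lemma hit_mark i p : hit (mark i) p = (i == p).
Proof.
rewrite /hit /mark nth_cat size_nseq nth_nseq; case: ltngtP => // [h|->].
- by rewrite nth_default //= subn_gt0.
- by rewrite subnn.
Qed.

Lemma hit_nil p : hit [::] p = false.
Proof. by rewrite /hit nth_nil. Qed.

Definition tix_ok (ix : seq (nat * nat)) : bool :=
  (size ix <= 2)%N && all (fun re => re.1 \in uregs) ix.

Definition loads (ix : seq (nat * nat)) : scmd :=
  match ix with
  | [::] => skip
  | [:: a] => load 10 a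
  | a :: b :: _ => SSeq (load 10 a) (load 11 b)
  end.

Definition emit_exps (ix : seq (nat * nat)) : scmd :=
  SSeq (loads ix) (SSeq exp_loop
    (SSeq (dump 12 [:: 2]) (SSeq (dump 10 [::]) (dump 11 [::])))).

Lemma loads_runs ix : tix_ok ix -> exists k, forall N m, pre N m ->
  exists la lb, [/\ runs (loads ix) m true (upd (upd m 10 la) 11 lb) (k * N.+1),
    (size la + size lb <= k * N.+1)%N &
    forall p, hit la p + hit lb p = count_mem p (map (inst_ix (env m)) ix)].
Proof.
have envE m r : r \in uregs -> env m r = size (m r).
  by move=> hr; have := allP (isT : all (fun r => r != 0) uregs) r hr; case: r {hr}.
case: ix => [|[r o] [|[r' o'] [|//]]] /andP [_] /=.
- move=> _; exists 1 => N m [m10 m11 m12 hu]; exists [::], [::]; split=> //; last first.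
    by move=> p; rewrite hit_nil.
  apply: runs_le (runs_eq (runs_ret _ _) _) _ => //.
  apply: functional_extensionality => j; rewrite /upd.
  by case: eqP => [->//|_]; case: eqP => [->|].
- move=> /andP [hr _]; exists (22 + o) => N m [m10 m11 m12 hu].
  have [ur lr] := hu r hr.
  exists (mark (size (m r) + o)), [::]; split.
  + have h := @load_runs 10 (r, o) N m isT hr m10 m12 ur lr.
    apply: runs_le (runs_eq h _) _; last by rewrite /=; nia.
    apply: functional_extensionality => j; rewrite /upd.
    by case: (eqVneq j 11) => // ->.
  + by rewrite /mark size_cat size_nseq /=; nia.
  + by move=> p; rewrite hit_mark hit_nil /= /inst_ix /= envE.
- move=> /andP [hr /andP [hr' _]]; exists (44 + o + o') => N m [m10 m11 m12 hu].
  have [ur lr] := hu r hr; have [ur' lr'] := hu r' hr'.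
  exists (mark (size (m r) + o)), (mark (size (m r') + o')); split.
  + have h := @load_runs 10 (r, o) N m isT hr m10 m12 ur lr.
    set m1 := upd _ _ _ in h.
    have n10 := allP (isT : all (fun r => r != 10) uregs) r' hr'.
    have m1r : m1 r' = m r' by rewrite /m1 /upd (negbTE n10).
    have := @load_runs 11 (r', o') N m1 isT hr' m11 m12; rewrite [_.1]/= m1r => h'.
    apply: runs_le (runs_seq h (h' ur' lr')) _; rewrite /=; nia.
  + by rewrite /mark !size_cat !size_nseq /=; nia.
  + by move=> p; rewrite !hit_mark /= /inst_ix /= !envE // addn0.
Qed.

Lemma emits_exps ix : tix_ok ix -> emits 1 (emit_exps ix) (fun e =>
  flatten [seq true :: enc_unary x | x <- exponents (e 2) (map (inst_ix e) ix)]).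
Proof.
move=> /loads_runs [k hk]; exists (4 * k + 40) => N m hm; rewrite expn1.
have [la [lb [h1 sl hh]]] := hk N m hm.
case: hm => m10 m11 m12 hu; have [u2 l2] := hu 2 isT.
set m1 := upd _ _ _ in h1.
have h2 := @exp_loop_runs la lb (size (m 2)) 0 m1 u2 (esym (drop0 la)) (esym (drop0 lb)).
set m2 := upd _ _ _ in h2.
have h3 := @dump_runs 12 [:: 2] m2 isT isT.
set m3 := upd _ _ _ in h3.
have h4 := @dump_runs 10 [::] m3 isT isT.
set m4 := upd _ _ _ in h4.
have h5 := @dump_runs 11 [::] m4 isT isT.
apply: runs_le (runs_eq (runs_seq h1 (runs_seq h2 (runs_seq h3 (runs_seq h4 h5)))) _) _.
- have -> : flatten [seq true :: enc_unary x | x <- exponents (env m 2) (map (inst_ix (env m)) ix)]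
          = exp_bits la lb 0 (size (m 2)).
    rewrite /exponents /exp_bits -map_comp; congr flatten; apply: eq_map => p /=.
    by rewrite /enc_unary hh.
  have e2 : rev (nseq (size (m 2)) true ++ m 12) = m 2 by rewrite m12 cats0 rev_nseq -u2.
  apply: functional_extensionality; do 2 (case; [by []|]).
  case; first by apply: (etrans _ e2); rewrite -[RHS]cats0.
  do 7 (case; [by []|]).
  case; first exact: (esym m10).
  case; first exact: (esym m11).
  case; first exact: (esym m12).
  by [].
- have s12 : size (m2 12) = size (m 2).
    by rewrite /m2 /upd /= size_cat size_nseq (m12 : m1 12 = [::]) addn0.
  have s10 : (size (m3 10) <= size la)%N by rewrite /m3 /m2 /upd /pushed /= size_drop leq_subr.
  have s11 : (size (m4 11) <= size lb)%N.
    by rewrite /m4 /m3 /m2 /upd /pushed /= size_drop leq_subr.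
  by rewrite s12 mulnDl -mulnA /=; lia.
Qed.

(* A template (r, o) stands for the variable whose index is the content of
   register r plus o. *)
Definition tmono : Type := Z * seq (nat * nat).
Definition tpoly := seq tmono.
Definition inst_mono (e : nat -> nat) (cm : tmono) : Z * seq nat :=
  (cm.1, map (inst_ix e) cm.2).
Definition inst_poly (e : nat -> nat) (p : tpoly) : lpoly := map (inst_mono e) p.
Definition inst_atom (e : nat -> nat) (a : tpoly * tpoly) : latom :=
  (inst_poly e a.1, inst_poly e a.2).
Definition tpoly_ok (p : tpoly) : bool := all (fun cm => tix_ok cm.2) p.

Definition emit_mono (std : bool) (cm : tmono) : scmd :=
  if std then SSeq (emit_exps cm.2) (emit (false :: enc_Z cm.1))
  else foldr (fun re k =>
         SSeq (emit [:: true; true; false; false])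
           (SSeq (emit_reg re) (SSeq (emit [:: false]) k)))
         (emit ([:: false; true] ++ enc_Z cm.1)) cm.2.

Definition emit_poly (std : bool) (p : tpoly) : scmd :=
  foldr (fun cm k => SSeq (emit (if std then [:: true] else [:: true; false]))
                       (SSeq (emit_mono std cm) k))
    (emit (if std then [:: false] else [:: false; true; false; false])) p.

Definition emit_atom (std : bool) (a : tpoly * tpoly) : scmd :=
  SSeq (emit [:: false]) (SSeq (emit_poly std a.1) (emit_poly std a.2)).

Definition enc_latom (std : bool) (hi : nat) (a : latom) : seq bool :=
  if std then enc_satom (latom_satom hi a) else enc_tatom (latom_tatom a).

Definition enc_lmono (std : bool) (hi : nat) (cm : Z * seq nat) : seq bool :=
  if std then enc_list enc_unary (exponents hi cm.2) ++ enc_Z cm.1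
  else enc_term (lmono_term cm).

Definition enc_lpoly (std : bool) (hi : nat) (p : lpoly) : seq bool :=
  if std then enc_stdpoly (lpoly_std hi p) else enc_term (lpoly_term p).

Lemma enc_list_flatten (T : Type) (e : T -> seq bool) l :
  enc_list e l = flatten [seq true :: e x | x <- l] ++ [:: false].
Proof. by elim: l => //= x l ->; rewrite catA. Qed.

Lemma emits_mono std cm : tix_ok cm.2 ->
  emits 1 (emit_mono std cm) (fun e => enc_lmono std (e 2) (inst_mono e cm)).
Proof.
case: cm => c ix /= hix; rewrite /emit_mono /enc_lmono; case: std.
- apply: emits_ext (emits_seq (emits_exps hix) (emits_const _ _)) _ => e /=.
  by rewrite enc_list_flatten -catA.
- move/andP: hix => /= [_]; elim: ix => [|re ix IH] /=.
    by move=> _; apply: emits_ext (emits_const _ _) _.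
  move=> /andP [hre /IH {}IH].
  apply: emits_ext (emits_seq (emits_const _ _) (emits_seq (emits_reg hre)
    (emits_seq (emits_const _ _) IH))) _ => e /=.
  by rewrite /enc_unary -catA.
Qed.

Lemma emits_poly std p : tpoly_ok p ->
  emits 1 (emit_poly std p) (fun e => enc_lpoly std (e 2) (inst_poly e p)).
Proof.
elim: p => [|cm p IH] /=.
  by move=> _; apply: emits_ext (emits_const _ _) _ => e; case: std.
move=> /andP [hcm /IH {}IH].
apply: emits_ext (emits_seq (emits_const _ _) (emits_seq (emits_mono std hcm) IH)) _ => e.
by rewrite /enc_lpoly /enc_lmono; case: (std).
Qed.

Lemma emits_atom std a : tpoly_ok a.1 -> tpoly_ok a.2 ->
  emits 1 (emit_atom std a) (fun e => enc_latom std (e 2) (inst_atom e a)).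
Proof.
move=> h1 h2.
apply: emits_ext (emits_seq (emits_const _ _) (emits_seq (emits_poly std h1) (emits_poly std h2))) _.
by move=> e; rewrite /enc_latom /enc_lpoly; case: std.
Qed.

(** A link is a connective with its left operand; [conn] is the second bit of the connective, true
    for a disjunction. *)
Definition enc_links (std : bool) (hi : nat) (conn : bool) (l : seq latom) : seq bool :=
  flatten [seq [:: true; conn; false] ++ enc_latom std hi a | a <- l].

Lemma enc_disj std hi l a : enc_qf (enc_latom std hi) (disj_list l a)
  = enc_links std hi true l ++ false :: enc_latom std hi a.
Proof. by elim: l => [|b l IH] //=; rewrite IH /enc_links /= -catA. Qed.

Lemma enc_conj std hi l a : enc_qf (enc_latom std hi) (conj_list l a)
  = enc_links std hi false l ++ false :: enc_latom std hi a.
Proof. by elim: l => [|b l IH] //=; rewrite IH /enc_links /= -catA. Qed.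

Lemma enc_links_cat std hi conn l1 l2 :
  enc_links std hi conn (l1 ++ l2) = enc_links std hi conn l1 ++ enc_links std hi conn l2.
Proof. by rewrite /enc_links map_cat flatten_cat. Qed.

Definition emit_links (std conn : bool) (l : seq (tpoly * tpoly)) : scmd :=
  foldr (fun a k => SSeq (emit [:: true; conn; false]) (SSeq (emit_atom std a) k))
    (emit [::]) l.

Definition tatoms_ok (l : seq (tpoly * tpoly)) : bool :=
  all (fun a => tpoly_ok a.1 && tpoly_ok a.2) l.

Lemma emits_links std conn l : tatoms_ok l ->
  emits 1 (emit_links std conn l)
    (fun e => enc_links std (e 2) conn (map (inst_atom e) l)).
Proof.
elim: l => [|a l IH] /=.
  by move=> _; apply: emits_ext (emits_const _ _) _.
move=> /andP [/andP [h1 h2] /IH {}IH].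
by apply: emits_ext (emits_seq (emits_const _ _) (emits_seq (emits_atom std h1 h2) IH)) _.
Qed.

(* Register 9 counts the subformulas of Psi still to be read; it is empty
   exactly when the formula being read is Phi. *)
Definition if_psi (c1 c2 : scmd) : scmd :=
  SCase 9 c2 (SSeq (SPush 9 true) c1) (SSeq (SPush 9 true) c1).

Lemma if_psi_runs c1 c2 m b m' N : is_unary (m 9) ->
  runs (if (0 < size (m 9))%N then c1 else c2) m b m' N ->
  runs (if_psi c1 c2) m b m' (N + 2).
Proof.
case e: (m 9) => [|x s] u /= h; rewrite addn2.
- by apply: runs_caseE => //; apply: runs_le h _.
- rewrite /if_psi; apply: (@runs_caseB 9 _ _ _ m x s) => //; rewrite -add1n.
  case: u => ex es.
  have -> : (if x then SSeq (SPush 9 true) c1 else SSeq (SPush 9 true) c1)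
          = SSeq (SPush 9 true) c1 by case: (x).
  apply: runs_seq (runs_push _ _ _) _.
  suff -> : upd (upd m 9 s) 9 (true :: upd m 9 s 9) = m by [].
  apply: functional_extensionality => j; rewrite /upd eqxx; case: eqP => // ->.
  by rewrite e ex.
Qed.

Lemma emits_if_psi d c1 c2 b1 b2 : emits d c1 b1 -> emits d c2 b2 ->
  emits d (if_psi c1 c2) (fun e => if (0 < e 9)%N then b1 e else b2 e).
Proof.
move=> [k1 h1] [k2 h2]; exists (k1 + k2 + 2) => N m hm.
have [_ _ _ /(_ 9 isT) [u9 _]] := hm.
apply: (@runs_le _ _ _ _ ((k1 + k2) * N.+1 ^ d + 2)); last first.
  by rewrite [X in (_ <= X)%N]mulnDl leq_add2l leq_pmulr ?expn_gt0.
apply: if_psi_runs => //; rewrite /= {2}/env mulnDl.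
by case: ifP => _; [apply: runs_le (h1 N m hm) _ | apply: runs_le (h2 N m hm) _]; lia.
Qed.

Definition tmon (ix : seq (nat * nat)) : tmono := (Zpos xH, ix).
Definition tnode : Type := tpoly * tpoly.
Definition rS := (3, 0). Definition rD := (4, 0). Definition rF := (5, 0).
Definition rF1 := (5, 1). Definition rC := (6, 0). Definition rV := (7, 0).
Definition rU := (13, 0). Definition rU1 := (13, 1).

Definition inst_node (e : nat -> nat) (t : tnode) : node :=
  (inst_poly e t.1, inst_poly e t.2, e 6).

Definition tnode_phi (t : tnode) : seq (tpoly * tpoly) :=
  [:: (tmon [:: rD] :: t.1, t.2); (tmon [:: rD] :: t.2, t.1);
      ([:: tmon [::]], [:: tmon [:: rC]]); ([:: tmon [:: rC]; tmon [::]], [::])].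

Definition tnode_psi (t : tnode) : seq (tpoly * tpoly) := [:: t; (t.2, t.1)].

Definition emit_node (std : bool) (t : tnode) : scmd :=
  if_psi (emit_links std false (tnode_psi t)) (emit_links std true (tnode_phi t)).

Definition node_atoms (psi : bool) (D : nat) (nd : node) : seq latom :=
  if psi then node_psi nd else node_phi D nd.

Lemma emits_node std t : tpoly_ok t.1 -> tpoly_ok t.2 ->
  emits 1 (emit_node std t) (fun e => enc_links std (e 2) (e 9 == 0)
     (node_atoms (0 < e 9)%N (e 4) (inst_node e t))).
Proof.
move=> h1 h2.
have o1 : tatoms_ok (tnode_psi t) by rewrite /tatoms_ok /= h1 h2.
have o2 : tatoms_ok (tnode_phi t).
  by move: h1 h2; rewrite /tatoms_ok /tpoly_ok /= => -> ->.
apply: emits_ext (emits_if_psi (emits_links std false o1) (emits_links std true o2)) _ => e.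
rewrite /node_atoms; case: posnP => // _.
congr enc_links; rewrite /node_phi /inst_node /tnode_phi /= /inst_atom /=.
by rewrite /inst_mono /= /inst_ix /= !addn0.
Qed.

Definition emit_last (std : bool) : scmd :=
  SSeq (emit [:: false])
    (if_psi (emit_atom std ([::], [::])) (emit_atom std ([:: tmon [:: rS]], [::]))).

Lemma emits_last std : emits 1 (emit_last std) (fun e =>
  false :: enc_latom std (e 2) (if (0 < e 9)%N then psi_last else phi_last (e 3))).
Proof.
apply: emits_ext (emits_seq (emits_const _ _) (emits_if_psi (emits_atom std _ _)
  (emits_atom std _ _))) _ => // e /=.
case: posnP => // _; congr (_ :: enc_latom _ _ _).
by rewrite /phi_last /inst_atom /= /inst_mono /= /inst_ix /= addn0.
Qed.

(** The length of the chain depends on the input, so a fixed list of templates cannot produce it: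
    register 13 runs upwards from S while a copy of register 14 counts down. *)
Definition emit_chain (std : bool) : scmd :=
  SSeq (copy 3 12 [:: 13]) (SSeq (copy 14 12 [:: 15])
    (SSeq (SLoop (SCase 15 (SRet false) (SRet false)
       (SSeq (emit_links std true [:: ([:: tmon [:: rS; rU]], [:: (Zpos (xO (xO xH)), [:: rU1])])])
          (SPush 13 true))))
      (dump 13 [::]))).

Definition pre_chain (N : nat) (m : mem) : Prop :=
  [/\ pre N m, is_unary (m 14), (size (m 14) <= N)%N, m 13 = [::] & m 15 = [::]].

Lemma pre_chain_out N m bs : pre_chain N m -> pre_chain N (out m bs).
Proof. by move=> [h1 h2 h3 h4 h5]; split=> //; exact: pre_out. Qed.

Lemma is_unary_nseq n : is_unary (nseq n true).
Proof. by rewrite /is_unary size_nseq. Qed.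

Lemma emit_chain_runs std : exists k, forall N m, pre_chain N m ->
  runs (emit_chain std) m true
    (out m (enc_links std (env m 2) true (chain_atoms (env m 3) (env m 14))))
    (k * N.+1 ^ 2).
Proof.
have [k hk] := @emits_links std true
  [:: ([:: tmon [:: rS; rU]], [:: (Zpos (xO (xO xH)), [:: rU1])])] isT.
exists (4 * k + 60) => N m [hm u14 l14 m13 m15].
have [m10 m11 m12 hu] := hm; have [u3 l3] := hu 3 isT.
have h1 := @copy_runs 3 12 [:: 13] m isT m12 u3.
set m1 := pushed _ _ _ in h1.
have h2 := @copy_runs 14 12 [:: 15] m1 isT m12 u14.
set m2 := pushed _ _ _ in h2.
pose L := size (m 14); pose S := size (m 3).
(* The bound doubles because the running index reaches S + L, the sum of two registers bounded by
   [N]. *)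
have loop n U M : pre (2 * N) M -> M 3 = m 3 -> M 2 = m 2 ->
    M 13 = nseq U true -> M 15 = nseq n true -> (U + n <= 2 * N)%N ->
    runs (SLoop (SCase 15 (SRet false) (SRet false)
       (SSeq (emit_links std true
           [:: ([:: tmon [:: rS; rU]], [:: (Zpos (xO (xO xH)), [:: rU1])])])
          (SPush 13 true)))) M true
      (upd (upd (out M (enc_links std (env m 2) true
         [seq ([:: mon [:: S; i]], [:: (Zpos (xO (xO xH)), [:: i.+1])]) | i <- iota U n]))
           13 (nseq (U + n) true)) 15 [::])
      (n.+1 * (k * (2 * N).+1 + 2)).
  elim: n U M => [|n IH] U M hM M3 M2 M13 M15 hU.
    apply: (@runs_le _ _ _ _ 2); last by nia.
    apply: runs_stop; apply: runs_caseE => //; apply: runs_eq (runs_ret _ _) _.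
    rewrite addn0; apply: functional_extensionality => j; rewrite /out /upd /=.
    by case: eqP => [->//|_]; case: eqP => [->//|_]; case: eqP => [->|].
  pose M1 := upd M 15 (nseq n true).
  have hM1 : pre (2 * N) M1.
    case: hM => a1 a2 a3 a4; split=> // r hr; rewrite /M1 /upd.
    have n15 := allP (isT : all (fun r => r != 15) uregs) r hr.
    by rewrite (negbTE n15); exact: a4.
  have := hk _ _ hM1; rewrite expn1 => s1.
  set M2' := out _ _ in s1.
  pose M3' := upd M2' 13 (nseq U.+1 true).
  have hM3 : pre (2 * N) M3'.
    have : pre (2 * N) M2' by exact: pre_out.
    case=> a1 a2 a3 a4; split=> // r hr; rewrite /M3' /upd; case: eqP => _.
      by split; [exact: is_unary_nseq | rewrite size_nseq; lia].
    exact: a4.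
  have := IH U.+1 M3' hM3 M3 M2 erefl erefl ltac:(lia) => s2.
  have step : runs (SCase 15 (SRet false) (SRet false)
       (SSeq (emit_links std true
           [:: ([:: tmon [:: rS; rU]], [:: (Zpos (xO (xO xH)), [:: rU1])])])
          (SPush 13 true))) M true M3' (k * (2 * N).+1 + 2).
    rewrite addn2; apply: (@runs_caseB _ _ _ _ _ true (nseq n true)) => //.
    apply: (@runs_le _ _ _ _ (k * (2 * N).+1 + 1)); last by rewrite addn1.
    apply: runs_seq s1 _; apply: runs_eq (runs_push _ _ _) _; rewrite /M3'.
    by have -> : M2' 13 = nseq U true by rewrite -M13.
  apply: runs_le (runs_eq (runs_go step s2) _) _; last by rewrite [in X in (_ <= X)%N]mulSn.
  have eb : enc_links std (env M1 2) true
     [seq inst_atom (env M1) i | i <- [:: ([:: tmon [:: rS; rU]], [:: (Zpos (xO (xO xH)), [:: rU1])])]]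
     = enc_links std (env m 2) true [:: ([:: mon [:: S; U]], [:: (Zpos (xO (xO xH)), [:: U.+1])])].
    have e2 : env M1 2 = env m 2 by rewrite /env /M1 /upd /= M2.
    rewrite e2 /= /inst_atom /= /inst_mono /= /inst_ix /=.
    have -> : env M1 3 = S by rewrite /env /M1 /upd /= M3.
    have -> : env M1 13 = U by rewrite /env /M1 /upd /= M13 size_nseq.
    by rewrite !addn0 addn1.
  rewrite -addSnnS; apply: functional_extensionality; case.
    rewrite /M3' /M2' eb; set f := fun i => (_, _).
    transitivity (rev (enc_links std (env m 2) true [seq f i | i <- iota U.+1 n]) ++
      (rev (enc_links std (env m 2) true [:: f U]) ++ M 0)); first by [].
    by rewrite catA -rev_cat -enc_links_cat.
  by do 15 (case; [by []|]).
have hm2 : pre (2 * N) m2.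
  split=> // r hr; have [ur lr] := hu r hr.
  case: (eqVneq r 13) => [->|n13].
    have -> : m2 13 = m 3 by rewrite /m2 /m1 /pushed /= m13 cats0.
    by split=> //; lia.
  have n15 := allP (isT : all (fun r => r != 15) uregs) r hr.
  have -> : m2 r = m r.
    by rewrite /m2 /m1 /pushed !inE (negbTE n13) (negbTE n15).
  by split=> //; lia.
have e13 : m2 13 = nseq S true by rewrite /m2 /m1 /pushed /= m13 cats0.
have e15 : m2 15 = nseq L true.
  by rewrite /m2 /pushed /=; rewrite (m15 : m1 15 = [::]) cats0.
have h3 := loop L S m2 hm2 erefl erefl e13 e15 ltac:(rewrite /L /S; lia).
set m3 := upd _ _ _ in h3.
have h4 := @dump_runs 13 [::] m3 isT isT.
apply: runs_le (runs_eq (runs_seq h1 (runs_seq h2 (runs_seq h3 h4))) _) _.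
- apply: functional_extensionality; do 13 (case; [by []|]).
  case; first exact: (esym m13).
  case; first by [].
  case; first exact: (esym m15).
  by [].
- have -> : size (m3 13) = S + L by rewrite /m3 /upd /= size_nseq.
  have -> : size (m1 14) = L by [].
  rewrite -/S; rewrite -/S in l3; rewrite -/L in l14.
  have b1 : (L.+1 * (k * (2 * N).+1 + 2) <= N.+1 * (k * (2 * N.+1) + 2))%N.
    by apply: leq_mul; [lia | rewrite leq_add2r leq_mul2l; lia].
  rewrite expnS expn1 /=; nia.
Qed.

Definition emit_head (std : bool) : scmd :=
  if_psi (emit_links std false [:: ([:: tmon [:: rF]], [:: tmon [:: rF1]])])
    (SSeq (emit_links std true
       [:: ([:: tmon [:: rF]], [:: tmon [:: rF1]; tmon [:: rS; rS]]);
           ([:: tmon [::]], [:: tmon [:: rS]]);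
           ([:: tmon [:: rD]], [::])])
     (emit_chain std)).

Definition head_bits (std : bool) (e : nat -> nat) : seq bool :=
  if (0 < e 9)%N then enc_links std (e 2) false [:: psi_head (e 5)]
  else enc_links std (e 2) true (phi_head (e 3) (e 14) (e 5)).

Lemma emit_head_runs std : exists k, forall N m, pre_chain N m ->
  env m 4 = env m 3 + env m 14 ->
  runs (emit_head std) m true (out m (head_bits std (env m))) (k * N.+1 ^ 2).
Proof.
have [k1 h1] := emits_up (isT : (1 <= 2)%N)
  (@emits_links std false [:: ([:: tmon [:: rF]], [:: tmon [:: rF1]])] isT).
have [k2 h2] := emits_up (isT : (1 <= 2)%N) (@emits_links std true
  [:: ([:: tmon [:: rF]], [:: tmon [:: rF1]; tmon [:: rS; rS]]);
      ([:: tmon [::]], [:: tmon [:: rS]]); ([:: tmon [:: rD]], [::])] isT).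
have [k3 h3] := emit_chain_runs std.
exists (k1 + (k2 + k3) + 2) => N m hm e4.
have [hp _ _ _ _] := hm; have [_ _ _ /(_ 9 isT) [u9 _]] := hp.
apply: (@runs_le _ _ _ _ ((k1 + (k2 + k3)) * N.+1 ^ 2 + 2)); last first.
  by rewrite [X in (_ <= X)%N]mulnDl leq_add2l leq_pmulr ?expn_gt0.
apply: if_psi_runs => //; rewrite /head_bits {1}/env mulnDl.
case: ifP => _.
- apply: runs_le (runs_eq (h1 N m hp) _) _; last by lia.
  by rewrite /= /inst_atom /= /inst_mono /= /inst_ix /= addn0 addn1.
- have r3 := h3 N _ (pre_chain_out _ hm).
  apply: runs_le (runs_eq (runs_seq (h2 N m hp) (r3 _)) _) _; last by lia.
  rewrite env_out out_cat -enc_links_cat; congr out; congr enc_links.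
  by rewrite /phi_head /= /inst_atom /= /inst_mono /= /inst_ix /= !addn0 addn1 e4.
Qed.

(* Registers: 0 output (at the start, the input); 1 unread input; 2 number of
   variables; 3 index of s; 4 index of delta; 5 next fresh variable; 6 variable
   of the current node; 7 an index read from the input; 8 variables of pending
   nodes; 9 pending subformulas of Psi; 10, 11, 12, 15 scratch; 13 index running
   along the chain; 14 length of the input.  Numbers are in unary. *)
Definition tvar : tnode := ([:: tmon [:: rC]], [:: tmon [:: rS; rV]]).
Definition tadd : tnode := ([:: tmon [:: rC]], [:: tmon [:: rF]; tmon [:: rF1]]).
Definition tmul : tnode := ([:: tmon [:: rS; rC]], [:: tmon [:: rF; rF1]]).
Definition tneg : tnode := ([:: tmon [:: rC]], [:: (Zneg xH, [:: rF])]).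
Definition tdig (b : bool) : tnode :=
  ([:: tmon [:: rC]], (Zpos (xO xH), [:: rF]) :: (if b then [:: tmon [:: rS]] else [::])).
Definition tzero : tnode := ([:: tmon [:: rC]], [::]).

(** * The one-pass translator *)

Definition tnodes : seq tnode :=
  [:: tvar; tadd; tmul; tneg; tdig true; tdig false; tzero].

(* The end of the input reads as 0, so that the program is total. *)
Definition read_bit (c0 c1 : scmd) : scmd := SCase 1 c0 c0 c1.

(** The second child goes below the first, whose term is read next. *)
Definition push_children : scmd :=
  SSeq (SPush 8 false) (SSeq (copy 5 12 [:: 8]) (SSeq (SPush 8 true)
    (SSeq (SPush 8 false) (SSeq (copy 5 12 [:: 8])
      (SSeq (SPush 5 true) (SPush 5 true)))))).

Definition next_node : scmd :=
  SSeq (dump 6 [::]) (SSeq (copy 5 12 [:: 6]) (SPush 5 true)).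

Definition read_unary (a r : nat) : scmd :=
  SLoop (SCase a (SRet false) (SRet false) (SPush r true)).

Section Program.

Variable std : bool.

Definition digits : scmd :=
  SLoop (read_bit (SSeq (emit_node std tzero) (SRet false))
    (SSeq (read_bit (emit_node std (tdig false)) (emit_node std (tdig true))) next_node)).

Definition const_tok : scmd :=
  read_bit (read_bit (emit_node std tzero) digits)
    (SSeq (emit_node std tneg) (SSeq next_node digits)).

Definition var_tok : scmd :=
  SSeq (read_unary 1 7) (SSeq (emit_node std tvar) (dump 7 [::])).

(** An empty stack of pending variables marks the end of an atom: the closing clause is due, and one
    pending subformula of Psi, if there is any, is done. *)
Definition finish : scmd :=
  SCase 8 (SSeq (emit_last std) (SCase 9 skip skip skip)) (SPush 8 false) (SPush 8 true).

Definition term_tok : scmd :=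
  SSeq (read_bit (read_bit var_tok const_tok)
         (SSeq (read_bit (emit_node std tadd) (emit_node std tmul)) push_children))
    (SSeq (dump 6 [::]) finish).

Definition pop_pending : scmd := read_unary 8 6.

(** The tag of an atom is skipped, since the sentences concerned contain only [TLe]. A connective is
    copied; inside Psi it replaces one pending subformula by two. *)
Definition formula_tok : scmd :=
  read_bit (SSeq (read_bit skip skip) (SSeq (emit_head std) push_children))
    (SSeq (emit [:: true]) (SSeq (read_bit (emit [:: false]) (emit [:: true]))
      (if_psi (SPush 9 true) skip))).

Definition token : scmd :=
  SSeq (SCase 8 formula_tok (SSeq (SPush 8 false) (SSeq pop_pending term_tok))
         (SSeq (SPush 8 true) (SSeq pop_pending term_tok))) (SRet true).

Definition body : scmd :=
  SCase 1 (SRet false) (SSeq (SPush 1 false) token) (SSeq (SPush 1 true) token).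

(** * A functional model of the state *)

Record st := St { sI : seq bool; sF : nat; sP : seq nat; sQ : nat; sO : seq bool }.

Variables hi S L : nat.

Definition pending (P : seq nat) : seq bool := flatten (map mark P).

Arguments pending : simpl never.

(** The current node [c] and the index [v] are kept out of [st] because their registers are empty
    between tokens. *)
Definition memC (s : st) (c v : nat) : mem := fun j => nth [::]
  [:: rev (sO s); sI s; nseq hi true; nseq S true; nseq (S + L) true; nseq (sF s) true;
      nseq c true; nseq v true; pending (sP s); nseq (sQ s) true; [::]; [::]; [::]; [::];
      nseq L true; [::]] j.

Definition put (s : st) (bs : seq bool) : st := St (sI s) (sF s) (sP s) (sQ s) (sO s ++ bs).

Lemma out_memC s c v bs : out (memC s c v) bs = memC (put s bs) c v.
Proof.
by apply: functional_extensionality; case=> [|j] //; rewrite /out /upd /memC /= rev_cat.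
Qed.

Definition bounded (N : nat) (s : st) : Prop :=
  [/\ hi <= N, S + L <= N, sF s <= N & sQ s <= N]%N.

Lemma pre_memC N s c v : bounded N s -> (c <= N)%N -> (v <= N)%N ->
  pre_chain N (memC s c v).
Proof.
move=> [b1 b2 b3 b4] bc bv; split=> //; try exact: is_unary_nseq; last by rewrite size_nseq; lia.
split=> // r hr; split.
- have := allP (isT : all (fun r => r \in [:: 2; 3; 4; 5; 6; 7; 9; 13]) uregs) r hr.
  by rewrite !inE; repeat (case/orP; [by move/eqP=> ->; exact: is_unary_nseq|]); move/eqP=> ->.
- move: hr; rewrite /uregs !inE.
  by repeat (case/orP; [by move/eqP=> ->; rewrite size_nseq; lia|]); move/eqP=> ->.
Qed.

Definition node_bits (Q : nat) (nd : node) : seq bool :=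
  enc_links std hi (Q == 0) (node_atoms (0 < Q)%N (S + L) nd).

Lemma env_memC s c v : [/\ env (memC s c v) 2 = hi, env (memC s c v) 3 = S,
  env (memC s c v) 4 = S + L, env (memC s c v) 5 = sF s &
  [/\ env (memC s c v) 6 = c, env (memC s c v) 7 = v, env (memC s c v) 9 = sQ s &
      env (memC s c v) 14 = L]].
Proof. by rewrite /env /memC /= !size_nseq. Qed.

Lemma inst_tnodes s c v (e := env (memC s c v)) :
  [/\ inst_node e tvar = nvar S c v, inst_node e tadd = nadd c (sF s),
      inst_node e tmul = nmul S c (sF s), inst_node e tneg = nneg c (sF s) &
      (forall b, inst_node e (tdig b) = ndig S b c (sF s)) /\ inst_node e tzero = nzero c].
Proof.
have [e2 e3 e4 e5 [e6 e7 e9 e14]] := env_memC s c v.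
by split; [..|split; [case|]]; rewrite /inst_node /= /inst_mono /= /inst_ix /= /e
  ?e3 ?e5 ?e6 ?e7 ?addn0 ?addn1.
Qed.

(** Stated for fixed [hi], [S], [L]; a single [k] for all of them is what polynomial time requires,
    and [emit_tnodes_runs] provides it. *)
Definition tnodes_bound (k : nat) : Prop := forall t, List.In t tnodes ->
  forall N s c v, bounded N s -> (c <= N)%N -> (v <= N)%N ->
  runs (emit_node std t) (memC s c v) true
    (memC (put s (node_bits (sQ s) (inst_node (env (memC s c v)) t))) c v) (k * N.+1).

Definition last_bits (Q : nat) : seq bool :=
  false :: enc_latom std hi (if (0 < Q)%N then psi_last else phi_last S).

Definition last_bound (k : nat) : Prop := forall N s, bounded N s ->
  runs (emit_last std) (memC s 0 0) true (memC (put s (last_bits (sQ s))) 0 0) (k * N.+1).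

Definition head_of (F Q : nat) : seq bool :=
  if (0 < Q)%N then enc_links std hi false [:: psi_head F]
  else enc_links std hi true (phi_head S L F).

Definition head_bound (k : nat) : Prop := forall N s, bounded N s ->
  runs (emit_head std) (memC s 0 0) true (memC (put s (head_of (sF s) (sQ s))) 0 0)
    (k * N.+1 ^ 2).

Definition setI (s : st) (I : seq bool) : st := St I (sF s) (sP s) (sQ s) (sO s).

Lemma upd_memI s c v I : upd (memC s c v) 1 I = memC (setI s I) c v.
Proof. by apply: functional_extensionality; do 16 (case; [by []|]). Qed.

Lemma read_bit_runs c0 c1 s c v b m' N :
  runs (if head false (sI s) then c1 else c0) (memC (setI s (behead (sI s))) c v) b m' N ->
  runs (read_bit c0 c1) (memC s c v) b m' N.+1.
Proof.
case: s => -[|x I] F P Q O /= h; first exact: runs_caseE.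
apply: (@runs_caseB 1 _ _ _ _ x I) => //; rewrite upd_memI.
by case: (x) h.
Qed.

Lemma push_children_runs s c v N : (sF s <= N)%N ->
  runs push_children (memC s c v) true
    (memC (St (sI s) (sF s).+2 [:: sF s, (sF s).+1 & sP s] (sQ s) (sO s)) c v) (30 * N.+1).
Proof.
move=> hF.
have cp M : M 12 = [::] -> M 5 = nseq (sF s) true ->
    runs (copy 5 12 [:: 8]) M true (upd M 8 (nseq (sF s) true ++ M 8)) (N.+1 * 9).
  move=> h12 h5; have := @copy_runs 5 12 [:: 8] M isT h12; rewrite h5 size_nseq.
  move=> /(_ (is_unary_nseq _)) h; apply: runs_le (runs_eq h _) _; last by rewrite /=; nia.
  by apply: functional_extensionality => j; rewrite /pushed /upd inE; case: eqP => // ->.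
apply: runs_le (runs_eq (runs_seq (runs_push _ _ _) (runs_seq (cp _ _ _)
  (runs_seq (runs_push _ _ _) (runs_seq (runs_push _ _ _) (runs_seq (cp _ _ _)
  (runs_seq (runs_push _ _ _) (runs_push _ _ _))))))) _) _ => //; last by lia.
apply: functional_extensionality; do 8 (case; [by []|]).
case; last by do 7 (case; [by []|]).
by rewrite /upd /memC /pending /= /mark -!catA.
Qed.

Lemma next_node_runs s c v N : (sF s <= N)%N -> (c <= N)%N ->
  runs next_node (memC s c v) true
    (memC (St (sI s) (sF s).+1 (sP s) (sQ s) (sO s)) (sF s) v) (20 * N.+1).
Proof.
move=> hF hc.
have h1 := @dump_runs 6 [::] (memC s c v) isT isT.
set m1 := upd _ _ _ in h1.
have h2 := @copy_runs 5 12 [:: 6] m1 isT erefl (is_unary_nseq _).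
apply: runs_le (runs_eq (runs_seq h1 (runs_seq h2 (runs_push _ _ _))) _) _; last first.
  by rewrite /= !size_nseq; nia.
apply: functional_extensionality; do 6 (case; [by []|]).
case; first by rewrite /upd /pushed /= cats0.
by do 9 (case; [by []|]).
Qed.

Lemma clear_node_runs s c v N : (c <= N)%N ->
  runs (dump 6 [::]) (memC s c v) true (memC s 0 v) (3 * N.+1).
Proof.
move=> hc; have h1 := @dump_runs 6 [::] (memC s c v) isT isT.
apply: runs_le (runs_eq h1 _) _; last by rewrite /= size_nseq; nia.
by apply: functional_extensionality; do 16 (case; [by []|]).
Qed.

Lemma clear_var_runs s c v N : (v <= N)%N ->
  runs (dump 7 [::]) (memC s c v) true (memC s c 0) (3 * N.+1).
Proof.
move=> hc; have h1 := @dump_runs 7 [::] (memC s c v) isT isT.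
apply: runs_le (runs_eq h1 _) _; last by rewrite /= size_nseq; nia.
by apply: functional_extensionality; do 16 (case; [by []|]).
Qed.

End Program.

Lemma emit_tnodes_runs std : exists k, forall hi S L, tnodes_bound std hi S L k.
Proof.
suff [k hk] : exists k, forall t, List.In t tnodes -> forall hi S L N s c v,
    bounded hi S L N s -> (c <= N)%N -> (v <= N)%N ->
    runs (emit_node std t) (memC hi S L s c v) true
      (memC hi S L (put s (node_bits std hi S L (sQ s)
         (inst_node (env (memC hi S L s c v)) t))) c v) (k * N.+1).
  by exists k => hi S L t ht; exact: hk.
have ok t : List.In t tnodes -> tpoly_ok t.1 && tpoly_ok t.2.
  by do 7 (case=> [<- //|]).
elim: tnodes ok => [|t ts IH] ok; first by exists 0.
have [|k1 h1] := IH; first by move=> t' h; apply: ok; right.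
have /andP [o1 o2] := ok t (or_introl erefl).
have [k2 h2] := emits_node std o1 o2.
exists (k1 + k2) => t' [<-|ht] hi S L N s c v hb hc hv.
- have [hp _ _ _ _] := pre_memC hb hc hv.
  have := h2 N _ hp; have [e2 _ e4 _ [_ _ e9 _]] := env_memC hi S L s c v.
  rewrite out_memC e2 e4 e9 expn1 => h; apply: runs_le h _; nia.
- by apply: runs_le (h1 _ ht hi S L N s c v hb hc hv) _; nia.
Qed.

Lemma emit_last_mem std : exists k, forall hi S L, last_bound std hi S L k.
Proof.
have [k h] := emits_last std; exists k => hi S L N s hb.
have [hp _ _ _ _] := pre_memC hb (leq0n N) (leq0n N).
have := h N _ hp; have [e2 e3 _ _ [_ _ e9 _]] := env_memC hi S L s 0 0.
by rewrite out_memC e2 e3 e9 expn1.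
Qed.

Lemma emit_head_mem std : exists k, forall hi S L, head_bound std hi S L k.
Proof.
have [k h] := emit_head_runs std; exists k => hi S L N s hb.
have hp := pre_memC hb (leq0n N) (leq0n N).
have [e2 e3 e4 e5 [_ _ e9 e14]] := env_memC hi S L s 0 0.
have := h N _ hp; rewrite out_memC /head_bits e2 e3 e4 e5 e9 e14; exact.
Qed.

(** * Tokens as transitions of the model *)

Section Semantics.

Variables (std : bool) (hi S L : nat).

Local Notation memC := (memC hi S L).
Local Notation node_bits := (node_bits std hi S L).
Local Notation bounded := (bounded hi S L).

(** Model of the digit loop, which consumes two bits per digit. Returning [I1] itself when it is
    empty keeps the recursion structural. *)
Fixpoint digf (Q : nat) (I : seq bool) (c F : nat) (O : seq bool) :
    seq bool * nat * seq bool :=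
  match I with
  | true :: I1 => digf Q (if I1 is _ :: I2 then I2 else I1) F F.+1
                    (O ++ node_bits Q (ndig S (head false I1) c F))
  | _ => (behead I, F, O ++ node_bits Q (nzero c))
  end.

Local Notation tnodes_bound := (tnodes_bound std hi S L).
Local Notation last_bound := (last_bound std hi S L).
Local Notation last_bits := (last_bits std hi S).
Local Notation head_bound := (head_bound std hi S L).

Lemma digits_runs k n I c F P Q O N : tnodes_bound k ->
  (size I <= n)%N -> bounded N (St I (F + n) P Q O) -> (c <= N)%N ->
  let: (I', F', O') := digf Q I c F O in
  [/\ (size I' <= size I)%N, (F' <= F + n)%N &
   exists2 c', (c' <= N)%N & runs (digits std) (memC (St I F P Q O) c 0) true
     (memC (St I' F' P Q O') c' 0) ((k + 30) * (n.+1 * N.+1))].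
Proof.
move=> hk.
have base J d E W : head false J = false -> bounded N (St J E P Q W) -> (d <= N)%N ->
    runs (digits std) (memC (St J E P Q W) d 0) true
      (memC (St (behead J) E P Q (W ++ node_bits Q (nzero d))) d 0) ((k + 30) * N.+1).
  move=> hJ0 hb hd; apply: (@runs_le _ _ _ _ (k * N.+1 + 1).+1); last nia.
  apply: runs_stop; apply: read_bit_runs; rewrite hJ0.
  apply: runs_seq (runs_ret _ _).
  have tn : List.In tzero tnodes by do 6 right; left.
  have := hk _ tn N (setI (St J E P Q W) (behead J)) d 0 hb hd (leq0n N).
  have [_ _ _ _ [_ ->]] := inst_tnodes hi S L (setI (St J E P Q W) (behead J)) d 0.
  by apply.
elim: n I c F O => [|n IH] I c F O hI hb hc.
- case: I hI hb => [|x I] // _ hb /=; rewrite addn0 in hb *.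
  by split=> //; exists c => //; apply: runs_le (base _ _ _ O _ hb hc) _ => //; rewrite mul1n.
have hb' F' O' I' : (F' <= F + n.+1)%N -> bounded N (St I' F' P Q O').
  by move=> h; case: hb => /= b1 b2 b3 b4; split=> //=; apply: leq_trans h b3.
have hb0 I' : bounded N (St I' F P Q O) by apply: hb'; rewrite leq_addr.
- case: I hI hb => [|[] I] hI hb /=.
  + split=> //; first lia; exists c => //.
    apply: runs_le (base _ _ _ O _ (hb0 _) hc) _ => //.
    by rewrite leq_mul2l leq_pmull ?orbT.
  + set I2 := if I is _ :: I2 then I2 else I.
    set O2 := O ++ _.
    have sI2 : (size I2 <= size I)%N by rewrite /I2; case: (I) => //= *; lia.
    have := IH I2 F F.+1 O2.
    have hb2 : bounded N (St I2 (F.+1 + n) P Q O2) by apply: hb'; rewrite addSnnS.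
    have hFN : (F.+1 + n <= N)%N by case: hb2.
    move=> /(_ ltac:(rewrite /= in hI; lia) hb2 ltac:(lia)).
    case: (digf _ _ _ _ _) => [[I' F'] O'] [h1 h2 [c' hc' hr]].
    split; [lia | lia |]; exists c' => //.
    apply: (@runs_le _ _ _ _ ((k + 25) * N.+1 + (k + 30) * (n.+1 * N.+1))); last first.
      by rewrite [in X in (_ <= X)%N]mulSn mulnDr leq_add2r leq_mul2r; lia.
    apply: runs_go hr.
    apply: (@runs_le _ _ _ _ (((k * N.+1).+1 + 20 * N.+1).+1)); last nia.
    apply: read_bit_runs => /=; rewrite /setI /=.
    have -> : I2 = behead I by rewrite /I2; case: (I).
    apply: (@runs_seq _ _ _ true (memC (St (behead I) F P Q O2) c 0)); last first.
      have hF : (sF (St (behead I) F P Q O2) <= N)%N by rewrite /=; lia.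
      exact: (next_node_runs hi S L 0 hF hc).
    apply: read_bit_runs => /=.
    have tn : List.In (tdig (head false I)) tnodes.
      by case: (head _ _); [do 4 right; left | do 5 right; left].
    have := hk _ tn N (setI (St (true :: I) F P Q O) (behead I)) c 0 _ hc (leq0n N).
    have [_ _ _ _ [-> _]] := inst_tnodes hi S L (setI (St (true :: I) F P Q O) (behead I)) c 0.
    move=> /(_ (hb0 _)).
    by rewrite /put /setI /= -/O2; case: (head _ _).
  + split; [by [] | by rewrite leq_addr |]; exists c => //.
    apply: runs_le (base _ _ _ O _ (hb0 _) hc) _ => //.
    by rewrite leq_mul2l leq_pmull ?orbT.
Qed.
Lemma read_unary_runs a r m I : a != r -> m a = I ->
  runs (read_unary a r) m true
    (upd (upd m a (drop (index false I).+1 I)) r (nseq (index false I) true ++ m r))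
    (2 * (size I).+1).
Proof.
move=> ar; have ra : (r == a) = false by rewrite eq_sym (negbTE ar).
elim: I m => [|[] I IH] m ma.
- apply: runs_stop; apply: runs_caseE => //; apply: runs_eq (runs_ret _ _) _.
  apply: functional_extensionality => j; rewrite /upd /=.
  by case: eqP => [->|] //; case: eqP => [->|].
- set m1 := upd (upd m a I) r (true :: m r).
  have m1a : m1 a = I by rewrite /m1 /upd (negbTE ar) eqxx.
  have step : runs (SCase a (SRet false) (SRet false) (SPush r true)) m true m1 2.
    apply: (@runs_caseB a _ _ _ m true I) => //; apply: runs_eq (runs_push _ _ _) _.
    by rewrite /m1 /upd ra.
  apply: runs_le (runs_eq (runs_go step (IH _ m1a)) _) _; last by rewrite /=; lia.
  apply: functional_extensionality => j; rewrite /m1 /upd /= eqxx.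
  case: (eqVneq j r) => [_|nr]; last by case: (eqVneq j a).
  by elim: (index _ _) => //= n ->.
- apply: (@runs_le _ _ _ _ 2); last by rewrite /=; lia.
  apply: runs_stop; apply: (@runs_caseB a _ _ _ m false I) => //.
  apply: runs_eq (runs_ret _ _) _; apply: functional_extensionality => j; rewrite /upd /= drop0.
  by case: (eqVneq j r) => [->|]; rewrite ?ra.
Qed.

Definition term_step (c : nat) (s : st) : st :=
  let I := sI s in let F := sF s in let P := sP s in let Q := sQ s in let O := sO s in
  let I2 := behead (behead I) in
  if head false I then
    St I2 F.+2 [:: F, F.+1 & P] Q
      (O ++ node_bits Q (if head false (behead I) then nmul S c F else nadd c F))
  else if head false (behead I) then
    if head false I2 then
      let r := digf Q (behead I2) F F.+1 (O ++ node_bits Q (nneg c F)) in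
      St r.1.1 r.1.2 P Q r.2
    else if head false (behead I2) then
      let r := digf Q (behead (behead I2)) c F O in St r.1.1 r.1.2 P Q r.2
    else St (behead (behead I2)) F P Q (O ++ node_bits Q (nzero c))
  else St (drop (index false I2).+1 I2) F P Q (O ++ node_bits Q (nvar S c (index false I2))).

Lemma size_behead_le (T : Type) (l : seq T) : (size (behead l) <= size l)%N.
Proof. by rewrite size_behead leq_pred. Qed.

Lemma term_core_runs k1 N c s : tnodes_bound k1 -> bounded N s ->
  (sF s + size (sI s) <= N)%N -> (c <= N)%N ->
  exists2 c', (c' <= N)%N &
  runs (read_bit (read_bit (var_tok std) (const_tok std))
         (SSeq (read_bit (emit_node std tadd) (emit_node std tmul)) push_children))
    (memC s c 0) true (memC (term_step c s) c' 0) ((2 * k1 + 90) * N.+1 ^ 2).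
Proof.
move=> h1 hb hN hc; set k2 := k1 + 30.
have -> : 2 * k1 + 90 = k1 + k2 + 60 by rewrite /k2; lia.
have node s' t nd c' v : bounded N s' -> List.In t tnodes -> (c' <= N)%N -> (v <= N)%N ->
    inst_node (env (memC s' c' v)) t = nd ->
    runs (emit_node std t) (memC s' c' v) true (memC (put s' (node_bits (sQ s') nd)) c' v)
      (k1 * N.+1).
  by move=> b' ht hc' hv <-; apply: h1.
have X1 : (N.+1 <= N.+1 ^ 2)%N by rewrite expnS expn1 leq_pmulr.
(* The linear costs of all other branches are absorbed into the quadratic cost of the digit loop. *)
have fit j : (j <= (k1 + 60) * N.+1 + k2 * N.+1 ^ 2)%N -> (j <= (k1 + k2 + 60) * N.+1 ^ 2)%N.
  have := leq_mul (leqnn (k1 + 60)) X1; lia.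
have bd I' F' O' P' : (F' <= N)%N -> bounded N (St I' F' P' (sQ s) O').
  by case: hb => *; split.
case: s hb hN node bd => I F P Q O /= hb hN node bd.
have hF : (F <= N)%N by lia.
have digs I' c' F' O' : (F' + size I' <= N)%N -> (c' <= N)%N ->
    let: (I'', F'', O'') := digf Q I' c' F' O' in
    exists2 c'', (c'' <= N)%N & runs (digits std) (memC (St I' F' P Q O') c' 0) true
      (memC (St I'' F'' P Q O'') c'' 0) (k2 * N.+1 ^ 2).
  move=> hI hc'; have := digits_runs h1 (leqnn (size I')) (bd I' _ O' P hI) hc'.
  case: (digf _ _ _ _ _) => [[I'' F''] O''] [_ _ [c'' l'' r'']].
  exists c'' => //; apply: runs_le r'' _.
  by rewrite leq_mul2l expnS expn1 leq_mul2r; lia.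
have [I1 eI1] : exists I1, I1 = behead I by exists (behead I).
have [I2 eI2] : exists I2, I2 = behead I1 by exists (behead I1).
have sI1 : (size I1 <= size I)%N by rewrite eI1; exact: size_behead_le.
have sI2 : (size I2 <= size I1)%N by rewrite eI2; exact: size_behead_le.
have sI3 := size_behead_le I2; have sI4 := size_behead_le (behead I2).
have inst s' c' v := inst_tnodes hi S L s' c' v.
rewrite /term_step /= -?eI1 -?eI2.
case eb1: (head false I).
- exists c => //.
  apply: (@runs_le _ _ _ _ ((k1 * N.+1).+1 + 30 * N.+1).+1); last by apply: fit; move: (k2 * N.+1 ^ 2)%N => Y; lia.
  apply: read_bit_runs; rewrite /= eb1 /setI /= -?eI1.
  set nd := if head false I1 then _ else _.
  apply: (@runs_seq _ _ _ true (memC (St I2 F P Q (O ++ node_bits Q nd)) c 0)); last first.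
    exact: (push_children_runs hi S L (s := St I2 F P Q (O ++ node_bits Q nd)) c 0 hF).
  apply: read_bit_runs; rewrite /setI /= -?eI1 -?eI2 /nd.
  have [_ i1 i2 _ _] := inst (St I2 F P Q O) c 0.
  case: (head false I1).
  + exact: (node (St I2 F P Q O) tmul _ c 0 (bd _ _ _ _ hF) ltac:(simpl; auto 10) hc (leq0n N) i2).
  + exact: (node (St I2 F P Q O) tadd _ c 0 (bd _ _ _ _ hF) ltac:(simpl; auto 10) hc (leq0n N) i1).
case eb2: (head false I1); last first.
- exists c => //; set k := index false I2.
  have hk : (k <= N)%N := leq_trans (index_size _ _) (leq_trans sI2 (leq_trans sI1 (leq_trans (leq_addl _ _) hN))).
  apply: (@runs_le _ _ _ _ (2 * (size I2).+1 + (k1 * N.+1 + 3 * N.+1)).+2); last by apply: fit; move: (k2 * N.+1 ^ 2)%N => Y; lia.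
  apply: read_bit_runs; rewrite /= eb1; apply: read_bit_runs; rewrite /= -?eI1 eb2 /setI /= -?eI2.
  have r1 := @read_unary_runs 1 7 (memC (St I2 F P Q O) c 0) I2 isT erefl.
  rewrite -/k in r1; set s3 := St (drop k.+1 I2) F P Q O.
  have e1 : upd (upd (memC (St I2 F P Q O) c 0) 1 (drop k.+1 I2)) 7
       (nseq k true ++ memC (St I2 F P Q O) c 0 7) = memC s3 c k.
    apply: functional_extensionality; do 7 (case; [by []|]).
    case; first by rewrite /upd /= cats0.
    by do 8 (case; [by []|]).
  rewrite e1 in r1; have [i1 _ _ _ _] := inst s3 c k.
  apply: runs_seq r1 _; apply: runs_seq.
    exact: (node s3 tvar _ c k (bd _ _ _ _ hF) ltac:(simpl; auto 10) hc hk i1).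
  exact: clear_var_runs.
case eb3: (head false I2); last case eb4: (head false (behead I2)).
- have hI2 : (size (behead I2) < size I2)%N by case: (I2) eb3.
  have := digs (behead I2) F F.+1 (O ++ node_bits Q (nneg c F)).
  move=> /(_ ltac:(lia) hF).
  case: (digf _ _ _ _ _) => [[I'' F''] O''] [c'' l'' r'']; exists c'' => //.
  apply: (@runs_le _ _ _ _ (k1 * N.+1 + (20 * N.+1 + k2 * N.+1 ^ 2)).+3); last by apply: fit; move: (k2 * N.+1 ^ 2)%N => Y; lia.
  apply: read_bit_runs; rewrite /= eb1; apply: read_bit_runs; rewrite /= -?eI1 eb2 /setI /= -?eI2.
  apply: read_bit_runs; rewrite /= eb3 /setI /=.
  have [_ _ _ i1 _] := inst (St (behead I2) F P Q O) c 0.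
  apply: runs_seq.
    exact: (node (St (behead I2) F P Q O) tneg _ c 0 (bd _ _ _ _ hF) ltac:(simpl; auto 10) hc (leq0n N) i1).
  apply: runs_seq r''; rewrite /put /=.
  exact: (next_node_runs hi S L (s := St (behead I2) F P Q _) 0 hF hc).
- have := digs (behead (behead I2)) c F O.
  move=> /(_ ltac:(lia) hc).
  case: (digf _ _ _ _ _) => [[I'' F''] O''] [c'' l'' r'']; exists c'' => //.
  apply: (@runs_le _ _ _ _ (k2 * N.+1 ^ 2).+4); last by apply: fit; move: (k2 * N.+1 ^ 2)%N => Y; lia.
  apply: read_bit_runs; rewrite /= eb1; apply: read_bit_runs; rewrite /= -?eI1 eb2 /setI /= -?eI2.
  by apply: read_bit_runs; rewrite /= eb3; apply: read_bit_runs; rewrite /= eb4.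
- exists c => //.
  apply: (@runs_le _ _ _ _ (k1 * N.+1).+4); last by apply: fit; move: (k2 * N.+1 ^ 2)%N => Y; lia.
  apply: read_bit_runs; rewrite /= eb1; apply: read_bit_runs; rewrite /= -?eI1 eb2 /setI /= -?eI2.
  apply: read_bit_runs; rewrite /= eb3; apply: read_bit_runs; rewrite /= eb4 /setI /=.
  have [_ _ _ _ [_ i1]] := inst (St (behead (behead I2)) F P Q O) c 0.
  exact: (node (St (behead (behead I2)) F P Q O) tzero _ c 0 (bd _ _ _ _ hF) ltac:(simpl; auto 10) hc (leq0n N) i1).
Qed.

Definition finish_step (s : st) : st :=
  if sP s is [::] then St (sI s) (sF s) [::] (sQ s).-1 (sO s ++ last_bits (sQ s)) else s.

Definition formula_step (s : st) : st :=
  let I := sI s in let F := sF s in let P := sP s in let Q := sQ s in let O := sO s in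
  let I2 := behead (behead I) in
  if head false I then
    St I2 F P (if (0 < Q)%N then Q.+1 else Q) (O ++ [:: true; head false (behead I)])
  else St I2 F.+2 [:: F, F.+1 & P] Q (O ++ head_of std hi S L F Q).

(** Defined on arbitrary words, also on those that encode no sentence, because the machine has to
    halt in polynomial time on every input. *)
Definition stepf (s : st) : st :=
  if sI s is [::] then s
  else if sP s is c :: P then
    finish_step (term_step c (St (sI s) (sF s) P (sQ s) (sO s)))
  else formula_step s.

Lemma finish_runs k N s : last_bound k -> bounded N s ->
  runs (finish std) (memC s 0 0) true (memC (finish_step s) 0 0) ((k + 4) * N.+1).
Proof.
move=> hk hb.
rewrite /finish_step; case: s hb => I F [|c P] Q O hb /=.
- apply: (@runs_le _ _ _ _ (k * N.+1 + 2).+1); last by nia.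
  apply: runs_caseE => //; apply: runs_seq (hk N _ hb) _; rewrite /put /=.
  case: Q hb => [|Q] hb.
  + by apply: runs_caseE => //; apply: runs_ret.
  + apply: (@runs_caseB 9 _ _ _ _ true (nseq Q true)) => //.
    apply: runs_eq (runs_ret _ _) _.
    by apply: functional_extensionality; do 16 (case; [by []|]).
- apply: (@runs_le _ _ _ _ 2); last by nia.
  have [x [l el]] : exists x l, pending (c :: P) = x :: l.
    by rewrite /pending /= /mark; case: (c) => [|c'] /=; eexists; eexists.
  apply: (@runs_caseB 8 _ _ _ _ x l); first exact: el.
  have e : upd (upd (memC (St I F (c :: P) Q O) 0 0) 8 l) 8 (x :: l) = memC (St I F (c :: P) Q O) 0 0.
    apply: functional_extensionality; do 8 (case; [by []|]).
    case; first by rewrite /upd /memC /= -el.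
    by do 7 (case; [by []|]).
  by case: x {el} e => e; apply: runs_eq (runs_push _ _ _) _.
Qed.

(** * Potentials that bound the registers *)

Lemma digf_size Q I c F O (r := digf Q I c F O) :
  (r.1.2 + 2 * size r.1.1 <= F + 2 * size I)%N /\ (size r.1.1 <= size I)%N.
Proof.
rewrite {}/r; have [n] := ubnP (size I).
elim: n I c F O => // n IH [|[] I] c F O hn /=; [lia | | by rewrite /=; lia].
rewrite /= ltnS in hn.
have sI2 : (size (if I is _ :: I2 then I2 else I) <= size I)%N by case: (I) => //= *; lia.
have [h1 h2] := IH (if I is _ :: I2 then I2 else I) F F.+1
  (O ++ node_bits Q (ndig S (head false I) c F)) (leq_ltn_trans sI2 hn).
by move: h1 h2 sI2; case: (digf _ _ _ _ _) => [[I' F'] O'] /=; lia.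
Qed.

Lemma size_mark i : size (mark i) = i.+1.
Proof. by rewrite size_cat size_nseq addn1. Qed.

Lemma size_pending_cons c P : size (pending (c :: P)) = c.+1 + size (pending P).
Proof. by rewrite /pending /= size_cat -/(mark c) size_mark. Qed.

(** Unread input has weight 2 because a single last bit may be read as a binary operation whose
    second bit is missing; it then pays for two fresh variables. *)
Lemma term_step_size c s (s' := term_step c s) : sI s != [::] ->
  [/\ (size (sI s') < size (sI s))%N, (sF s' + 2 * size (sI s') <= sF s + 2 * size (sI s))%N,
      sQ s' = sQ s & (size (pending (sP s')) <= size (pending (sP s)) + 2 * sF s + 3)%N].
Proof.
case: s @s' => [[|b I] F P Q O] //= _; rewrite /term_step /=.
have hI := size_behead_le I; have hI3 := size_behead_le (behead I).
have hI4 := size_behead_le (behead (behead I)).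
case: b.
  by split=> //=; rewrite ?size_pending_cons; lia.
case: (head false I).
- case h3: (head false (behead I)).
    have hs : (size (behead (behead I)) < size (behead I))%N by case: (behead I) h3.
    have [] := digf_size Q (behead (behead I)) F F.+1 (O ++ node_bits Q (nneg c F)).
    by case: (digf _ _ _ _ _) => [[I' F'] O'] /= h1 h2; split=> //=; lia.
  case: ifP => _; last by split=> //=; lia.
  have [] := digf_size Q (behead (behead (behead I))) c F O.
  by case: (digf _ _ _ _ _) => [[I' F'] O'] /= h1 h2; split=> //=; lia.
- by split=> //=; rewrite ?size_drop; lia.
Qed.

(** Growth of a register is traded against unread input. The weight [2 * B + 3] pays for the marks
    of two variables, [2 * sF s + 3] symbols, which one token may push. *)
Definition inv (B : nat) (s : st) : Prop :=
  [/\ hi <= B, S + L <= B, sF s + 2 * size (sI s) <= B, sQ s + size (sI s) <= B &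
      size (pending (sP s)) + (2 * B + 3) * size (sI s) <= (2 * B + 3) * B.+1]%N.

Lemma stepf_inv B s : sI s != [::] -> inv B s ->
  inv B (stepf s) /\ (size (sI (stepf s)) < size (sI s))%N.
Proof.
move=> hI [b1 b2 b3 b4 b5]; rewrite /stepf.
case eI: (sI s) hI => [|b I] // _; rewrite -eI.
case eP: (sP s) => [|c P].
  rewrite /inv /formula_step /= !eI /=; rewrite eI /= in b3 b4 b5; rewrite eP /= in b5.
  have hI := size_behead_le I.
  have hm : ((2 * B + 3) * (size (behead I)).+1 <= (2 * B + 3) * (size I).+1)%N.
    by rewrite leq_mul2l ltnS hI orbT.
  rewrite mulnS in hm.
  case: b {eI} => /=; split; [split=> //| lia | split=> //| lia]; try lia.
  - by case: ifP => _; lia.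
  - by rewrite eP [size _]/=; lia.
  - by rewrite eP !size_pending_cons [size (pending [::])]/=; lia.
set s1 := St _ _ _ _ _.
have [|h1 h2 h3 h4] := @term_step_size c s1; first by rewrite /s1 eI.
rewrite /= in h1 h2 h3 h4.
have hp : size (pending (sP s)) = c.+1 + size (pending P).
  by rewrite eP size_pending_cons.
have pp : (size (pending (sP (term_step c s1))) + (2 * B + 3) * size (sI (term_step c s1))
    <= (2 * B + 3) * B.+1)%N.
  apply: leq_trans b5; rewrite hp.
  have : ((2 * B + 3) * (size (sI (term_step c s1))).+1 <= (2 * B + 3) * size (sI s))%N.
    by rewrite leq_mul2l h1 orbT.
  by rewrite mulnS; lia.
rewrite /finish_step; case eP1: (sP (term_step c s1)) => [|c' P'].
- by split; [split=> //=; rewrite ?h3; try lia; apply: leq_trans pp; rewrite eP1 | rewrite /=].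
- by split; [split=> //; rewrite ?h3; lia | ].
Qed.

Lemma body_runs ka kb k3 N s : tnodes_bound ka -> last_bound kb -> head_bound k3 ->
  sI s != [::] ->
  hi <= N -> S + L <= N -> sF s + 2 * size (sI s) <= N -> sQ s <= N ->
  size (pending (sP s)) <= N ->
  runs (body std) (memC s 0 0) true (memC (stepf s) 0 0)
    ((2 * ka + kb + k3 + 200) * N.+1 ^ 2).
Proof.
move=> ha hb' h3; have h1 N' c s' := @term_core_runs ka N' c s' ha.
have h2 N' s' := @finish_runs kb N' s' hb'.
set k1 := 2 * ka + 90 in h1; set k2 := kb + 4 in h2.
have -> : 2 * ka + kb + k3 + 200 = k1 + k2 + k3 + 106 by rewrite /k1 /k2; lia.
case: s => [[|b I] F P Q O] //= _ hh hS hF hQ hp.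
set s := St _ _ _ _ _.
have X1 : (N.+1 <= N.+1 ^ 2)%N by rewrite expnS expn1 leq_pmulr.
have fit j : (j <= k1 * N.+1 ^ 2 + k3 * N.+1 ^ 2 + (k2 + 90) * N.+1)%N ->
    (j + 4 <= (k1 + k2 + k3 + 106) * N.+1 ^ 2)%N.
  have := leq_mul (leqnn (k2 + 90)) X1; move: (N.+1 ^ 2)%N X1 => Y; nia.
have hb : bounded N s by split=> //=; lia.
suff tk : exists2 j, (j <= k1 * N.+1 ^ 2 + k3 * N.+1 ^ 2 + (k2 + 90) * N.+1)%N &
    runs (token std) (memC s 0 0) true (memC (stepf s) 0 0) (j + 1).
  have [j hj hr] := tk; apply: runs_le (fit j hj).
  apply: (@runs_le _ _ _ _ (1 + (j + 1)).+1); last lia.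
  apply: (@runs_caseB 1 _ _ _ _ b I) => //.
  rewrite upd_memI; have e : upd (memC (setI s I) 0 0) 1 (b :: I) = memC s 0 0 by rewrite upd_memI.
  by case: (b) e => e; apply: runs_seq (runs_push _ _ _) _; rewrite e.
have ret c b' m j : runs c (memC s 0 0) b' m j ->
   runs (SSeq c (SRet true)) (memC s 0 0) true m (j + 1).
  by move=> h; apply: runs_seq h (runs_ret _ _).
rewrite /stepf /=; case: P @s hp hb ret => [|c P] s hp hb ret.
- rewrite /formula_step /=.
  case: b @s hb ret => s hb ret.
  + exists 12; first by lia.
    apply: (ret _ true); apply: runs_caseE => //.
    apply: (@runs_le _ _ _ _ (2 + (3 + 3)).+1) => //.
    apply: read_bit_runs; rewrite /= /setI /=.
    apply: runs_seq (emit_runs _ _) _; rewrite out_memC /put /=.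
    apply: (@runs_seq _ _ _ true
      (memC (St (behead I) F [::] Q (O ++ [:: true; head false I])) 0 0)).
      apply: read_bit_runs; rewrite /= /setI /=.
      have -> : (if head false I then emit [:: true] else emit [:: false])
              = emit [:: head false I] by case: (head _ _).
      apply: runs_eq (emit_runs _ _) _.
      by rewrite out_memC /put /= -catA.
    apply: (@if_psi_runs _ _ _ _ _ 1); first exact: is_unary_nseq.
    rewrite /= size_nseq; case: ifP => _; last exact: runs_ret.
    apply: runs_eq (runs_push _ _ _) _.
    by apply: functional_extensionality; do 16 (case; [by []|]).
  + exists (k3 * N.+1 ^ 2 + 30 * N.+1 + 6); first by move: (N.+1 ^ 2)%N => Y; nia.
    apply: (ret _ true).
    apply: (@runs_le _ _ _ _ (2 + (k3 * N.+1 ^ 2 + 30 * N.+1)).+2); last lia.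
    apply: runs_caseE => //; apply: read_bit_runs; rewrite /= /setI /=.
    apply: (@runs_seq _ _ _ true (memC (St (behead I) F [::] Q O) 0 0)).
      by apply: read_bit_runs; rewrite /= /setI /=; case: (head _ _); apply: runs_ret.
    have hb2 : bounded N (St (behead I) F [::] Q O) by split=> //=; lia.
    apply: runs_seq (h3 N _ hb2) _.
    have hF' : (F <= N)%N by lia.
    exact: (@push_children_runs hi S L (put (St (behead I) F [::] Q O) _) 0 0 N hF').
- pose s1 := St (b :: I) F P Q O.
  have hc : (c < N)%N by move: hp; rewrite size_pending_cons; lia.
  have hb1 : bounded N s1 by split=> //=; lia.
  have [c' hc' r1] := h1 N c s1 hb1 ltac:(rewrite /=; lia) (ltnW hc).
  have r2 := clear_node_runs hi S L (term_step c s1) 0 hc'.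
  have [//|z1 z2 z3 z4] := @term_step_size c s1.
  have hb3 : bounded N (term_step c s1).
    by split=> //; [rewrite /= in z2; lia | rewrite z3].
  have r3 := h2 N _ hb3.
  have popr := @read_unary_runs 8 6 (memC s 0 0) (mark c ++ pending P) isT erefl.
  have ix : index false (mark c ++ pending P) = c.
    by elim: (c) => //= c0 /= ->.
  have dr : drop c.+1 (mark c ++ pending P) = pending P.
    by rewrite drop_size_cat // size_mark.
  rewrite ix dr in popr.
  have em : upd (upd (memC s 0 0) 8 (pending P)) 6 (nseq c true ++ memC s 0 0 6) = memC s1 c 0.
    apply: functional_extensionality; do 6 (case; [by []|]).
    case; first by rewrite /upd /= cats0.
    by do 9 (case; [by []|]).
  rewrite em in popr.
  have sm : (size (mark c ++ pending P) <= N)%N by exact: hp.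
  have rt := runs_seq popr (runs_seq r1 (runs_seq r2 r3)).
  exists (2 * N.+1 + (k1 * N.+1 ^ 2 + (3 * N.+1 + k2 * N.+1)) + 2).
    by move: (N.+1 ^ 2)%N => Y; nia.
  apply: (ret _ true).
  have [x [l el]] : exists x l, pending (c :: P) = x :: l.
    by rewrite /pending /= /mark; case: (c) => [|c0] /=; eexists; eexists.
  have e : upd (upd (memC s 0 0) 8 l) 8 (x :: l) = memC s 0 0.
    apply: functional_extensionality; do 8 (case; [by []|]).
    case; first by rewrite /upd /memC /= -el.
    by do 7 (case; [by []|]).
  apply: (@runs_le _ _ _ _ (1 + (2 * (size (mark c ++ pending P)).+1 +
     (k1 * N.+1 ^ 2 + (3 * N.+1 + k2 * N.+1)))).+1); last first.
    by move: (k1 * N.+1 ^ 2)%N (k2 * N.+1)%N => Y Z; lia.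
  apply: (@runs_caseB 8 _ _ _ _ x l); first exact: el.
  by case: x {el} e => e; apply: runs_seq (runs_push _ _ _) _; rewrite e.
Qed.

Lemma iter_stepf_nil n s : sI s = [::] -> iter n stepf s = s.
Proof. by move=> e; elim: n => //= n ->; rewrite /stepf e. Qed.

(** [(2 * B + 3) * B.+1 + B] bounds all registers at once, the stack of pending variables included.
    The step from 200 to 202 pays for the last round, which finds the input empty. *)
Lemma main_loop_runs ka kb kc n s B :
  tnodes_bound ka -> last_bound kb -> head_bound kc ->
  (size (sI s) <= n)%N -> inv B s ->
  runs (SLoop (body std)) (memC s 0 0) true (memC (iter n stepf s) 0 0)
    ((2 * ka + kb + kc + 202) * (n.+1 * ((2 * B + 3) * B.+1 + B).+1 ^ 2)).
Proof.
move=> ha hb hc; have hk N s' := @body_runs ka kb kc N s' ha hb hc.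
rewrite (_ : 202 = 200 + 2) // addnA; move: (2 * ka + kb + kc + 200) hk => k hk.
elim: n s => [|n IH] s hn hi_.
all: have stop : sI s = [::] -> runs (SLoop (body std)) (memC s 0 0) true (memC s 0 0) 2
  by move=> e; apply: runs_stop; apply: runs_caseE; [exact: e | apply: runs_ret].
- have e : sI s = [::] by case: (sI s) hn.
  by apply: runs_le (stop e) _; rewrite mul1n; have := expn_gt0 ((2 * B + 3) * B.+1 + B).+1 2; nia.
case: (eqVneq (sI s) [::]) => [e|ne].
  rewrite (iter_stepf_nil n.+1 e); apply: runs_le (stop e) _.
  by have := expn_gt0 ((2 * B + 3) * B.+1 + B).+1 2; nia.
have [inv' lt'] := stepf_inv ne hi_.
rewrite iterSr.
have r2 := IH (stepf s) ltac:(lia) inv'.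
case: hi_ => b1 b2 b3 b4 b5.
have r1 := hk ((2 * B + 3) * B.+1 + B)%N s ne ltac:(lia) ltac:(lia) ltac:(lia) ltac:(lia) ltac:(lia).
apply: runs_le (runs_go r1 r2) _.
by rewrite [in X in (_ <= X)%N]mulSn mulnDr leq_add2r leq_mul2r leq_addr orbT.
Qed.

End Semantics.

(** * The program on encoded sentences *)

Section Parsing.

Variables (std : bool) (hi S L : nat).

Local Notation step := (stepf std hi S L).
Local Notation node_bits := (node_bits std hi S L).
Local Notation digf := (digf std hi S L).
Local Notation enc_l := (enc_latom std hi).

(** The number of steps is left open: [step] is stationary once the input is used up, so
    [reach_iter] can replace it by the length of the input. *)
Definition reach (s s' : st) : Prop := exists k, iter k step s = s'.

Lemma reach_trans s1 s2 s3 : reach s1 s2 -> reach s2 s3 -> reach s1 s3.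
Proof. by move=> [k1 <-] [k2 <-]; exists (k2 + k1); rewrite iterD. Qed.

Lemma reach_step s s' : step s = s' -> reach s s'.
Proof. by move=> <-; exists 1. Qed.

Definition nodes_bits (Q : nat) (l : seq node) : seq bool := flatten (map (node_bits Q) l).

Lemma nodes_bits_cat Q l1 l2 : nodes_bits Q (l1 ++ l2) = nodes_bits Q l1 ++ nodes_bits Q l2.
Proof. by rewrite /nodes_bits map_cat flatten_cat. Qed.

Lemma digf_enc Q p c F O rest :
  digf Q (enc_pos p ++ rest) c F O =
  (rest, F + dig_alloc p, O ++ nodes_bits Q (dig_nodes S c F p)).
Proof.
rewrite /enc_pos -catA; elim: p c F O => [q IH|q IH|] c F O /=.
- by rewrite IH addSnnS /nodes_bits /= catA.
- by rewrite IH addSnnS /nodes_bits /= catA.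
- by rewrite addn1 /nodes_bits /= cats0 catA.
Qed.

Lemma index_unary i rest : index false (enc_unary i ++ rest) = i.
Proof. by rewrite /enc_unary -catA; elim: i => //= i ->. Qed.

Lemma drop_unary i rest : drop i.+1 (enc_unary i ++ rest) = rest.
Proof. by rewrite drop_size_cat // size_cat size_nseq addn1. Qed.

(** [finish_step] occurs in the target since the last token of a term also decides whether the atom
    is complete; while other variables are pending it is the identity. *)
Lemma term_reach t c F P Q O rest :
  reach (St (enc_term t ++ rest) F (c :: P) Q O)
    (finish_step std hi S (St rest (F + talloc t) P Q (O ++ nodes_bits Q (nodes S c F t)))).
Proof.
elim: t c F P O rest => [i|z|a IHa b IHb|a IHa b IHb] c F P O rest.
- apply: reach_step; rewrite /stepf /= /term_step /=.
  by rewrite index_unary drop_unary addn0 /nodes_bits /= cats0.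
- apply: reach_step; rewrite /stepf /= /term_step /=; case: z => [|p|p] /=.
  + by rewrite addn0 /nodes_bits /= cats0.
  + by rewrite digf_enc.
  + by rewrite digf_enc /= addSnnS /nodes_bits /= catA.
- have eF : F + talloc (TAdd a b) = F.+2 + talloc a + talloc b by rewrite /=; lia.
  have eO : O ++ nodes_bits Q (nodes S c F (TAdd a b))
      = ((O ++ node_bits Q (nadd c F)) ++ nodes_bits Q (nodes S F F.+2 a))
        ++ nodes_bits Q (nodes S F.+1 (F.+2 + talloc a) b).
    by rewrite -!catA -nodes_bits_cat.
  rewrite eF eO; apply: reach_trans (IHb _ _ _ _ _).
  apply: reach_trans (IHa F F.+2 (F.+1 :: P) _ _).
  by apply: reach_step; rewrite /stepf /= /term_step /= -catA.
- have eF : F + talloc (TMul a b) = F.+2 + talloc a + talloc b by rewrite /=; lia.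
  have eO : O ++ nodes_bits Q (nodes S c F (TMul a b))
      = ((O ++ node_bits Q (nmul S c F)) ++ nodes_bits Q (nodes S F F.+2 a))
        ++ nodes_bits Q (nodes S F.+1 (F.+2 + talloc a) b).
    by rewrite -!catA -nodes_bits_cat.
  rewrite eF eO; apply: reach_trans (IHb _ _ _ _ _).
  apply: reach_trans (IHa F F.+2 (F.+1 :: P) _ _).
  by apply: reach_step; rewrite /stepf /= /term_step /= -catA.
Qed.

Lemma nodes_bits_links Q l : nodes_bits Q l =
  enc_links std hi (Q == 0) (flatten (map (node_atoms (0 < Q)%N (S + L)) l)).
Proof. by elim: l => //= nd l IH; rewrite enc_links_cat -IH. Qed.

Lemma atom_reach a F Q O rest :
  reach (St (false :: enc_tatom a ++ rest) F [::] Q O)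
    (St rest (F + aalloc a) [::] Q.-1
       (O ++ enc_qf enc_l (red_atom (0 < Q)%N S L F a))).
Proof.
have main t u tag : tatom_sides a = (t, u) ->
  reach (St [:: false, tag & enc_term t ++ enc_term u ++ rest] F [::] Q O)
    (St rest (F + aalloc a) [::] Q.-1 (O ++ enc_qf enc_l (red_atom (0 < Q)%N S L F a))).
  move=> ea.
  apply: reach_trans; first by apply: reach_step; rewrite /stepf /= /formula_step /=; reflexivity.
  apply: reach_trans (term_reach _ _ _ _ _ _ _) _; rewrite {1}/finish_step /=.
  apply: reach_trans (term_reach _ _ _ _ _ _ _) _; rewrite /finish_step /=.
  exists 0; rewrite /=; congr St.
  - by rewrite /aalloc ea /=; lia.
  - rewrite -!catA; congr cat.
    rewrite [X in _ ++ X = _]catA -nodes_bits_cat.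
    have -> : nodes S F F.+2 t ++ nodes S F.+1 (F.+2 + talloc t) u = atom_nodes S F a.
      by rewrite /atom_nodes ea.
    rewrite nodes_bits_links /head_of /last_bits /red_atom.
    case: posnP => _.
    + by rewrite enc_disj /phi_atoms enc_links_cat catA.
    + by rewrite enc_conj /psi_atoms catA -enc_links_cat.
by case: a main => t u main; rewrite /= -catA; apply: main.
Qed.

(** A subformula of Psi settles one pending subformula; within Phi the count is 0 and [Q.-1] leaves
    it there. *)
Definition qf_reaches (f : qf tatom) : Prop := forall F Q O rest,
  reach (St (enc_qf enc_tatom f ++ rest) F [::] Q O)
    (St rest (F + qalloc f) [::] Q.-1
       (O ++ enc_qf enc_l (red_qf (0 < Q)%N S L F f))).

Lemma conn_reach g1 g2 b F Q O rest : qf_reaches g1 -> qf_reaches g2 ->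
  reach (St ([:: true, b & enc_qf enc_tatom g1 ++ enc_qf enc_tatom g2 ++ rest]) F [::] Q O)
    (St rest (F + (qalloc g1 + qalloc g2)) [::] Q.-1
      (O ++ [:: true, b & enc_qf enc_l (red_qf (0 < Q)%N S L F g1) ++
         enc_qf enc_l (red_qf (0 < Q)%N S L (F + qalloc g1) g2)])).
Proof.
move=> h1 h2.
apply: reach_trans; first by apply: reach_step; rewrite /stepf /= /formula_step /=; reflexivity.
apply: reach_trans (h1 _ _ _ _) _.
have -> : (if (0 < Q)%N then Q.+1 else Q).-1 = Q by case: (Q).
have -> : (0 < (if (0 < Q)%N then Q.+1 else Q))%N = (0 < Q)%N by case: (Q).
apply: reach_trans (h2 _ _ _ _) _; exists 0 => /=.
by rewrite addnA -!catA.
Qed.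

Lemma qf_reach f : qf_reaches f.
Proof.
elim: f => [a|f IHf g IHg|f IHf g IHg] F Q O rest.
- exact: atom_reach.
- by rewrite /= -catA; apply: conn_reach.
- by rewrite /= -catA; apply: conn_reach.
Qed.

Lemma iter_stepf_done B n s : inv hi S L B s -> (size (sI s) <= n)%N ->
  sI (iter n step s) = [::].
Proof.
elim: n s => [|n IH] s hs hn; first by case: (sI s) hn.
case: (eqVneq (sI s) [::]) => [e|ne]; first by rewrite iter_stepf_nil.
have [hs' lt'] := stepf_inv std ne hs.
by rewrite iterSr; apply: IH => //; lia.
Qed.

Lemma reach_iter B n s s' : inv hi S L B s -> (size (sI s) <= n)%N ->
  reach s s' -> sI s' = [::] -> iter n step s = s'.
Proof.
move=> hs hn [k ek] e'.
have e1 := iter_stepf_nil std hi S L k (iter_stepf_done hs hn).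
have e2 := iter_stepf_nil std hi S L n e'.
by rewrite -e1 -iterD addnC iterD ek e2.
Qed.

End Parsing.

(** * Reading the header and setting up the registers *)

Definition load_input : scmd :=
  SLoop (SCase 0 (SRet false) (SSeq (SPush 1 false) (SPush 14 true))
    (SSeq (SPush 1 true) (SPush 14 true))).

Definition read_tag : scmd :=
  read_bit (SSeq (emit [:: false]) (read_bit (emit [:: false]) (emit [:: true])))
    (SSeq (emit [:: true]) (SPush 9 true)).

(** The unary number is left in the output without its end mark, so that the second dimension can
    still be extended by the new variables. Register 3 accumulates the sum of both dimensions. *)
Definition read_dim : scmd :=
  SSeq (read_unary 1 7) (SSeq (copy 7 12 [:: 0; 3]) (dump 7 [::])).

(** Starts with S = m + n in register 3 and L in register 14. Register 2 gets the total
    [S + (L + L).+1], register 4 the index of delta and register 5 the one after it. *)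
Definition set_registers : scmd :=
  SSeq (copy 14 12 [:: 0; 2; 4; 5]) (SSeq (copy 14 12 [:: 0; 2])
    (SSeq (copy 3 12 [:: 2; 4; 5]) (SSeq (SPush 0 true) (SSeq (SPush 2 true)
      (SSeq (SPush 5 true) (emit [:: false])))))).

Definition init : scmd :=
  SSeq load_input (SSeq read_tag (SSeq read_dim (SSeq (emit [:: false])
    (SSeq read_dim set_registers)))).

Definition reduction (std : bool) : scmd := SSeq init (SLoop (body std)).

Definition memI (O I : seq bool) (h s d f v q l : nat) : mem := fun j => nth [::]
  [:: O; I; nseq h true; nseq s true; nseq d true; nseq f true; [::]; nseq v true; [::];
      nseq q true; [::]; [::]; [::]; [::]; nseq l true; [::]] j.

Ltac mem_cases := apply: functional_extensionality;
  do 16 (case; [by rewrite /out /upd /pushed /memI /= -?nseqD ?cats0 -?catA|]); by [].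

Lemma load_input_runs O I l :
  runs load_input (memI O I 0 0 0 0 0 0 l) true (memI [::] (rev O ++ I) 0 0 0 0 0 0 (size O + l))
    (3 * (size O).+1).
Proof.
elim: O I l => [|b O IH] I l.
  apply: (@runs_le _ _ _ _ 2) => //; apply: runs_stop; apply: runs_caseE => //.
  exact: runs_ret.
have st : runs (SCase 0 (SRet false) (SSeq (SPush 1 false) (SPush 14 true))
    (SSeq (SPush 1 true) (SPush 14 true))) (memI (b :: O) I 0 0 0 0 0 0 l) true
    (memI O (b :: I) 0 0 0 0 0 0 l.+1) 3.
  apply: (@runs_caseB 0 _ _ _ _ b O) => //.
  have e : upd (upd (upd (memI (b :: O) I 0 0 0 0 0 0 l) 0 O) 1 (b :: I)) 14
      (true :: nseq l true) = memI O (b :: I) 0 0 0 0 0 0 l.+1 by mem_cases.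
  by case: b e => e; apply: runs_eq (runs_seq (runs_push _ _ _) (runs_push _ _ _)) e.
apply: runs_le (runs_eq (runs_go st (IH _ _)) _) _; last by rewrite /=; lia.
by rewrite rev_cons cat_rcons /= addnS.
Qed.

Lemma memI_read_bit c0 c1 O I s q l b m' N :
  runs (if head false I then c1 else c0) (memI O (behead I) 0 s 0 0 0 q l) b m' N ->
  runs (read_bit c0 c1) (memI O I 0 s 0 0 0 q l) b m' N.+1.
Proof.
case: I => [|x I] /= h; first exact: runs_caseE.
apply: (@runs_caseB 1 _ _ _ _ x I) => //.
have -> : upd (memI O (x :: I) 0 s 0 0 0 q l) 1 I = memI O I 0 s 0 0 0 q l by mem_cases.
by case: (x) h.
Qed.

Lemma memI_out O I h s d f v q l bs :
  out (memI O I h s d f v q l) bs = memI (rev bs ++ O) I h s d f v q l.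
Proof. by mem_cases. Qed.

Definition tag_bits (w : seq bool) : seq bool :=
  if head false w then [:: true] else [:: false; head false (behead w)].

Definition after_tag (w : seq bool) : seq bool :=
  if head false w then behead w else behead (behead w).

Lemma read_tag_runs w l :
  runs read_tag (memI [::] w 0 0 0 0 0 0 l) true
    (memI (rev (tag_bits w)) (after_tag w) 0 0 0 0 0 (head false w) l) 8.
Proof.
rewrite /tag_bits /after_tag; apply: (@runs_le _ _ _ _ (2 + 3).+1) => //.
apply: memI_read_bit; case: (head false w).
- apply: (@runs_le _ _ _ _ (2 + 1)) => //.
  apply: runs_seq (emit_runs _ _) _; rewrite memI_out.
  by apply: runs_eq (runs_push _ _ _) _; mem_cases.
- apply: runs_seq (emit_runs _ _) _; rewrite memI_out.
  apply: memI_read_bit.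
  have -> : (if head false (behead w) then emit [:: true] else emit [:: false])
     = emit [:: head false (behead w)] by case: (head _ _).
  by apply: runs_eq (emit_runs _ _) _; rewrite memI_out.
Qed.

Lemma read_dim_runs O I s q l :
  runs read_dim (memI O I 0 s 0 0 0 q l) true
    (memI (nseq (index false I) true ++ O) (drop (index false I).+1 I) 0
       (index false I + s) 0 0 0 q l) (15 * (size I).+1).
Proof.
set k := index false I.
have hk : (k <= size I)%N := index_size false I.
have h1 := @read_unary_runs 1 7 (memI O I 0 s 0 0 0 q l) I isT erefl.
have e1 : upd (upd (memI O I 0 s 0 0 0 q l) 1 (drop (index false I).+1 I)) 7
    (nseq (index false I) true ++ memI O I 0 s 0 0 0 q l 7)
  = memI O (drop k.+1 I) 0 s 0 0 k q l by mem_cases.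
rewrite e1 in h1.
have h2 := @copy_runs 7 12 [:: 0; 3] (memI O (drop k.+1 I) 0 s 0 0 k q l) isT erefl
  (is_unary_nseq k).
set m2 := pushed _ _ _ in h2.
have h3 := @dump_runs 7 [::] m2 isT isT.
apply: runs_le (runs_eq (runs_seq h1 (runs_seq h2 h3)) _) _; first by rewrite /m2; mem_cases.
by rewrite /m2 /pushed /= !size_nseq; lia.
Qed.

Lemma set_registers_runs O I s q l N : (s <= N)%N -> (l <= N)%N ->
  runs set_registers (memI O I 0 s 0 0 0 q l) true
    (memI (rev (nseq (l + l).+1 true ++ [:: false]) ++ O) I (s + (l + l).+1) s (s + l) (s + l).+1
       0 q l) (50 * N.+1).
Proof.
move=> hs hl.
have h1 := @copy_runs 14 12 [:: 0; 2; 4; 5] (memI O I 0 s 0 0 0 q l) isT erefl (is_unary_nseq l).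
set m1 := pushed _ _ _ in h1.
have h2 := @copy_runs 14 12 [:: 0; 2] m1 isT erefl (is_unary_nseq l).
set m2 := pushed _ _ _ in h2.
have h3 := @copy_runs 3 12 [:: 2; 4; 5] m2 isT erefl (is_unary_nseq s).
apply: runs_le (runs_eq (runs_seq h1 (runs_seq h2 (runs_seq h3 (runs_seq (runs_push _ _ _)
  (runs_seq (runs_push _ _ _) (runs_seq (runs_push _ _ _) (emit_runs _ _))))))) _) _; last first.
  by rewrite /m2 /m1 /pushed /= !size_nseq; lia.
rewrite /m2 /m1 addnS; apply: functional_extensionality; case.
  by rewrite /out /upd /pushed /memI rev_cat rev_nseq /= nseqD -!catA.
case; first by [].
case; first by rewrite /out /upd /pushed /memI /= !nseqD cats0.
case; first by [].
case; first by rewrite /out /upd /pushed /memI /= !nseqD cats0.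
case; first by rewrite /out /upd /pushed /memI /= !nseqD cats0.
by do 10 (case; [by []|]).
Qed.

(** * The whole reduction on words *)

Section Reduction.

Variable std : bool.

Definition dim1 (w : seq bool) := index false (after_tag w).
Definition after_dim1 (w : seq bool) := drop (dim1 w).+1 (after_tag w).
Definition dim2 (w : seq bool) := index false (after_dim1 w).
Definition dims (w : seq bool) := dim1 w + dim2 w.
Definition total (w : seq bool) := dims w + (size w + size w).+1.

Definition start (w : seq bool) : st :=
  St (drop (dim2 w).+1 (after_dim1 w)) (dims w + size w).+1 [::] (head false w)
    (tag_bits w ++ nseq (dim1 w) true ++ [:: false] ++
       nseq (dim2 w + (size w + size w).+1) true ++ [:: false]).

Lemma start_sizes w : [/\ (size (after_tag w) <= size w)%N,
  (size (after_dim1 w) <= size w)%N, (dim1 w <= size w)%N, (dim2 w <= size w)%N &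
  (size (sI (start w)) <= size w)%N].
Proof.
have h1 : (size (after_tag w) <= size w)%N.
  by rewrite /after_tag; case: ifP => _; rewrite !size_behead; lia.
have h2 : (size (after_dim1 w) <= size w)%N by rewrite size_drop; lia.
split=> //.
- exact: (leq_trans (index_size false (after_tag w)) h1).
- exact: (leq_trans (index_size false (after_dim1 w)) h2).
- by rewrite /= size_drop; lia.
Qed.

Lemma init_runs w : runs init (mem_input w) true
  (memC (total w) (dims w) (size w) (start w) 0 0) (300 * (size w).+1).
Proof.
have [z1 z2 z3 z4 _] := start_sizes w.
have e0 : mem_input w = memI (rev w) [::] 0 0 0 0 0 0 0.
  by apply: functional_extensionality; do 16 (case; [exact: erefl|]); move=> j; rewrite /memI /= nth_nil.
have h1 := load_input_runs (rev w) [::] 0.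
rewrite revK cats0 addn0 size_rev in h1.
have h2 := read_tag_runs w (size w).
have h3 := read_dim_runs (rev (tag_bits w)) (after_tag w) 0 (head false w) (size w).
rewrite -/(dim1 w) -/(after_dim1 w) addn0 in h3.
set O1 := _ ++ _ in h3.
have h4 := emit_runs [:: false] (memI O1 (after_dim1 w) 0 (dim1 w) 0 0 0 (head false w) (size w)).
rewrite memI_out in h4.
set O2 := rev [:: false] ++ O1 in h4.
have h5 := read_dim_runs O2 (after_dim1 w) (dim1 w) (head false w) (size w).
rewrite -/(dim2 w) [dim2 w + dim1 w]addnC -/(dims w) in h5.
set O3 := _ ++ O2 in h5.
have h6 := @set_registers_runs O3 (drop (dim2 w).+1 (after_dim1 w)) (dims w) (head false w)
  (size w) (size w + size w) ltac:(rewrite /dims; lia) ltac:(lia).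
rewrite e0; apply: runs_le (runs_eq (runs_seq h1 (runs_seq h2 (runs_seq h3 (runs_seq h4
  (runs_seq h5 h6))))) _) _; last by rewrite /=; lia.
apply: functional_extensionality; case; last by do 15 (case; [by []|]).
rewrite -[LHS]/(rev (nseq (size w + size w).+1 true ++ [:: false]) ++ O3).
rewrite -[RHS]/(rev (tag_bits w ++ nseq (dim1 w) true ++ [:: false] ++
  nseq (dim2 w + (size w + size w).+1) true ++ [:: false])) /O3 /O2 /O1.
move: (size w + size w).+1 => y.
by rewrite !rev_cat !rev_nseq addnC nseqD -!catA.
Qed.

Definition reduction_fun (w : seq bool) : seq bool :=
  sO (iter (size w) (stepf std (total w) (dims w) (size w)) (start w)).

(** The two dimensions and the parameter L are at most [size w] each, and unread input counts twice;
    hence the factor 5. *)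
Lemma start_inv w : inv (total w) (dims w) (size w) (5 * size w + 2) (start w).
Proof.
have [_ _ z3 z4 z5] := start_sizes w; rewrite /= in z5.
split=> /=.
- by rewrite /total /dims; lia.
- by rewrite /dims; lia.
- by rewrite /dims; lia.
- by case: (head false w); lia.
- by rewrite ?add0n leq_mul2l; apply/orP; right; lia.
Qed.

Theorem reduction_poly_time : poly_time_computable reduction_fun.
Proof.
have main : exists k, forall w, runs (reduction std) (mem_input w) true
    (memC (total w) (dims w) (size w)
       (iter (size w) (stepf std (total w) (dims w) (size w)) (start w)) 0 0)
    (k * (size w).+1 ^ 5).
  have [ka ha] := emit_tnodes_runs std; have [kb hb] := emit_last_mem std.
  have [kc hc] := emit_head_mem std.
  (* A linear number of rounds, each quadratic in a register bound that is itself quadratic, gives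
     the exponent 5. The number 3025 is the square of 55 in [b1], and 300 comes from [init_runs]. *)
  exists ((2 * ka + kb + kc + 202) * 3025 + 300) => w.
  have [_ _ _ _ z5] := start_sizes w.
  have h2 := main_loop_runs (ha _ _ _) (hb _ _ _) (hc _ _ _) z5 (start_inv w).
  apply: runs_le (runs_seq (init_runs w) h2) _.
  move: (2 * ka + kb + kc + 202) (size w) => K x.
  have b1 : ((2 * (5 * x + 2) + 3) * (5 * x + 2).+1 + (5 * x + 2)).+1 <= 55 * x.+1 ^ 2.
    by rewrite expnS expn1; nia.
  have b2 : (((2 * (5 * x + 2) + 3) * (5 * x + 2).+1 + (5 * x + 2)).+1 ^ 2 <= 3025 * x.+1 ^ 4)%N.
    by rewrite [X in (X <= _)%N]expnS expn1; apply: leq_trans (leq_mul b1 b1) _; rewrite mulnACA -expnD.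
  have b3 := leq_mul (leqnn K) (leq_mul (leqnn x.+1) b2).
  have b4 : (x.+1 <= x.+1 ^ 5)%N by rewrite -{1}(expn1 x.+1) leq_pexp2l.
  have e5 : x.+1 * (3025 * x.+1 ^ 4) = 3025 * x.+1 ^ 5 by rewrite [in RHS]expnS mulnCA.
  rewrite e5 in b3.
  apply: leq_trans (leq_add (leq_mul (leqnn 300) b4) b3) _.
  by rewrite mulnDl mulnA addnC.
have [k hk] := main.
apply: (@stack_poly_time 15 (reduction std) reduction_fun k 5).
  by case: std; vm_compute.
move=> w; have [t ex lt] := hk w.
by exists true; eexists; exists t; split; [exact: ex | rewrite /memC /= revK |].
Qed.

Lemma tag_dims b1 b2 m n rest : let w := [:: b1, b2 & enc_unary m ++ enc_unary n ++ rest] in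
  b1 = false ->
  [/\ tag_bits w = [:: b1; b2], dim1 w = m, dim2 w = n & sI (start w) = rest].
Proof.
move=> w b1F; have et : after_tag w = enc_unary m ++ enc_unary n ++ rest.
  by rewrite /after_tag /w b1F.
have e1 : dim1 w = m by rewrite /dim1 et index_unary.
have ed : after_dim1 w = enc_unary n ++ rest by rewrite /after_dim1 e1 et drop_unary.
have e2 : dim2 w = n by rewrite /dim2 ed index_unary.
split=> //; first by rewrite /tag_bits /w b1F.
by rewrite /= e2 ed drop_unary.
Qed.

Lemma tag_dims_pp m n rest : let w := true :: enc_unary m ++ enc_unary n ++ rest in
  [/\ tag_bits w = [:: true], dim1 w = m, dim2 w = n & sI (start w) = rest].
Proof.
move=> w; have et : after_tag w = enc_unary m ++ enc_unary n ++ rest by [].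
have e1 : dim1 w = m by rewrite /dim1 et index_unary.
have ed : after_dim1 w = enc_unary n ++ rest by rewrite /after_dim1 e1 et drop_unary.
have e2 : dim2 w = n by rewrite /dim2 ed index_unary.
by split=> //; rewrite /= e2 ed drop_unary.
Qed.

Lemma reduction_reach w s' :
  reach std (total w) (dims w) (size w) (start w) s' -> sI s' = [::] ->
  reduction_fun w = sO s'.
Proof.
move=> h e; have [_ _ _ _ z5] := start_sizes w.
by rewrite /reduction_fun (reach_iter (start_inv w) z5 h e).
Qed.

Lemma reduction_sentence s (w := enc_sentence enc_tatom s) :
  reduction_fun w = enc_sentence (enc_latom std (nvars (red_sentence (size w) s)))
                      (red_sentence (size w) s).
Proof.
have phi_case b m n phi (w' := [:: false, b & enc_unary m ++ enc_unary n ++ enc_qf enc_tatom phi])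
    (l := size w') :
  reduction_fun w' = [:: false, b & enc_unary m ++ enc_unary (n + (l + l).+1) ++
    enc_qf (enc_latom std (m + (n + (l + l).+1)))
      (red_qf false (m + n) l (m + n + l).+1 phi)].
  have := @tag_dims false b m n (enc_qf enc_tatom phi) erefl; rewrite -/w'.
  move=> [et e1 e2 eI].
  have ed : dims w' = m + n by rewrite /dims e1 e2.
  have eh : total w' = m + (n + (l + l).+1) by rewrite /total ed addnA.
  have es : start w' = St (enc_qf enc_tatom phi ++ [::]) (m + n + l).+1 [::] 0
      ([:: false; b] ++ enc_unary m ++ enc_unary (n + (l + l).+1)).
    rewrite cats0 -eI /start et e1 e2 ed /enc_unary /=.
    by rewrite -catA; reflexivity.
  have := @qf_reach std (total w') (dims w') l phi (m + n + l).+1 0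
    ([:: false; b] ++ enc_unary m ++ enc_unary (n + (l + l).+1)) [::].
  rewrite -es => /reduction_reach -> //.
  by rewrite /= eh ed -!catA.
rewrite {}/w; case: s => [m n phi|m n phi|m n psi phi].
- exact: (phi_case false).
- exact: (phi_case true).
set w := enc_sentence _ _; set l := size w.
have [et e1 e2 eI] : [/\ tag_bits w = [:: true], dim1 w = m, dim2 w = n &
    sI (start w) = enc_qf enc_tatom psi ++ enc_qf enc_tatom phi] := tag_dims_pp _ _ _.
have ed : dims w = m + n by rewrite /dims e1 e2.
have eh : total w = m + (n + (l + l).+1) by rewrite /total ed addnA.
set O1 := [:: true] ++ enc_unary m ++ enc_unary (n + (l + l).+1).
have es : start w = St (enc_qf enc_tatom psi ++ enc_qf enc_tatom phi) (m + n + l).+1 [::] 1 O1.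
  by rewrite -eI /start et e1 e2 ed /O1 /enc_unary -catA; reflexivity.
have r1 := @qf_reach std (total w) (dims w) l psi (m + n + l).+1 1 O1 (enc_qf enc_tatom phi).
rewrite -es in r1.
have r2 := @qf_reach std (total w) (dims w) l phi ((m + n + l).+1 + qalloc psi) 0
  (O1 ++ enc_qf (enc_latom std (total w)) (red_qf true (dims w) l (m + n + l).+1 psi)) [::].
rewrite cats0 in r2.
rewrite (reduction_reach (reach_trans r1 r2)) //.
by rewrite /O1 /= eh ed -!catA.
Qed.

End Reduction.

(** * The length of the input as a bound on fresh variables *)

Lemma dig_alloc_le p : (dig_alloc p <= size (enc_pos p))%N.
Proof. by rewrite /enc_pos size_cat /=; elim: p => [q|q|] //=; lia. Qed.

(** Fresh variables are paid for by bits of the encoding: two by the two tag bits of a binary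
    operation, one by the two bits of each digit, one by the sign. *)
Lemma talloc_le t : (talloc t <= size (enc_term t))%N.
Proof.
elim: t => [i|[|p|p]|a IHa b IHb|a IHa b IHb] //=.
- by have := dig_alloc_le p; lia.
- by have := dig_alloc_le p; lia.
- by rewrite size_cat; lia.
- by rewrite size_cat; lia.
Qed.

Lemma qalloc_le f : (qalloc f <= size (enc_qf enc_tatom f))%N.
Proof.
elim: f => [a|f IHf g IHg|f IHf g IHg] /=; rewrite ?size_cat; try lia.
by case: a => t u; rewrite /aalloc /= size_cat; have := talloc_le t; have := talloc_le u; lia.
Qed.

Lemma salloc_le s : (salloc s <= size (enc_sentence enc_tatom s))%N.
Proof.
case: s => [m n phi|m n phi|m n psi phi] /=; rewrite !size_cat; have := qalloc_le phi; try lia.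
by have := qalloc_le psi; lia.
Qed.

Theorem mainTheorem12 :
  forall C : cls,
    (exists g : seq bool -> seq bool, poly_time_computable g /\
       forall s : sentence tatom, in_class tatom_ok C s ->
         exists s' : sentence tatom,
           in_class tatom_ok C s' /\
           sentence_atoms_all (tatom_deg_le (nvars s') 4) s' /\
           g (enc_sentence enc_tatom s) = enc_sentence enc_tatom s' /\
           (sentence_true tatom_holds s' <-> sentence_true tatom_holds s))
    /\
    (exists g : seq bool -> seq bool, poly_time_computable g /\
       forall s : sentence tatom, in_class tatom_ok C s ->
         exists s' : sentence satom,
           in_class satom_ok C s' /\
           g (enc_sentence enc_tatom s) = enc_sentence enc_satom s' /\
           (sentence_true satom_holds s' <-> sentence_true tatom_holds s)).
Proof.
move=> C; split.
- exists (reduction_fun false); split; first exact: reduction_poly_time.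
  move=> s hs; have [h1 h2 h3] := red_tatom_spec hs (salloc_le s).
  exists (red_tatom (size (enc_sentence enc_tatom s)) s); split=> //; split=> //; split=> //.
  by rewrite reduction_sentence /red_tatom enc_sentence_smap.
- exists (reduction_fun true); split; first exact: reduction_poly_time.
  move=> s hs; have [h1 h2] := red_satom_spec hs (salloc_le s).
  exists (red_satom (size (enc_sentence enc_tatom s)) s); split=> //; split=> //.
  by rewrite reduction_sentence /red_satom enc_sentence_smap.
Qed.
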